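(* Let $k$ be a field, $G$ a connected affine smooth algebraic group over $k$, and $S$ a $G$-algebra of finite type over $k$ which is an integral domain. Let $K$ be the integral closure of $k$ in $Q(S)$, and assume that the base change map $X(G)\to X(K\otimes_k G)$ is surjective. Set $A:=S_G$. Assume that if $P$ is a $G$-stable height one prime ideal of $S$ such that $P\cap A$ is a minimal prime of some nonzero principal ideal of $A$, then $P$ is a principal ideal. Then: (i) If $P$ is a $G$-stable height one prime ideal of $S$ such that $P\cap A$ is a minimal prime of a nonzero principal ideal of $A$, then $P=Sf$ for some homogeneous prime element $f$ of $A$. (ii) $A$ is a UFD. (iii) Any homogeneous prime element of $A$ is a prime element of $S$. (iv) If, moreover, $X(G)$ is trivial, then $S^G=A$ is a UFD.
   Context: A $G$-algebra is a commutative $k$-algebra $S$ with a $G$-action, i.e. with a $k[G]$-comodule structure $\omega:S\to S\otimes_k k[G]$ (the coaction) which is a $k$-algebra map. An ideal $I$ of $S$ is $G$-stable if $\omega(I)\subset I\otimes_k k[G]$. $Q(S)$ is the field of fractions of the domain $S$. $X(G)$ is the group of characters $G\to\mathbb G_m$ over $k$, identified with the group-like elements of $k[G]$; for a field extension $K/k$ there is a base change map $X(G)\to X(K\otimes_k G)$. For $\chi\in X(G)$, $S^\chi=\{s\in S\mid \omega(s)=s\otimes\chi\}$, and $S_G:=\bigoplus_{\chi\in X(G)}S^\chi\subset S$ is the $k$-subalgebra generated by the semiinvariants; it is $X(G)$-graded, and ''homogeneous'' refers to this grading. $S^G=\{s\in S\mid\omega(s)=s\otimes 1\}$. *)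

(* Defs.v *)
From HB Require Import structures.
From mathcomp Require Import all_boot all_order all_algebra.
From mathcomp Require Import boolp classical_sets.

Set Implicit Arguments.
Unset Strict Implicit.
Unset Printing Implicit Defensive.

Import GRing.Theory.
Local Open Scope ring_scope.
Local Open Scope quotient_scope.
Local Open Scope classical_set_scope.

Reserved Notation "a ⊗ b" (at level 35, right associativity).

#[short(type="idomAlgType")]
HB.structure Definition DomainAlgebra (R : nzRingType) :=
  { A of GRing.ComAlgebra R A & GRing.IntegralDomain A }.

#[short(type="fieldAlgType")]
HB.structure Definition FieldAlgebra (R : nzRingType) :=
  { A of GRing.ComAlgebra R A & GRing.Field A }.

Section Balanced.
Variables (k : fieldType) (A B : comAlgType k).

Definition balanced (V : zmodType) (f : A -> B -> V) : Prop :=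
  [/\ forall a a' b, f (a + a') b = f a b + f a' b,
      forall a b b', f a (b + b') = f a b + f a b'
    & forall c a b, f (c *: a) b = f a (c *: b)].

Definition formal_eval (V : zmodType) (f : A -> B -> V) (s : seq (A * B)) : V :=
  \sum_(p <- s) f p.1 p.2.

(* [s] stands for the formal sum of the [p.1 ⊗ p.2], [p] in [s]. By the
   universal property of the tensor product two formal sums are equal in it iff
   no balanced map to an abelian group separates them. *)
Definition formal_eq (s t : seq (A * B)) : bool :=
  `[< forall (V : zmodType) (f : A -> B -> V), balanced f ->
        formal_eval f s = formal_eval f t >].

Lemma formal_eq_refl : reflexive formal_eq.
Proof. by move=> s; apply/asboolP. Qed.

Lemma formal_eq_sym : symmetric formal_eq.
Proof.
by move=> s t; apply/asboolP/asboolP => st V f bf; rewrite st.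
Qed.

Lemma formal_eq_trans : transitive formal_eq.
Proof.
move=> t s u /asboolP st /asboolP tu; apply/asboolP => V f bf.
by rewrite st // tu.
Qed.

Canonical formal_eq_equiv :=
  EquivRel formal_eq formal_eq_refl formal_eq_sym formal_eq_trans.

Definition tensor := {eq_quot formal_eq}.
HB.instance Definition _ : EqQuotient _ formal_eq tensor :=
  EqQuotient.on tensor.
HB.instance Definition _ := Choice.on tensor.

Definition tens (a : A) (b : B) : tensor := \pi_tensor [:: (a, b)].

(* Meaningful for balanced [f]: the additive map sending [a ⊗ b] to [f a b]. *)
Definition tlift (V : zmodType) (f : A -> B -> V) (x : tensor) : V :=
  formal_eval f (repr x).

Definition tadd (x y : tensor) : tensor := \pi_tensor (repr x ++ repr y).
Definition topp (x : tensor) : tensor := \pi_tensor [seq (- p.1, p.2) | p <- repr x].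
Definition tzero : tensor := \pi_tensor [::].
Definition tone : tensor := tens 1 1.
Definition tmul (x y : tensor) : tensor :=
  \pi_tensor [seq (p.1 * q.1, p.2 * q.2) | p <- repr x, q <- repr y].

End Balanced.

Section TensorTheory.
Variables (k : fieldType) (A B : comAlgType k).
Local Notation T := (tensor A B).

Section Lift.
Variables (V : zmodType) (f : A -> B -> V).
Hypothesis bf : balanced f.

Lemma bal0l b : f 0 b = 0.
Proof.
by case: bf => D _ _; apply: (addIr (f 0 b)); rewrite -D !add0r.
Qed.

Lemma bal0r a : f a 0 = 0.
Proof.
by case: bf => _ D _; apply: (addIr (f a 0)); rewrite -D !add0r.
Qed.

Lemma balNl a b : f (- a) b = - f a b.
Proof.
by case: (bf) => D _ _; apply: (addIr (f a b)); rewrite -D !addNr bal0l.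
Qed.

Lemma balNr a b : f a (- b) = - f a b.
Proof.
by case: (bf) => _ D _; apply: (addIr (f a b)); rewrite -D !addNr bal0r.
Qed.

Lemma bal_suml (I : Type) (r : seq I) (g : I -> A) b :
  f (\sum_(i <- r) g i) b = \sum_(i <- r) f (g i) b.
Proof.
elim: r => [|i r IH]; first by rewrite !big_nil bal0l.
by case: bf => D _ _; rewrite !big_cons D IH.
Qed.

Lemma bal_sumr (I : Type) (r : seq I) (g : I -> B) a :
  f a (\sum_(i <- r) g i) = \sum_(i <- r) f a (g i).
Proof.
elim: r => [|i r IH]; first by rewrite !big_nil bal0r.
by case: bf => _ D _; rewrite !big_cons D IH.
Qed.

Lemma tlift_pi s : tlift f (\pi_T s) = formal_eval f s.
Proof.
rewrite /tlift; have : repr (\pi_T s) = s %[mod T] by rewrite reprK.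
by move=> /eqmodP /asboolP; apply.
Qed.

Lemma tlift_tens a b : tlift f (tens a b) = f a b.
Proof. by rewrite tlift_pi /formal_eval big_seq1. Qed.

Lemma tlift_tadd (x y : T) : tlift f (tadd x y) = tlift f x + tlift f y.
Proof. by rewrite tlift_pi /formal_eval big_cat. Qed.

Lemma tlift_topp (x : T) : tlift f (topp x) = - tlift f x.
Proof.
rewrite tlift_pi /formal_eval big_map -sumrN.
by apply: eq_bigr => p _; rewrite balNl.
Qed.

Lemma tlift_tzero : tlift f (tzero A B) = 0.
Proof. by rewrite tlift_pi /formal_eval big_nil. Qed.

Lemma tlift_tmul (x y : T) : tlift f (tmul x y) =
  tlift (fun a b => tlift (fun a' b' => f (a * a') (b * b')) y) x.
Proof. by rewrite tlift_pi /formal_eval big_allpairs_dep. Qed.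

Lemma balancedM a0 b0 : balanced (fun a b => f (a0 * a) (b0 * b)).
Proof.
case: bf => Dl Dr Z; split=> [a a' b|a b b'|d a b]; rewrite ?mulrDr ?Dl ?Dr //.
by rewrite -!scalerAr Z.
Qed.

Lemma balancedM2 (y : T) :
  balanced (fun a b => tlift (fun a' b' => f (a * a') (b * b')) y).
Proof.
case: bf => Dl Dr Z; rewrite /tlift /formal_eval.
split=> [a a' b|a b b'|d a b]; rewrite -?big_split /=;
  apply: eq_bigr => p _; rewrite ?mulrDl ?Dl ?Dr //.
by rewrite -!scalerAl Z.
Qed.

End Lift.

Lemma tensorP (x y : T) :
  (forall (V : zmodType) (f : A -> B -> V), balanced f ->
     tlift f x = tlift f y) -> x = y.
Proof.
move=> H; rewrite -[x]reprK -[y]reprK; apply/eqmodP/asboolP.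
exact: H.
Qed.

Fact taddA : associative (@tadd k A B).
Proof. by move=> x y z; apply: tensorP => V f bf; rewrite !tlift_tadd ?addrA. Qed.

Fact taddC : commutative (@tadd k A B).
Proof. by move=> x y; apply: tensorP => V f bf; rewrite !tlift_tadd // addrC. Qed.

Fact tadd0 : left_id (tzero A B) (@tadd k A B).
Proof.
by move=> x; apply: tensorP => V f bf; rewrite tlift_tadd // tlift_tzero // add0r.
Qed.

Fact taddN : left_inverse (tzero A B) (@topp k A B) (@tadd k A B).
Proof.
move=> x; apply: tensorP => V f bf.
by rewrite tlift_tadd // tlift_topp // tlift_tzero // addNr.
Qed.

HB.instance Definition _ := GRing.isZmodule.Build T taddA taddC tadd0 taddN.

Lemma tliftD (V : zmodType) (f : A -> B -> V) (bf : balanced f) (x y : T) :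
  tlift f (x + y) = tlift f x + tlift f y.
Proof. exact: tlift_tadd. Qed.

Lemma tlift0 (V : zmodType) (f : A -> B -> V) (bf : balanced f) :
  tlift f 0 = 0.
Proof. exact: tlift_tzero. Qed.

Lemma tens_balanced : balanced (@tens k A B).
Proof.
split=> *; apply: tensorP => V f bf; case: (bf) => Dl Dr Z;
  by rewrite ?tliftD // !tlift_tens // ?Dl ?Dr ?Z.
Qed.

Lemma tensor_sum (x : T) : x = \sum_(p <- repr x) tens p.1 p.2.
Proof.
apply: tensorP => V f bf; rewrite {1}/tlift /formal_eval.
elim: (repr x) => [|p s IH]; first by rewrite !big_nil tlift0.
by rewrite !big_cons tliftD // tlift_tens // IH.
Qed.

Lemma tlift_sum (V : zmodType) (f : A -> B -> V) (bf : balanced f)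
    (I : Type) (r : seq I) (F : I -> T) :
  tlift f (\sum_(i <- r) F i) = \sum_(i <- r) tlift f (F i).
Proof.
elim: r => [|i r IH]; first by rewrite !big_nil tlift0.
by rewrite !big_cons tliftD // IH.
Qed.

Lemma tmul_tens a b a' b' :
  tmul (tens a b) (tens a' b') = tens (a * a') (b * b') :> T.
Proof.
apply: tensorP => V f bf.
by rewrite tlift_tmul // !tlift_tens //;
  [exact: balancedM | exact: balancedM2].
Qed.

Fact tmulC : commutative (@tmul k A B).
Proof.
move=> x y; apply: tensorP => V f bf; rewrite !tlift_tmul //.
rewrite /tlift /formal_eval exchange_big /=.
by apply: eq_bigr => p _; apply: eq_bigr => q _; rewrite mulrC [X in f _ X]mulrC.
Qed.

Fact tmulD : left_distributive (@tmul k A B) +%R.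
Proof.
move=> x y z; apply: tensorP => V f bf.
by rewrite tliftD // !tlift_tmul // tliftD //; exact: balancedM2.
Qed.

Fact tmulA : associative (@tmul k A B).
Proof.
move=> x y z; apply: tensorP => V f bf.
rewrite !(tlift_tmul bf) (tlift_tmul (balancedM2 bf z)).
rewrite /tlift {1 3}/formal_eval; apply: eq_bigr => p _ /=.
rewrite -/(tlift _ (tmul y z)) (tlift_tmul (balancedM bf p.1 p.2)).
rewrite /tlift /formal_eval; apply: eq_bigr => q _.
by apply: eq_bigr => r _; rewrite !mulrA.
Qed.

Fact tmul1 : left_id (tone A B) (@tmul k A B).
Proof.
move=> x; apply: tensorP => V f bf; rewrite tlift_tmul //.
rewrite /tone tlift_tens; last exact: balancedM2.
by rewrite /tlift /formal_eval; apply: eq_bigr => p _; rewrite !mul1r.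
Qed.

(* A subspace maximal among those avoiding [1] is a hyperplane, which yields a
   linear form mapping [1] to [1]; it is needed to see that [1 ⊗ 1] is not 0. *)
Lemma ex_linear_form (C : comAlgType k) :
  exists l : C -> k, l 1 = 1 /\ forall c x y, l (c *: x + y) = c * l x + l y.
Proof.
pose sub (W : set C) := W 0 /\ forall c x y, W x -> W y -> W (c *: x + y).
pose P (W : set C) := W !=set0 -> sub W /\ ~ W 1.
have [F FP Ftot|W [PW Wmax]] := @Zorn_bigcup C P.
  case=> x0 [X0 FX0 X0x]; split; first split.
  - by exists X0 => //; have [[]] := FP _ FX0 (ex_intro _ x0 X0x).
  - move=> c x y [X FX Xx] [Y FY Yy].
    have [XY|YX] := Ftot X Y FX FY.
      exists Y => //; have [[_ +] _] := FP _ FY (ex_intro _ y Yy).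
      by apply=> //; apply: XY.
    exists X => //; have [[_ +] _] := FP _ FX (ex_intro _ x Xx).
    by apply=> //; apply: YX.
  - by case=> X FX X1; have [_ +] := FP _ FX (ex_intro _ 1 X1); apply.
have [w0 Ww0] : W !=set0.
  have [//|/nonemptyPn W0] := pselect (W !=set0).
  suff : P [set 0] by move=> P0; case: (Wmax [set 0]) => //; rewrite W0; split=> // /(_ 0 erefl).
  move=> _; split; last by move=> /eqP; rewrite oner_eq0.
  by split=> // c x y -> ->; rewrite scaler0 addr0.
have [[W0 Wlin] W1] := PW (ex_intro _ w0 Ww0).
have ex_l x : exists c : k, W (x - c%:A).
  have [|Wx] := pselect (W x); first by exists 0; rewrite scale0r subr0.
  pose W' : set C := [set y | exists c w, W w /\ y = w + c *: x].
  have WW' : W `<` W'.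
    split; first by move=> w Ww; exists 0, w; rewrite scale0r addr0.
    by move=> /(_ x) W'W; apply/Wx/W'W; exists 1, 0; rewrite scale1r add0r.
  have W'1 : W' 1.
    apply: contrapT => W'1; apply: (Wmax _ WW') => _; split=> //; split.
      by exists 0, 0; rewrite scale0r addr0.
    move=> c y z [d [w [Ww ->]]] [e [v [Wv ->]]].
    exists (c * d + e), (c *: w + v); split; first exact: Wlin.
    by rewrite scalerDr scalerA scalerDl addrACA.
  have [c [w [Ww E]]] := W'1.
  have c0 : c != 0.
    by apply: contra_notN W1 => /eqP c0; rewrite E c0 scale0r addr0.
  exists c^-1; suff -> : x - c^-1%:A = (- c^-1) *: w + 0 by exact: Wlin.
  rewrite E scalerDr scalerA mulVf // scale1r addr0 scaleNr.
  by rewrite opprD addrCA subrr addr0.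
have uniq_l x c d : W (x - c%:A) -> W (x - d%:A) -> c = d.
  move=> Wc Wd; apply/eqP; rewrite -subr_eq0; apply: contra_notT W1 => cd.
  have := Wlin (c - d)^-1 _ _ (Wlin (-1) _ _ Wc Wd) W0.
  have -> : -1 *: (x - c%:A) + (x - d%:A) = (c - d)%:A :> C.
    by rewrite scaleN1r opprB scalerBl addrA subrK.
  by rewrite scalerA mulVf // scale1r addr0.
exists (fun x => xget 0 [set c | W (x - c%:A)]).
have lP x : W (x - (xget 0 [set c | W (x - c%:A)])%:A).
  by case: xgetP => // /(_ _) H; have [c /H] := ex_l x.
split.
  by apply: (uniq_l 1) => /=; [exact: lP | rewrite scale1r subrr].
move=> c x y; apply: (uniq_l _ _ _ (lP _)).
rewrite scalerDl -scalerA opprD addrACA -scalerBr; exact: Wlin.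
Qed.

Fact tone_neq0 : tone A B != 0.
Proof.
have [l [l1 lP]] := ex_linear_form A.
have l0 : l 0 = 0 by have := lP (-1) 0 0; rewrite scaler0 addr0 mulN1r addNr.
have bf : balanced (fun a b => l a *: b : B).
  split=> [a a' b|a b b'|c a b]; last 1 first.
  - by rewrite -[c *: a]addr0 lP l0 addr0 mulrC scalerA.
  - by rewrite -[a]scale1r lP mul1r scale1r scalerDl.
  - exact: scalerDr.
apply/eqP => /(congr1 (tlift (fun a b => l a *: b : B))) /eqP.
by rewrite tlift0 // /tone tlift_tens // l1 scale1r oner_eq0.
Qed.

HB.instance Definition _ := GRing.Zmodule_isComNzRing.Build T
  (@tmulA) (@tmulC) (@tmul1) (@tmulD) tone_neq0.

Lemma tens_mul a b a' b' : tens a b * tens a' b' = tens (a * a') (b * b') :> T.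
Proof. exact: tmul_tens. Qed.

Lemma tensDl a a' b : tens (a + a') b = tens a b + tens a' b :> T.
Proof. by case: tens_balanced. Qed.

Fact tscaleA (c d : k) (x : T) :
  tens c%:A 1 * (tens d%:A 1 * x) = tens (c * d)%:A 1 * x.
Proof. by rewrite mulrA tens_mul mulr1 -scalerAl mul1r scalerA. Qed.

Fact tscale1 (x : T) : tens (1 : k)%:A 1 * x = x.
Proof. by rewrite scale1r mul1r. Qed.

Fact tscaleDr (c : k) (x y : T) :
  tens c%:A 1 * (x + y) = tens c%:A 1 * x + tens c%:A 1 * y.
Proof. exact: mulrDr. Qed.

Fact tscaleDl (x : T) (c d : k) :
  tens (c + d)%:A 1 * x = tens c%:A 1 * x + tens d%:A 1 * x.
Proof. by rewrite scalerDl tensDl mulrDl. Qed.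

HB.instance Definition _ := GRing.Zmodule_isLmodule.Build k T
  tscaleA tscale1 tscaleDr tscaleDl.

Fact tscaleAl (c : k) (x y : T) : c *: (x * y) = c *: x * y.
Proof. exact: mulrA. Qed.

HB.instance Definition _ := GRing.Lmodule_isLalgebra.Build k T tscaleAl.
HB.instance Definition _ := GRing.Lalgebra_isComAlgebra.Build k T.

Lemma scale_tens c a b : c *: tens a b = tens (c *: a) b :> T.
Proof. by rewrite [LHS]tens_mul mul1r -scalerAl mul1r. Qed.

End TensorTheory.

Notation "a ⊗ b" := (tens a b) : ring_scope.

Section TensorMaps.
Variable k : fieldType.
Implicit Types A B C D : comAlgType k.

Definition tmap A B C D (f : A -> C) (g : B -> D) : tensor A B -> tensor C D :=
  tlift (fun a b => f a ⊗ g b).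

Definition tassoc A B C : tensor A (tensor B C) -> tensor (tensor A B) C :=
  tlift (fun a => tlift (fun b c => (a ⊗ b) ⊗ c)).

Lemma tmap_balanced A B C D (f : {lrmorphism A -> C}) (g : {lrmorphism B -> D}) :
  balanced (fun a b => f a ⊗ g b).
Proof.
have [Dl Dr Z] := tens_balanced C D.
by split=> *; rewrite ?rmorphD ?linearZ /= ?Dl ?Dr ?Z.
Qed.

Lemma tmap_tens A B C D (f : {lrmorphism A -> C}) (g : {lrmorphism B -> D}) a b :
  tmap f g (a ⊗ b) = f a ⊗ g b.
Proof. exact/tlift_tens/tmap_balanced. Qed.

Lemma tassoc_balanced2 A B C (a : A) :
  balanced (fun (b : B) (c : C) => (a ⊗ b) ⊗ c).
Proof.
have [Dl Dr Z] := tens_balanced (tensor A B) C.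
have [Dl' Dr' Z'] := tens_balanced A B.
split=> [b b' c|b c c'|d b c]; rewrite ?Dr ?Dr' ?Dl //.
by rewrite -Z' -scale_tens Z.
Qed.

Lemma tassoc_balanced A B C : balanced (fun a : A =>
  tlift (fun (b : B) (c : C) => (a ⊗ b) ⊗ c)).
Proof.
have [Dl Dr Z] := tens_balanced (tensor A B) C.
split=> [a a' x|a x y|d a x].
- rewrite /tlift /formal_eval -big_split; apply: eq_bigr => p _ /=.
  by rewrite tensDl Dl.
- by rewrite tliftD //; apply: tassoc_balanced2.
rewrite [x in RHS]tensor_sum scaler_sumr tlift_sum; last exact: tassoc_balanced2.
rewrite {1}/tlift /formal_eval; apply: eq_bigr => p _ /=.
rewrite scale_tens tlift_tens; last exact: tassoc_balanced2.
by have [_ _ ->] := tens_balanced A B.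
Qed.

Lemma tassoc_tens A B C (a : A) (b : B) (c : C) :
  tassoc (a ⊗ (b ⊗ c)) = (a ⊗ b) ⊗ c.
Proof.
by rewrite /tassoc tlift_tens ?tlift_tens //;
  [exact: tassoc_balanced2 | exact: tassoc_balanced].
Qed.

End TensorMaps.

(* [G] is represented by the Hopf algebra [k[G]], here [coordRing G]. *)
Record affineGroup (k : fieldType) := AffineGroup {
  coordRing : comAlgType k;
  comul : {lrmorphism coordRing -> tensor coordRing coordRing};
  counit : {lrmorphism coordRing -> k^o};
  antipode : {lrmorphism coordRing -> coordRing};
  comulA : forall x,
    tassoc (tmap id comul (comul x)) = tmap comul id (comul x);
  counitl : forall x, tlift (fun a b => counit a *: b) (comul x) = x;
  counitr : forall x, tlift (fun a b => counit b *: a) (comul x) = x;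
  antipodel : forall x,
    tlift (fun a b => antipode a * b) (comul x) = (counit x)%:A;
  antipoder : forall x,
    tlift (fun a b => a * antipode b) (comul x) = (counit x)%:A
}.

Record coaction (k : fieldType) (G : affineGroup k) (S : comAlgType k) :=
  Coaction {
  coact :> {lrmorphism S -> tensor S (coordRing G)};
  coactA : forall s,
    tassoc (tmap id (comul G) (coact s)) = tmap coact id (coact s);
  coact1 : forall s, tlift (fun a h => counit G h *: a) (coact s) = s
}.

Section RingNotions.
Variable R : comNzRingType.
Implicit Types (I J P Q : set R) (f g : R).

Definition is_ideal I : Prop :=
  [/\ I 0, forall x y, I x -> I y -> I (x + y) & forall r x, I x -> I (r * x)].

Definition is_prime_ideal P : Prop :=
  [/\ is_ideal P, ~ P 1 & forall x y, P (x * y) -> P x \/ P y].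

Definition principal f : set R := [set x | exists r, x = r * f].

Definition Spec : set (set R) := [set P | is_prime_ideal P].

Definition Vset I : set (set R) := [set P | Spec P /\ I `<=` P].

(* The closed subsets of the spectrum are the [Vset I], [I] an ideal. *)
Definition Spec_connected : Prop := Spec !=set0 /\
  forall I J, is_ideal I -> is_ideal J ->
    Vset I `|` Vset J = Spec -> Vset I `&` Vset J = set0 ->
    Vset I = set0 \/ Vset J = set0.

Fixpoint height_ge (n : nat) P : Prop :=
  if n is m.+1 then is_prime_ideal P /\ exists2 Q, height_ge m Q & Q `<` P
  else is_prime_ideal P.

Definition has_height (n : nat) P : Prop := height_ge n P /\ ~ height_ge n.+1 P.

Definition minimal_prime_over I P : Prop :=
  [/\ is_prime_ideal P, I `<=` P &
      forall Q, is_prime_ideal Q -> I `<=` Q -> Q `<=` P -> Q = P].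

Definition is_unit f : Prop := exists g, f * g = 1.

Definition divides f g : Prop := exists r, g = r * f.

Definition prime_element f : Prop :=
  [/\ f <> 0, ~ is_unit f &
      forall x y, divides f (x * y) -> divides f x \/ divides f y].

Definition irreducible_element f : Prop :=
  [/\ f <> 0, ~ is_unit f &
      forall x y, f = x * y -> is_unit x \/ is_unit y].

Definition associate f g : Prop := exists2 u, is_unit u & f = u * g.

Definition is_UFD : Prop :=
  [/\ forall f g, f * g = 0 -> f = 0 \/ g = 0,
      forall f, f <> 0 -> ~ is_unit f ->
        exists2 s : seq R, {in s, forall p, irreducible_element p}
                         & f = \prod_(p <- s) p
    & forall s t : seq R,
        {in s, forall p, irreducible_element p} ->
        {in t, forall p, irreducible_element p} ->
        \prod_(p <- s) p = \prod_(p <- t) p ->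
        size s = size t /\ exists2 t' : seq R, perm_eq t t' &
          forall i, (i < size s)%N -> associate s`_i t'`_i].

End RingNotions.

Section AlgebraNotions.
Variables (k : fieldType) (A : comAlgType k).

Definition finite_type : Prop := exists gens : seq A,
  forall B : {pred A}, GRing.subalg_closed B -> {subset gens <= B} ->
    forall x, x \in B.

(* The infinitesimal lifting property along square-zero surjections. *)
Definition formally_smooth : Prop :=
  forall (C D : comAlgType k) (p : {lrmorphism C -> D}),
    (forall d, exists c, p c = d) ->
    (forall x y, p x = 0 -> p y = 0 -> x * y = 0) ->
    forall f : {lrmorphism A -> D},
      exists g : {lrmorphism A -> C}, forall a, p (g a) = f a.

Definition smooth : Prop := finite_type /\ formally_smooth.

End AlgebraNotions.

Section GroupLike.
Variables (k : fieldType) (C : comAlgType k).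
Variables (delta : C -> tensor C C) (eps : C -> k).

Definition group_like (u : C) : Prop := delta u = u ⊗ u /\ eps u = 1.

End GroupLike.

Definition character (k : fieldType) (G : affineGroup k) (chi : coordRing G) :
  Prop := group_like (comul G) (counit G) chi.

Section BaseChange.
Variables (k : fieldType) (K : fieldAlgType k) (A : comAlgType k).

Definition base_change := tensor (K : comAlgType k) A.

HB.instance Definition _ := GRing.ComNzRing.on base_change.

Fact bscaleA (c d : K) (x : base_change) :
  c ⊗ 1 * (d ⊗ 1 * x) = (c * d) ⊗ 1 * x.
Proof. by rewrite mulrA tens_mul mulr1. Qed.

Fact bscale1 (x : base_change) : (1 : K) ⊗ 1 * x = x.
Proof. exact: mul1r. Qed.

Fact bscaleDr (c : K) (x y : base_change) :
  c ⊗ 1 * (x + y) = c ⊗ 1 * x + c ⊗ 1 * y.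
Proof. exact: mulrDr. Qed.

Fact bscaleDl (x : base_change) (c d : K) :
  (c + d) ⊗ 1 * x = c ⊗ 1 * x + d ⊗ 1 * x.
Proof. by rewrite tensDl mulrDl. Qed.

HB.instance Definition _ := GRing.Zmodule_isLmodule.Build K base_change
  bscaleA bscale1 bscaleDr bscaleDl.

Fact bscaleAl (c : K) (x y : base_change) : c *: (x * y) = c *: x * y.
Proof. exact: mulrA. Qed.

HB.instance Definition _ := GRing.Lmodule_isLalgebra.Build K base_change bscaleAl.
HB.instance Definition _ := GRing.Lalgebra_isComAlgebra.Build K base_change.

Definition to_base_change (a : A) : base_change := (1 : K) ⊗ a.

End BaseChange.

(* The [K]-coalgebra structure of [K ⊗ k[G]], the coordinate ring of [K ⊗ G]. *)
Section BaseChangeGroup.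
Variables (k : fieldType) (K : fieldAlgType k) (G : affineGroup k).
Local Notation KG := (base_change K (coordRing G)).

Definition comul_base_change : KG -> tensor KG KG :=
  tlift (fun (c : K) h => c *:
    tlift (fun h1 h2 => to_base_change K h1 ⊗ to_base_change K h2) (comul G h)).

Definition counit_base_change : KG -> K :=
  tlift (fun (c : K) h => (counit G h : k) *: c).

Definition character_base_change (u : KG) : Prop :=
  group_like comul_base_change counit_base_change u.

Lemma to_base_changeZ (A : comAlgType k) (c : k) (a : A) :
  to_base_change K (c *: a) = c%:A *: to_base_change K a :> base_change K A.
Proof.
have [_ _ Z] := tens_balanced (K : comAlgType k) A.
by rewrite /to_base_change -Z [RHS]tens_mul mulr1 mul1r.
Qed.

Lemma comul_base_change_balanced2 : balanced (fun h1 h2 : coordRing G =>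
  (to_base_change K h1 : KG) ⊗ (to_base_change K h2 : KG)).
Proof.
have [_ D' _] := tens_balanced (K : comAlgType k) (coordRing G).
have [Dl Dr Z] := tens_balanced KG KG.
split=> [h h' g|h g g'|c h g]; rewrite ?to_base_changeZ ?Z //.
  by rewrite {1}/to_base_change D' Dl.
by rewrite {2}/to_base_change D' Dr.
Qed.

Lemma comul_base_change_balanced : balanced (fun (c : K) h => c *:
  tlift (fun h1 h2 => (to_base_change K h1 : KG) ⊗ (to_base_change K h2 : KG))
    (comul G h)).
Proof.
split=> [c d h|c h g|a c h]; first exact: scalerDl.
  by rewrite rmorphD tliftD ?scalerDr //; exact: comul_base_change_balanced2.
rewrite linearZ /=.
have -> : a *: comul G h = \sum_(p <- repr (comul G h)) (a *: p.1) ⊗ p.2.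
  rewrite {1}[comul G h]tensor_sum scaler_sumr.
  by apply: eq_bigr => p _; rewrite scale_tens.
rewrite tlift_sum; last exact: comul_base_change_balanced2.
rewrite !scaler_sumr; apply: eq_bigr => p _.
rewrite tlift_tens; last exact: comul_base_change_balanced2.
by rewrite to_base_changeZ -scale_tens scalerA -scalerAr mulr1.
Qed.

Lemma counit_base_change_balanced :
  balanced (fun (c : K) (h : coordRing G) => (counit G h : k) *: c).
Proof.
split=> [c d h|c h g|a c h]; first exact: scalerDr.
  by rewrite rmorphD scalerDl.
have -> : counit G (a *: h) = a * counit G h :> k by rewrite linearZ.
by rewrite scalerA mulrC.
Qed.

Lemma character_to_base_change (chi : coordRing G) :
  character chi -> character_base_change (to_base_change K chi : KG).
Proof.
move=> [dc ec]; split.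
  rewrite /comul_base_change tlift_tens; last exact: comul_base_change_balanced.
  by rewrite dc tlift_tens ?scale1r //; exact: comul_base_change_balanced2.
rewrite /counit_base_change tlift_tens; last exact: counit_base_change_balanced.
by rewrite ec scale1r.
Qed.

End BaseChangeGroup.

Section SubRing.
Variables (R : comNzRingType) (B : subringClosed R).

Record subring : Type := SubRing { sr_val : R; _ : sr_val \in B }.
HB.instance Definition _ := [isSub for sr_val].
HB.instance Definition _ := [Choice of subring by <:].
HB.instance Definition _ := [SubChoice_isSubComNzRing of subring by <:].

End SubRing.

Section ConstantField.
Variables (k : fieldType) (S : idomAlgType k).
Local Notation iota := (@FracField.tofrac S \o in_alg S).

Definition integral_over_base : {pred {fraction S}} :=
  fun x => `[< integralOver iota x >].

Local Notation iotaM := (iota : {rmorphism k -> {fraction S}}).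

Fact integral_over_base_divring : divring_closed integral_over_base.
Proof.
split=> [|x y /asboolP xi /asboolP yi|x y /asboolP xi /asboolP yi];
  apply/asboolP.
- exact: (integral1 iotaM).
- exact: (@integral_sub _ _ iotaM _ _ xi yi).
- exact: (@integral_div _ _ iotaM _ _ xi yi).
Qed.

HB.instance Definition _ := GRing.isDivringClosed.Build _ integral_over_base
  integral_over_base_divring.

(* The integral closure of [k] in [Q(S)]. *)
Record base_closure : Type := BaseClosure {
  bc_val : {fraction S}; _ : bc_val \in integral_over_base }.
HB.instance Definition _ := [isSub for bc_val].
HB.instance Definition _ := [Choice of base_closure by <:].
HB.instance Definition _ := [SubChoice_isSubComNzRing of base_closure by <:].

Fact base_closure_inv_subproof (x : base_closure) :
  (bc_val x)^-1 \in integral_over_base.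
Proof. by case: x => x /= /asboolP xi; apply/asboolP/(@integral_inv _ _ iotaM). Qed.

Definition base_closure_inv (x : base_closure) : base_closure :=
  BaseClosure (base_closure_inv_subproof x).

Fact base_closure_mulV (x : base_closure) : x != 0 -> base_closure_inv x * x = 1.
Proof.
move=> x0; apply: val_inj; apply: mulVf.
by apply: contra_neq x0 => x0; apply: val_inj.
Qed.

Fact base_closure_inv0 : base_closure_inv 0 = 0.
Proof. by apply: val_inj; apply: invr0. Qed.

HB.instance Definition _ := GRing.ComNzRing_isField.Build base_closure
  base_closure_mulV base_closure_inv0.

Fact iota_integral (c : k) : iota c \in integral_over_base.
Proof. apply/asboolP; exact: integral_id. Qed.

Definition base_closure_in (c : k) : base_closure := BaseClosure (iota_integral c).

Fact kscaleA (c d : k) (x : base_closure) :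
  base_closure_in c * (base_closure_in d * x) = base_closure_in (c * d) * x.
Proof.
rewrite mulrA; congr (_ * _); apply: val_inj => /=.
exact/esym/(rmorphM iotaM).
Qed.

Fact kscale1 (x : base_closure) : base_closure_in 1 * x = x.
Proof.
suff -> : base_closure_in 1 = 1 by rewrite mul1r.
by apply: val_inj; apply: (rmorph1 iotaM).
Qed.

Fact kscaleDr (c : k) (x y : base_closure) :
  base_closure_in c * (x + y) = base_closure_in c * x + base_closure_in c * y.
Proof. exact: mulrDr. Qed.

Fact kscaleDl (x : base_closure) (c d : k) :
  base_closure_in (c + d) * x = base_closure_in c * x + base_closure_in d * x.
Proof.
rewrite -mulrDl; congr (_ * _); apply: val_inj => /=.
exact: (rmorphD iotaM).
Qed.

HB.instance Definition _ := GRing.Zmodule_isLmodule.Build k base_closure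
  kscaleA kscale1 kscaleDr kscaleDl.

Fact kscaleAl (c : k) (x y : base_closure) : c *: (x * y) = c *: x * y.
Proof. exact: mulrA. Qed.

HB.instance Definition _ := GRing.Lmodule_isLalgebra.Build k base_closure kscaleAl.
HB.instance Definition _ := GRing.Lalgebra_isComAlgebra.Build k base_closure.

End ConstantField.

Section Semiinvariants.
Variables (k : fieldType) (G : affineGroup k) (S : comAlgType k).
Variable omega : coaction G S.

Definition semiinvariants (chi : coordRing G) : set S :=
  [set s | omega s = s ⊗ chi].

Definition homogeneous (s : S) : Prop :=
  exists2 chi, character chi & semiinvariants chi s.

Definition in_semiinv_ring : {pred S} := fun s =>
  `[< exists2 r : seq S, {in r, forall x, homogeneous x} & s = \sum_(x <- r) x >].

Definition in_inv_ring : {pred S} := fun s => omega s == s ⊗ 1.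

Lemma character1 : character (1 : coordRing G).
Proof. by split; rewrite rmorph1. Qed.

Lemma characterM (chi psi : coordRing G) :
  character chi -> character psi -> character (chi * psi).
Proof.
move=> [dc ec] [dp ep]; split; first by rewrite rmorphM /= dc dp tens_mul.
by rewrite rmorphM /= ec ep; apply: mulr1.
Qed.

Lemma homogeneousM (x y : S) :
  homogeneous x -> homogeneous y -> homogeneous (x * y).
Proof.
move=> [chi Xc xc] [psi Xp yp]; exists (chi * psi); first exact: characterM.
by rewrite /semiinvariants /= rmorphM /= xc yp tens_mul.
Qed.

Lemma homogeneousN (x : S) : homogeneous x -> homogeneous (- x).
Proof.
move=> [chi Xc xc]; exists chi => //.
by rewrite /semiinvariants /= rmorphN /= xc -!scaleN1r scale_tens.
Qed.

Fact semiinv_ring_closed : subring_closed in_semiinv_ring.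
Proof.
split=> [|x y /asboolP[r hr ->] /asboolP[t ht ->]
         |x y /asboolP[r hr ->] /asboolP[t ht ->]]; apply/asboolP.
- exists [:: 1]; last by rewrite big_seq1.
  move=> x; rewrite inE => /eqP ->; exists 1; first exact: character1.
  by rewrite /semiinvariants /= rmorph1.
- exists (r ++ [seq - x | x <- t]); last by rewrite big_cat big_map sumrN.
  move=> z; rewrite mem_cat => /orP[/hr //|/mapP[w /ht hw ->]].
  exact: homogeneousN.
- exists [seq a * b | a <- r, b <- t].
    move=> z /allpairsP[[a b] /= [/hr ha /ht hb ->]]; exact: homogeneousM.
  by rewrite big_allpairs_dep mulr_suml; apply: eq_bigr => a _; rewrite mulr_sumr.
Qed.

HB.instance Definition _ :=
  GRing.isSubringClosed.Build S in_semiinv_ring semiinv_ring_closed.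

Fact inv_ring_closed : subring_closed in_inv_ring.
Proof.
split=> [|x y /eqP ex /eqP ey|x y /eqP ex /eqP ey]; apply/eqP.
- exact: rmorph1.
- by rewrite rmorphB /= ex ey tensDl -!scaleN1r scale_tens.
- by rewrite rmorphM /= ex ey tens_mul mulr1.
Qed.

HB.instance Definition _ :=
  GRing.isSubringClosed.Build S in_inv_ring inv_ring_closed.

(* [S_G], the sum of the spaces of semiinvariants. *)
Definition semiinv_ring : comNzRingType :=
  subring (in_semiinv_ring : subringClosed S).

(* [S^G]. *)
Definition inv_ring : comNzRingType := subring (in_inv_ring : subringClosed S).

(* The image of [I ⊗ k[G]] in [S ⊗ k[G]]. *)
Definition tensor_ideal (I : set S) : set (tensor S (coordRing G)) :=
  [set x | exists2 r : seq (S * coordRing G),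
     {in r, forall p, I p.1} & x = \sum_(p <- r) p.1 ⊗ p.2].

Definition stable_ideal (I : set S) : Prop :=
  is_ideal I /\ forall s, I s -> tensor_ideal I (omega s).

(* [contraction P] is [P ∩ S_G]. *)
Definition contraction (P : set S) : set semiinv_ring :=
  [set a | P (sr_val a)].

(* [P] is a stable height one prime whose trace on [S_G] is a minimal prime of
   a nonzero principal ideal of [S_G]. *)
Definition special_prime (P : set S) : Prop :=
  [/\ stable_ideal P, is_prime_ideal P, has_height 1 P &
      exists2 a : semiinv_ring, a <> 0 &
        minimal_prime_over (principal a) (contraction P)].

End Semiinvariants.

(* Main.v *)
(* Since [G] is smooth and connected, Taylor coefficients at the identity are
   multiplicative linear forms on [k[G]] with no common zero, so [P ⊗ k[G]] is
   prime for every prime [P] of any [k]-algebra. Hence minimal primes of stable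
   ideals are stable. If [Sf] is stable then [ω f = (f ⊗ 1) u] with [u] a unit
   cocycle; the Taylor coefficients of [u] and of its inverse generate a finite
   dimensional algebra, so they are algebraic over [k], and [u] is a group-like
   element of [K ⊗ k[G]], that is, a character: [f] is homogeneous.

   A homogeneous nonzero nonunit [a] of [S_G] lies in a minimal prime of [S_G a];
   it is the trace of a minimal prime of [S a], which is principal by assumption
   and has a homogeneous generator, a prime of [S] and of [S_G]. So homogeneous
   irreducible elements are prime in [S_G]. The group [X(G)] is torsion free, and
   in a domain graded by such a group, with ascending chains of principal ideals
   stationary, it follows that all irreducible elements are prime: adjoining the
   degrees one rank at a time, this is Gauss' argument with Euclidean division
   of Laurent polynomials over the homogeneous fractions. *)
Require Import Defs.
From HB Require Import structures.
From mathcomp Require Import all_boot all_order all_algebra.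
From mathcomp Require Import boolp classical_sets.
From mathcomp Require Import mpoly ring zify.

Set Implicit Arguments.
Unset Strict Implicit.
Unset Printing Implicit Defensive.

Import Order.TTheory GRing.Theory.
Local Open Scope ring_scope.
Local Open Scope classical_set_scope.

(** * Ideals and Krull's principal ideal theorem *)

(** The field [k] is arbitrary, so [G] may have few rational points and cannot be studied through
    them. Points are replaced by a ring map from [k[G]] to power series at the identity, built by
    infinitesimal lifting. Tensored with an algebra [R] it lands in [R[[X]]], where a product is
    controlled modulo a prime by lowest terms. Connectedness serves to make this map injective: the
    functions vanishing near the identity are split off by idempotents. The same map turns the unit
    cocycle of a stable principal ideal into an invertible series with coefficients in a finite
    dimensional space, which replaces structure theorems on units. Two obstacles shape the rest. The
    ring [S_G] is not known to be noetherian, so its chain condition is imported from [S]; this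
    needs that a unit of [S] lying in [S_G] is a unit there. And no basis of [X(G)] is chosen: a
    subgroup [Sg] with torsion free quotient takes the place of a coefficient ring, the elements
    homogeneous modulo [Sg] acting as constants. *)

Lemma zorn_above (T : Type) (Q : set T -> Prop) (I : set T) :
  Q I ->
  (forall F : set (set T), F !=set0 -> (forall X, F X -> Q X) ->
     total_on F (fun X Y => X `<=` Y) -> Q (\bigcup_(X in F) X)) ->
  exists J, [/\ Q J, I `<=` J & forall J', Q J' -> J `<=` J' -> J' `<=` J].
Proof.
move=> QI Qchain.
(* [Zorn_bigcup] also tests the empty chain. For the property of [W] that the union of [I] and [W]
   satisfies [Q], that case is [Q I]. *)
have [F FP Ftot|W [PW Wmax]] := @Zorn_bigcup T (fun W => Q (I `|` W)).
  have [->|/set0P[X0 FX0]] := eqVneq F set0; first by rewrite bigcup_set0 setU0.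
  have -> : I `|` \bigcup_(X in F) X = \bigcup_(Y in [set I `|` X | X in F]) Y.
    apply/seteqP; split=> [x [Ix|[X FX Xx]]|x [_ [X FX <-]] [Ix|Xx]].
    - by exists (I `|` X0); [exists X0 | left].
    - by exists (I `|` X); [exists X | right].
    - by left.
    - by right; exists X.
  apply: Qchain; first by exists (I `|` X0); exists X0.
    by move=> _ [X FX <-]; apply: FP.
  move=> _ _ [X FX <-] [Y FY <-].
  by have [XY|YX] := Ftot _ _ FX FY; [left|right]; apply: setUS.
exists (I `|` W); split=> // J' QJ' IWJ'.
have IJ' : I `|` J' = J' by apply/setUidPr => x Ix; apply: IWJ'; left.
move=> x J'x; right; apply: contrapT => Wx; apply: (Wmax J'); last by rewrite IJ'.
by split=> [y Wy|/(_ x J'x)//]; apply: IWJ'; right.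
Qed.

Definition is_domain (R : comNzRingType) : Prop :=
  forall x y : R, x * y = 0 -> x = 0 \/ y = 0.

Definition noetherian (R : comNzRingType) : Prop :=
  forall Q : set (set R), (forall I, Q I -> is_ideal I) -> Q !=set0 ->
    exists2 J, Q J & forall J', Q J' -> J `<=` J' -> J' `<=` J.

Section Ideals.
Variable R : comNzRingType.
Implicit Types (I J P Q M : set R) (x y : R).

Lemma domain_lreg : is_domain R -> forall x, x <> 0 -> forall y z, x * y = x * z -> y = z.
Proof.
move=> dom x x0 y z xyz; have : x * (y - z) = 0 by rewrite mulrBr xyz subrr.
by case/dom => // /subr0_eq.
Qed.

Lemma ideal0 I : is_ideal I -> I 0. Proof. by case. Qed.

Lemma idealD I x y : is_ideal I -> I x -> I y -> I (x + y).
Proof. by case=> _ H _; apply: H. Qed.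

Lemma idealMl I x y : is_ideal I -> I y -> I (x * y).
Proof. by case=> _ _; apply. Qed.

Lemma idealMr I x y : is_ideal I -> I x -> I (x * y).
Proof. by rewrite mulrC; apply: idealMl. Qed.

Lemma idealN I x : is_ideal I -> I x -> I (- x).
Proof. by move=> hI Ix; rewrite -mulN1r; apply: idealMl. Qed.

Lemma idealB I x y : is_ideal I -> I x -> I y -> I (x - y).
Proof. by move=> hI Ix Iy; apply: idealD => //; apply: idealN. Qed.

Lemma idealDr I x y : is_ideal I -> I (x + y) -> I y -> I x.
Proof. by move=> hI Ixy Iy; rewrite -[x](addrK y); apply: idealB. Qed.

Lemma ideal_sum I (K : eqType) (r : seq K) (P : pred K) (F : K -> R) :
  is_ideal I -> (forall i, i \in r -> P i -> I (F i)) -> I (\sum_(i <- r | P i) F i).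
Proof.
move=> hI HF; rewrite big_seq_cond; apply: big_ind => //.
- exact: ideal0.
- by move=> *; apply: idealD.
- by move=> i /andP[]; apply: HF.
Qed.

Lemma prime_ideal I : is_prime_ideal I -> is_ideal I. Proof. by case. Qed.

Lemma primeX P x n : is_prime_ideal P -> P (x ^+ n) -> P x.
Proof.
move=> hP; elim: n => [|n IH]; first by case: hP.
by rewrite exprS; case: hP => _ _ H /H[].
Qed.

Lemma domain_prime : is_domain R -> is_prime_ideal [set (0 : R)].
Proof.
move=> dom; split; [split=> //= | exact/eqP/oner_neq0 | exact: dom].
  by move=> x y -> ->; rewrite addr0.
by move=> r x ->; rewrite mulr0.
Qed.

Lemma zero_ideal : is_ideal [set (0 : R)].
Proof.
split=> //= [x y -> ->|r x ->]; first by rewrite addr0.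
exact: mulr0.
Qed.

Lemma principal_ideal (f : R) : is_ideal (principal f).
Proof.
split=> [|x y [r ->] [s ->]|r x [s ->]]; first by exists 0; rewrite mul0r.
  by exists (r + s); rewrite mulrDl.
by exists (r * s); rewrite mulrA.
Qed.

Lemma principal_sub I (f : R) : is_ideal I -> I f -> principal f `<=` I.
Proof. by move=> hI If _ [r ->]; apply: idealMl. Qed.

Lemma principal_refl (f : R) : principal f f.
Proof. by exists 1; rewrite mul1r. Qed.

Definition adjoin I x : set R := [set y | exists i r, I i /\ y = i + r * x].

Lemma adjoin_ideal I x : is_ideal I -> is_ideal (adjoin I x).
Proof.
move=> hI; split=> [|_ _ [i [r [Ii ->]]] [j [s [Ij ->]]]|t _ [i [r [Ii ->]]]].
- by exists 0, 0; rewrite mul0r addr0; split=> //; apply: ideal0.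
- by exists (i + j), (r + s); rewrite mulrDl addrACA; split=> //; apply: idealD.
- by exists (t * i), (t * r); rewrite mulrDr mulrA; split=> //; apply: idealMl.
Qed.

Lemma adjoin_sub I x : I `<=` adjoin I x.
Proof. by move=> i Ii; exists i, 0; rewrite mul0r addr0. Qed.

Lemma adjoin_mem I x : is_ideal I -> adjoin I x x.
Proof. by move=> hI; exists 0, 1; rewrite mul1r add0r; split=> //; apply: ideal0. Qed.

Definition colon I x : set R := [set t | I (t * x)].

Lemma colon_ideal I x : is_ideal I -> is_ideal (colon I x).
Proof.
move=> hI; split=> [|s t Is It|s t It]; rewrite /colon /=.
- by rewrite mul0r; apply: ideal0.
- by rewrite mulrDl; apply: idealD.
- by rewrite -mulrA; apply: idealMl.
Qed.

(** The preimage in [R] of the extension of [I] to the local ring at [P]. Localizations are never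
    formed: ideals of the local ring are represented by [saturated] ideals of [R]. *)
Definition satur P I : set R := [set x | exists2 s, ~ P s & I (s * x)].

Lemma satur_sub P I : is_prime_ideal P -> I `<=` satur P I.
Proof. by case=> _ P1 _ x Ix; exists 1 => //; rewrite mul1r. Qed.

Lemma satur_ideal P I : is_prime_ideal P -> is_ideal I -> is_ideal (satur P I).
Proof.
move=> [hP P1 PM] hI; split=> [|x y [s Ps Isx] [t Pt Ity]|r x [s Ps Isx]].
- by exists 1 => //; rewrite mulr0; apply: ideal0.
- exists (s * t); first by move=> /PM[].
  by rewrite mulrDr mulrAC -[_ * _ * y]mulrA; apply: idealD => //;
    [apply: idealMr | apply: idealMl].
- by exists s => //; rewrite mulrCA; apply: idealMl.
Qed.

Lemma satur_mono P I J : I `<=` J -> satur P I `<=` satur P J.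
Proof. by move=> IJ x [s Ps /IJ ?]; exists s. Qed.

Definition saturated P I := forall s x, ~ P s -> I (s * x) -> I x.

Lemma satur_saturated P I : is_prime_ideal P -> saturated P (satur P I).
Proof.
move=> [_ _ PM] s x Ps [t Pt Itsx]; exists (t * s); last by rewrite -mulrA.
by move=> /PM[].
Qed.

Lemma prime_avoiding I M : is_ideal I -> M 1 ->
  (forall x y, M x -> M y -> M (x * y)) -> (forall x, I x -> ~ M x) ->
  exists P, [/\ is_prime_ideal P, I `<=` P & forall x, P x -> ~ M x].
Proof.
move=> hI M1 MM IM.
pose Q J := is_ideal J /\ forall x, J x -> ~ M x.
have [//|F [X0 FX0] FQ Ftot|P [[hP PM] IP Pmax]] := @zorn_above _ Q I.
  split; last by move=> x [X /FQ[_ H] /H].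
  split=> [|x y [X FX Xx] [Y FY Yy]|r x [X FX Xx]].
  - by exists X0 => //; apply: ideal0; have [] := FQ _ FX0.
  - have [XY|YX] := Ftot _ _ FX FY.
      by exists Y => //; apply: idealD => //; [have [] := FQ _ FY | apply: XY].
    by exists X => //; apply: idealD => //; [have [] := FQ _ FX | apply: YX].
  - by exists X => //; apply: idealMl => //; have [] := FQ _ FX.
exists P; split=> //; split=> // [P1|x y Pxy]; first exact: PM P1 M1.
have key z : ~ P z -> exists p r, P p /\ M (p + r * z).
  move=> Pz; apply: contrapT => H; apply: Pz.
  apply: (Pmax (adjoin P z)) (adjoin_mem z hP); last exact: adjoin_sub.
  split; first exact: adjoin_ideal.
  by move=> _ [p [r [Pp ->]]] Mp; apply: H; exists p, r.
apply: contrapT => /not_orP[/key[p [r [Pp Mp]]] /key[q [s [Pq Mq]]]].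
apply: (PM _ _ (MM _ _ Mp Mq)); rewrite mulrDl mulrDr.
apply: idealD => //; first by apply: idealD => //; apply: idealMr.
rewrite mulrDr; apply: idealD => //; first exact: idealMl.
by rewrite mulrACA; apply: idealMl.
Qed.

(** Passing to complements turns minimality into the maximality of [zorn_above]: the union of a
    chain of complements of primes is the complement of their intersection, which is prime. *)
Lemma minimal_prime_below I Q : is_prime_ideal Q -> I `<=` Q ->
  exists2 P, minimal_prime_over I P & P `<=` Q.
Proof.
move=> hQ IQ; pose B W := is_prime_ideal (~` W) /\ I `<=` ~` W.
have BQ : B (~` Q) by rewrite /B setCK.
have [//|F [X0 FX0] FB Ftot|W [[hW IW] QW Wmax]] := @zorn_above _ B (~` Q).
  split; last by move=> x Ix [X /FB[_ H]] /=; apply: H.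
  have FP X : F X -> is_prime_ideal (~` X) by move=> /FB[].
  split; first split.
  - by move=> [X FX X0']; apply: (ideal0 (prime_ideal (FP _ FX))).
  - move=> x y Fx Fy [X FX]; apply: (idealD (prime_ideal (FP _ FX))) => Xz.
      by apply: Fx; exists X.
    by apply: Fy; exists X.
  - move=> r x Fx [X FX]; apply: (idealMl _ (prime_ideal (FP _ FX))) => Xz.
    by apply: Fx; exists X.
  - have [_ H _] := FP _ FX0; move=> U1; apply: H => X01; apply: U1; exists X0 => //.
  move=> x y Fxy; apply: contrapT => /not_orP[/contrapT[X FX Xx] /contrapT[Y FY Yy]].
  have [Z [FZ Zx Zy]] : exists Z, [/\ F Z, Z x & Z y].
    have [XY|YX] := Ftot _ _ FX FY; first by exists Y; split=> //; apply: XY.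
    by exists X; split=> //; apply: YX.
  have [_ _ PM] := FP _ FZ.
  by case: (PM x y) => // Zxy; apply: Fxy; exists Z.
exists (~` W); last by move=> x /= Wx; apply: contrapT => /QW.
split=> // Q' hQ' IQ' Q'W; apply/seteqP; split=> // x Wx; apply: contrapT => Q'x.
apply: Wx; apply: (Wmax (~` Q')) => // [|y Wy Q'y]; first by rewrite /B setCK.
exact: Q'W Q'y Wy.
Qed.

Lemma radicalP I x : is_ideal I ->
  (forall P, is_prime_ideal P -> I `<=` P -> P x) -> exists n, I (x ^+ n).
Proof.
move=> hI HP; apply: contrapT => Hx.
have [|_ _ [n ->] [m ->]|y Iy [n E]|P [hP IP PM]] :=
    @prime_avoiding I [set y | exists n, y = x ^+ n] hI.
- by exists 0%N; rewrite expr0.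
- by exists (n + m)%N; rewrite exprD.
- by apply: Hx; exists n; rewrite -E.
- by apply: (PM x); [apply: HP | exists 1%N; rewrite expr1].
Qed.

Lemma prime_of_nonunit x : ~ is_unit x -> exists2 P, is_prime_ideal P & P x.
Proof.
move=> ux; apply: contrapT => H; apply: ux.
have [|n [r]] := @radicalP (principal x) 1 (principal_ideal x).
  move=> P hP Px; exfalso; apply: H; exists P => //; apply: Px; exact: principal_refl.
by rewrite expr1n => E; exists r; rewrite mulrC.
Qed.

End Ideals.

(** * Noetherian rings and Hilbert's basis theorem *)

Section Noetherian.
Variable R : comNzRingType.
Implicit Types (I J P Q M : set R) (x y : R).

(** Generation is expressed by a universal property, which avoids handling coefficients. *)
Definition fin_gen I := exists2 s : seq R, {in s, forall x, I x} &
  forall J, is_ideal J -> {in s, forall x, J x} -> I `<=` J.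

Lemma noetherian_fin_gen : noetherian R -> forall I, is_ideal I -> fin_gen I.
Proof.
move=> nR I hI; pose gen (s : seq R) : set R :=
  [set x | forall J, is_ideal J -> {in s, forall y, J y} -> J x].
have hgen s : is_ideal (gen s).
  split=> [J hJ _|x y gx gy J hJ Js|r x gx J hJ Js]; first exact: ideal0.
    by apply: idealD => //; [apply: gx | apply: gy].
  by apply: idealMl => //; apply: gx.
have [||_ [s [sI ->]] smax] := nR [set J | exists s : seq R, {in s, forall x, I x} /\ J = gen s].
- by move=> _ [s [_ ->]].
- by exists (gen [::]); exists [::]; split.
exists s => // J hJ Js x Ix.
have gx : gen s x.
  apply: (smax (gen (x :: s))).
  - exists (x :: s); split=> // y; rewrite inE => /orP[/eqP -> //|]; exact: sI.
  - move=> y gy K hK Ks; apply: gy => // z zs; apply: Ks; rewrite inE zs orbT //.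
  - by move=> K hK Ks; apply: Ks; rewrite inE eqxx.
exact: gx.
Qed.

Lemma fin_gen_noetherian : (forall I, is_ideal I -> fin_gen I) -> noetherian R.
Proof.
move=> fg Q Qid [I0 QI0].
have [//|F [X0 FX0] FQ Ftot|J [QJ _ Jmax]] := @zorn_above _ Q I0; last by exists J.
have hU : is_ideal (\bigcup_(X in F) X).
  split=> [|x y [X FX Xx] [Y FY Yy]|r x [X FX Xx]].
  - by exists X0 => //; apply: ideal0; apply: Qid; apply: FQ.
  - have [XY|YX] := Ftot _ _ FX FY.
      by exists Y => //; apply: idealD (XY _ Xx) _ => //; apply: Qid; apply: FQ.
    by exists X => //; apply: idealD Xx (YX _ Yy); apply: Qid; apply: FQ.
  - by exists X => //; apply: idealMl => //; apply: Qid; apply: FQ.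
have [s sU sgen] := fg _ hU.
have [X FX Xs] : exists2 X, F X & {in s, forall x, X x}.
  elim: s sU {sgen} => [|x s IH] sU; first by exists X0.
  have [y ys|X FX Xs] := IH; first by apply: sU; rewrite inE ys orbT.
  have [Y FY Yx] := sU x (mem_head x s).
  have [XY|YX] := Ftot _ _ FX FY.
    by exists Y => // y; rewrite inE => /orP[/eqP -> //|/Xs /XY].
  by exists X => // y; rewrite inE => /orP[/eqP ->|/Xs //]; apply: YX.
suff -> : \bigcup_(X in F) X = X by apply: FQ.
apply/seteqP; split=> [|x Xx]; last by exists X.
by apply: sgen => //; apply: Qid; apply: FQ.
Qed.

Lemma noetherian_acc (f : nat -> set R) : noetherian R ->
  (forall n, is_ideal (f n)) -> (forall n, f n `<=` f n.+1) ->
  exists n, forall m, (n <= m)%N -> f m `<=` f n.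
Proof.
move=> nR fid fS.
have mono n m : (n <= m)%N -> f n `<=` f m.
  by move=> /subnK <-; elim: (m - n)%N => //= d IH; apply: subset_trans IH (fS _).
have [||_ [n ->] nmax] := nR [set I | exists n, I = f n].
- by move=> _ [n ->].
- by exists (f 0%N), 0%N.
by exists n => m nm; apply: nmax; [exists m | apply: mono].
Qed.

End Noetherian.

Lemma field_noetherian (k : fieldType) : noetherian k.
Proof.
apply: fin_gen_noetherian => I hI.
have [[x [Ix x0]]|H] := pselect (exists x, I x /\ x != 0).
  exists [:: x] => [y|J hJ Jx y Iy]; first by rewrite inE => /eqP ->.
  by rewrite -[y](divfK x0); apply: idealMl => //; apply: Jx; rewrite inE.
exists [::] => // J hJ _ x Ix; have [->|x0] := eqVneq x 0; first exact: ideal0.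
by exfalso; apply: H; exists x.
Qed.

Lemma hilbert_basis (R : comNzRingType) : noetherian R -> noetherian {poly R}.
Proof.
move=> nR; apply: fin_gen_noetherian => I hI.
(* The leading ideals: the coefficients at ['X^n] of elements of [J] of degree at most [n]. For [I]
   they increase with [n], by multiplication with ['X]. *)
pose L (J : set {poly R}) n : set R :=
  [set c | exists p, [/\ J p, (size p <= n.+1)%N & p`_n = c]].
have hL J n : is_ideal J -> is_ideal (L J n).
  move=> hJ; split=> [|_ _ [p [Jp sp <-]] [q [Jq sq <-]]|r _ [p [Jp sp <-]]].
  - by exists 0; rewrite size_poly0 coef0; split=> //; apply: ideal0.
  - exists (p + q); rewrite coefD; split=> //; first exact: idealD.
    by rewrite (leq_trans (size_polyD _ _)) // geq_max sp sq.
  - exists (r%:P * p); rewrite coefCM; split=> //; first exact: idealMl.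
    by rewrite mul_polyC (leq_trans (size_scale_leq _ _)).
have [n|n _ [p [Ip sp <-]]|N HN] := @noetherian_acc _ (L I) nR.
- exact: hL.
- exists ('X * p); rewrite coefXM; split=> //; first exact: idealMl.
  rewrite mulrC; have [->|p0] := eqVneq p 0; first by rewrite mul0r size_poly0.
  by rewrite size_mulX.
(* Generators of [L I n] are lifted to polynomials of [I]; an ideal [J] containing the lifts
   realizes every element of [L I n] by a polynomial of its own of degree at most [n]. *)
have /choice[G HG] : forall n, exists s : seq {poly R}, {in s, forall p, I p} /\
    forall J, is_ideal J -> {in s, forall p, J p} -> L I n `<=` L (J `&` I) n.
  move=> n; have [s sL sgen] := noetherian_fin_gen nR (hL I n hI).
  have [t [tI tJ]] : exists t : seq {poly R}, {in t, forall p, I p} /\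
      forall J, is_ideal J -> {in t, forall p, J p} -> {in s, forall c, L (J `&` I) n c}.
    elim: s sL {sgen} => [|c s IH] sL; first by exists [::].
    have [d ds|t [tI tJ]] := IH; first by apply: sL; rewrite inE ds orbT.
    have [p [Ip sp Ec]] := sL c (mem_head c s).
    exists (p :: t); split=> [q|J hJ Jt d].
      by rewrite inE => /orP[/eqP -> //|/tI].
    rewrite inE => /orP[/eqP ->|ds].
      by exists p; split=> //; split=> //; apply: Jt; rewrite mem_head.
    by apply: tJ => // q qt; apply: Jt; rewrite inE qt orbT.
  exists t; split=> // J hJ Jt; apply: sgen; last exact: tJ.
  apply: hL; split=> [|x y [Jx Ix] [Jy Iy]|r x [Jx Ix]].
  - by split; apply: ideal0.
  - by split; apply: idealD.
  - by split; apply: idealMl.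
exists (flatten [seq G n | n <- iota 0 N.+1]) => [p /flatten_mapP[n _]|J hJ JG].
  by have [GI _] := HG n; apply: GI.
have {}JG n : (n <= N)%N -> {in G n, forall p, J p}.
  by move=> nN p pG; apply: JG; apply/flatten_mapP; exists n => //; rewrite mem_iota.
suff H m (p : {poly R}) : (size p <= m)%N -> I p -> J p by move=> p Ip; apply: (H (size p)).
elim: m p => [|m IH] p sp Ip.
  by move: sp; rewrite leqn0 size_poly_eq0 => /eqP ->; apply: ideal0.
(* Beyond [N] the leading ideals are stationary, so lifts of degree at most [N] suffice: a
   polynomial [q] of degree at most [n] is shifted by ['X^(m - n)] to cancel the coefficient of [p]
   at [m]. *)
pose n := minn m N; have nm : (n <= m)%N by rewrite geq_minl.
have : L I n p`_m.
  rewrite /n; case: (leqP m N) => [_|/ltnW mN]; first by exists p.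
  by apply: (HN m mN); exists p.
have [_ Gn] := HG n.
move=> /(Gn J hJ (JG n (geq_minr _ _)))[q [[Jq Iq] sq Eq]].
have Jq' : J ('X^(m - n) * q) by apply: idealMl.
rewrite -[p](subrK ('X^(m - n) * q)); apply: idealD => //; apply: IH; last first.
  by apply: idealB => //; apply: idealMl.
apply/leq_sizeP => j mj; rewrite coefB mulrC coefMXn.
have -> : (j < m - n)%N = false by apply/negbTE; rewrite -leqNgt (leq_trans (leq_subr _ _)).
move: mj; rewrite leq_eqVlt => /orP[/eqP <-|mj]; first by rewrite subKn // Eq subrr.
rewrite nth_default; last exact: leq_trans mj.
rewrite nth_default ?subrr //; apply: leq_trans sq _.
by rewrite ltn_subRL subnK.
Qed.

Lemma surj_noetherian (R S : comNzRingType) (phi : {rmorphism R -> S}) :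
  (forall s, exists r, phi r = s) -> noetherian R -> noetherian S.
Proof.
move=> surj nR Q Qid [I0 QI0].
pose pre (I : set S) : set R := [set r | I (phi r)].
have [||_ [J QJ ->] Jmax] := nR [set I | exists2 J, Q J & I = pre J].
- move=> _ [J /Qid hJ ->]; split=> [|x y Jx Jy|r x Jx]; rewrite /pre /=.
  + by rewrite rmorph0; apply: ideal0.
  + by rewrite rmorphD; apply: idealD.
  + by rewrite rmorphM; apply: idealMl.
- by exists (pre I0), I0.
exists J => // J' QJ' JJ' x J'x; have [r rx] := surj x; rewrite -rx.
by apply: (Jmax (pre J')); [exists J' | move=> y; apply: JJ' | rewrite /pre /= rx].
Qed.

(** Adding the generators one at a time presents the algebra as a quotient of an iterated polynomial
    ring over [k]. *)
Lemma finite_type_noetherian (k : fieldType) (A : comAlgType k) :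
  finite_type A -> noetherian A.
Proof.
move=> [gens Hgens].
have [R [phi [nR phik phig]]] : exists (R : comNzRingType) (phi : {rmorphism R -> A}),
    [/\ noetherian R, forall c, exists r, phi r = c%:A &
        {in gens, forall x, exists r, phi r = x}].
  elim: gens {Hgens} => [|x s [R [phi [nR phik phis]]]].
    by exists k, (in_alg A); split=> //; [apply: field_noetherian | move=> c; exists c].
  have cx : commr_rmorph phi x by move=> y; apply: mulrC.
  exists {poly R}, (horner_morph cx); split; first exact: hilbert_basis.
    by move=> c; have [r <-] := phik c; exists r%:P; exact: horner_morphC.
  move=> y; rewrite inE => /orP[/eqP ->|/phis[r <-]].
    by exists 'X; exact: horner_morphX.
  by exists r%:P; exact: horner_morphC.
apply: surj_noetherian nR => s.
pose B : {pred A} := fun x => `[< exists r, phi r = x >].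
suff Bs : s \in B by apply/asboolP; exact: Bs.
apply: Hgens => [|x /phig]; last by move=> ?; apply/asboolP.
split=> [|c x y /asboolP[r <-] /asboolP[t <-]|x y /asboolP[r <-] /asboolP[t <-]];
  apply/asboolP.
- by exists 1; rewrite rmorph1.
- have [d dc] := phik c; exists (d * r + t).
  by rewrite rmorphD rmorphM dc -scalerAl mul1r.
- by exists (r * t); rewrite rmorphM.
Qed.

(** * Krull's principal ideal theorem *)

Section Krull.
Variable R : comNzRingType.
Hypothesis nR : noetherian R.
Implicit Types (I J P Q M U : set R) (x y : R).

(** The colon ideal of [U] by the [n]-th power of [M], iterated so that powers of [M] need not be
    formed. *)
Fixpoint colons U M (n : nat) : set R :=
  if n is n'.+1 then [set x | forall p, M p -> colons U M n' (p * x)] else U.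

Lemma colons_ideal U M n : is_ideal U -> is_ideal (colons U M n).
Proof.
move=> hU; elim: n => [|n hn] //=; split=> [p _|x y hx hy p Mp|r x hx p Mp].
- by rewrite mulr0; apply: ideal0.
- by rewrite mulrDr; apply: idealD => //; [apply: hx | apply: hy].
- by rewrite mulrCA; apply: idealMl => //; apply: hx.
Qed.

Lemma colons_sub U M n : is_ideal U -> colons U M n `<=` colons U M n.+1.
Proof. by move=> hU x Ux p _; apply: idealMl => //; apply: colons_ideal. Qed.

(* A colon ideal that is maximal among the proper ones [(U : y)] is prime, so
   the chain of iterated colons by [M] can only stop at the unit ideal. *)
Lemma colons_exhaust U M : is_ideal U ->
  (forall n y, is_prime_ideal (colon (colons U M n) y) -> M `<=` colon (colons U M n) y) ->
  exists n, colons U M n 1.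
Proof.
move=> hU H; have hUn n := colons_ideal M n hU.
have [N HN] := noetherian_acc nR hUn (fun n => colons_sub (M := M) (n := n) hU).
exists N; apply: contrapT => UN1.
have [||_ [y nUy ->] ymax] :=
  nR (Q := [set I | exists2 y, ~ colons U M N y & I = colon (colons U M N) y]).
- by move=> _ [y _ ->]; apply: colon_ideal.
- by exists (colon (colons U M N) 1); exists 1.
have {}ymax z : ~ colons U M N z -> colon (colons U M N) y `<=` colon (colons U M N) z ->
    colon (colons U M N) z `<=` colon (colons U M N) y.
  by move=> nUz; apply: ymax; exists z.
apply: (nUy); apply: (HN N.+1) => // p Mp; apply: (H N y) => //.
split; first exact: colon_ideal.
  by rewrite /colon /= mul1r.
move=> a b; rewrite /colon /= => abU; have [aU|naU] := pselect (colons U M N (a * y)).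
  by left.
right; apply: (ymax (a * y) naU); rewrite /colon /=.
  by move=> c cU; rewrite /colon /= mulrCA; apply: idealMl.
by rewrite mulrA [b * a]mulrC.
Qed.

(* If [E] is maximal among the saturated ideals meeting some [D j] in [C], then
   [D] is stable from that [j] on: an element of [D j] outside a later [D i]
   could be added to [E]. *)
Lemma saturated_dcc P C (D : nat -> set R) : is_prime_ideal P ->
  is_ideal C -> saturated P C ->
  (forall n, is_ideal (D n)) -> (forall n, saturated P (D n)) ->
  (forall n, D n.+1 `<=` D n) -> (forall n, C `<=` D n) ->
  (forall n p x, P p -> D n x -> C (p * x)) ->
  exists n, forall m, (n <= m)%N -> D n `<=` D m.
Proof.
move=> hP hC sC hD sD Ddec CD PD.
have mono n m : (n <= m)%N -> D m `<=` D n.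
  by move=> /subnK <-; elim: (m - n)%N => //= d IH; apply: subset_trans (Ddec _) IH.
pose Q E := [/\ is_ideal E, saturated P E, C `<=` E & exists j, E `&` D j `<=` C].
have [||E [hE sE CE [j Ej]] Emax] := nR (Q := Q); first by move=> ? [].
  by exists C; split=> //; exists 0%N => x [].
exists j => i ji x Djx; apply: contrapT => Dix.
have hE' := adjoin_ideal x hE.
have Ex : E x.
  apply: (Emax (satur P (adjoin E x))).
  - split; [exact: satur_ideal | exact: satur_saturated | |].
      by move=> c /CE Ec; apply: satur_sub => //; apply: adjoin_sub.
    exists i => y [[s Ps [e [r [Ee E1]]]] Diy].
    have Diry : D i (s * y) by apply: idealMl.
    have [Pr|Pr] := pselect (P r).
      apply: (sC s y Ps); apply: Ej; split; last by apply: mono ji _ Diry.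
      by rewrite E1; apply: idealD => //; apply: CE; apply: PD Pr Djx.
    exfalso; apply: Dix; apply: (sD i r x Pr).
    have -> : r * x = s * y - e by rewrite E1 addrAC subrr add0r.
    apply: idealB => //; apply: (CD i); apply: Ej; split=> //.
    rewrite -[e](addrK (r * x)) -E1; apply: idealB => //; last exact: idealMl.
    exact: mono ji _ Diry.
  - by move=> y Ey; apply: satur_sub => //; apply: adjoin_sub.
  - by apply: satur_sub => //; apply: adjoin_mem.
by apply: Dix; apply: (CD i); apply: Ej.
Qed.

(* Nakayama's lemma for [J' + f J = J] at the prime [P]. *)
Lemma saturated_nakayama P J J' f : is_prime_ideal P -> P f ->
  is_ideal J' -> saturated P J' ->
  (forall x, J x -> exists s y r, [/\ ~ P s, J' y, J r & s * x = y + r * f]) ->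
  J `<=` J'.
Proof.
move=> hP Pf hJ' sJ' H x0 Jx0; apply: contrapT => J'x0.
pose F x := satur P (adjoin J' x).
have hF x : is_ideal (F x) by apply: satur_ideal => //; apply: adjoin_ideal.
have [||_ [x [Jx J'x] ->] xmax] := nR (Q := [set I | exists2 x, J x /\ ~ J' x & I = F x]).
- by move=> _ [x _ ->].
- by exists (F x0); exists x0.
have [s [y [r [Ps J'y Jr E]]]] := H x Jx.
have J'r : ~ J' r.
  move=> J'r; apply: J'x; apply: (sJ' s) => //; rewrite E.
  by apply: idealD => //; apply: idealMr.
have [_ P1 PM] := hP; have hPi := prime_ideal hP.
have sub : F x `<=` F r.
  move=> z [t Pt [j [q [J'j Ez]]]].
  exists (s * t); first by move=> /PM[].
  exists (s * j + q * y), (q * f); split; last first.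
    have -> : s * t * z = s * (t * z) by rewrite mulrA.
    by rewrite Ez mulrDr mulrCA E mulrDr [r * f]mulrC !mulrA addrA.
  by apply: idealD => //; apply: idealMl.
have [||t Pt [j [q [J'j Er]]]] := xmax (F r) _ sub r; first by exists r.
  exact/(satur_sub hP)/adjoin_mem.
apply: J'x; apply: (sJ' (t * s - f * q)).
  move=> H1; have /PM[//|//] : P (t * s).
  by rewrite -[t * s](subrK (f * q)); apply: idealD => //; apply: idealMr.
have -> : (t * s - f * q) * x = t * (s * x) - f * (q * x) by ring.
rewrite E mulrDr; have -> : t * (r * f) = f * (t * r) by ring.
rewrite Er mulrDr addrA addrK.
by apply: idealD => //; apply: idealMl.
Qed.

(** The classical argument, with the symbolic powers of one element [q] of [Q]. Modulo [f] the local
    ring at [P] has finite length, which is used as a descending chain condition along the ideals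
    [U i]. The symbolic powers thus become stationary modulo [f], and by Nakayama's lemma [q ^+ n]
    lies in the next one; a denominator outside [Q] is then a multiple of [q]. *)
Theorem krull_principal (dom : is_domain R) f P Q :
  minimal_prime_over (principal f) P -> is_prime_ideal Q -> Q `<=` P -> ~ (P `<=` Q) ->
  forall q, Q q -> q = 0.
Proof.
move=> [hP fP Pmin] hQ QP nPQ q Qq; apply: contrapT => q0.
have [_ P1 PM] := hP; have hPi := prime_ideal hP.
have [_ Q1 QM] := hQ; have hQi := prime_ideal hQ.
have Pf : P f by apply: fP; apply: principal_refl.
have nQf : ~ Q f.
  by move=> Qf; apply: nPQ; rewrite (Pmin Q hQ) //; apply: principal_sub.
pose U0 := satur P (principal f).
have hU0 : is_ideal U0 by apply: satur_ideal => //; apply: principal_ideal.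
pose U n := colons U0 P n.
have hU n : is_ideal (U n) by apply: colons_ideal.
have sU n : saturated P (U n).
  elim: n => [|n IH] s x Ps /=; first exact: (@satur_saturated _ P _ hP).
  by move=> H p Pp; apply: (IH s) => //; rewrite mulrCA; apply: H.
have U0n n : U0 `<=` U n.
  by elim: n => // n IH; apply: subset_trans IH (colons_sub _).
(* A prime colon of [U n] contains [f] and, [U n] being saturated, lies inside [P]; minimality of
   [P] makes it [P]. *)
have [N UN] : exists n, U n 1.
  apply: colons_exhaust => // n y hC; suff -> : colon (colons U0 P n) y = P by [].
  apply: Pmin => // [x fx|t Uty]; first by apply: idealMr => //; apply: U0n; apply: satur_sub.
  apply: contrapT => Pt; case: hC => _ H _; apply: H; rewrite /colon /= mul1r.
  exact: (sU n t).
(* The preimage in [R] of the ideal generated by [q ^+ n] in the local ring at [Q]. *)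
pose J n : set R := [set x | exists s r, ~ Q s /\ s * x = r * q ^+ n].
have hJ n : is_ideal (J n).
  split=> [|x y [s [r [Qs Ex]]] [t [u [Qt Ey]]]|c x [s [r [Qs Ex]]]].
  - by exists 1, 0; rewrite mulr0 mul0r.
  - exists (s * t), (t * r + s * u); split; first by move=> /QM[].
    have -> : s * t * (x + y) = t * (s * x) + s * (t * y) by ring.
    by rewrite Ex Ey; ring.
  - by exists s, (c * r); split=> //; rewrite mulrCA Ex mulrA.
have sJ n : saturated Q (J n).
  move=> s x Qs [t [r [Qt E]]]; exists (t * s), r; split; first by move=> /QM[].
  by rewrite -mulrA.
have Jdec n : J n.+1 `<=` J n.
  by move=> x [s [r [Qs E]]]; exists s, (r * q); rewrite -mulrA -exprS.
pose adj n : set R := [set x | exists y r, J n y /\ x = y + r * f].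
pose I n := satur P (adj n).
have hadj n : is_ideal (adj n) by exact: (adjoin_ideal f (hJ n)).
have hI n : is_ideal (I n) by apply: satur_ideal.
have sI n : saturated P (I n) by apply: satur_saturated.
have Idec n : I n.+1 `<=` I n.
  by apply: satur_mono => x [y [r [Jy ->]]]; exists y, r; split=> //; apply: Jdec.
have U0I n : U0 `<=` I n.
  apply: satur_mono => x [r ->]; exists 0, r; rewrite add0r; split=> //; exact: ideal0.
(* Since [P] multiplies [U i.+1] into [U i], consecutive stages differ by a vector space over the
   residue field, where [saturated_dcc] applies. At stage [N], where [U N] is the whole ring, the
   [I n] themselves are stationary. *)
have stable i : exists n, forall m, (n <= m)%N -> I n `&` U i `<=` I m.
  elim: i => [|i [n Hn]]; first by exists 0%N => m _ x [_] /U0I.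
  pose D j := I (n + j)%N `&` U i.+1.
  have capI A B : is_ideal A -> is_ideal B -> is_ideal (A `&` B).
    move=> hA hB; split=> [|x y [Ax Bx] [Ay By]|r x [Ax Bx]].
    - by split; apply: ideal0.
    - by split; apply: idealD.
    - by split; apply: idealMl.
  have [|||j|j s x Ps [Ix Ux]|j x [Ix Ux]|j x [Ix Ux]|j p x Pp [Ix Ux]|j0 Hj0] :=
    @saturated_dcc P (I n `&` U i) D.
  - by [].
  - exact: capI.
  - by move=> s x Ps [Ix Ux]; split; [apply: (sI n s) | apply: (sU i s)].
  - exact: capI.
  - by split; [apply: (sI _ s) | apply: (sU i.+1 s)].
  - by split=> //; apply: Idec; rewrite -addnS.
  - by split; [apply: Hn => //; rewrite leq_addr | apply: colons_sub].
  - split; last exact: Ux.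
    apply: idealMl => //; elim: j Ix => [|j IH]; first by rewrite addn0.
    by rewrite addnS => /Idec.
  exists (n + j0)%N => m nm x Hx.
  have nm' : (n <= m)%N by apply: leq_trans nm; rewrite leq_addr.
  have [//|] := Hj0 (m - n)%N _ x Hx; first by rewrite leq_subRL.
  by rewrite subnKC.
have [n Hn] := stable N.
(* Locally at [P], [J n] equals [J n.+1 + f J n]: in [s * x = y + r * f] the coefficient [r] lies in
   [J n] because [f] is outside [Q]. *)
have JJ : J n `<=` J n.+1.
  apply: (saturated_nakayama (P := P) (f := f)) => // [s x Ps|x Jx].
    by apply: sJ => Qs; apply: Ps; apply: QP.
  have [|s Ps [y [r [Jy E]]]] := Hn n.+1 (leqnSn n) x.
    split; last by rewrite -[x]mulr1; apply: idealMl.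
    by apply: satur_sub => //; exists x, 0; rewrite mul0r addr0.
  exists s, y, r; split=> //; apply: (sJ n f) => //.
  have -> : f * r = s * x - y by rewrite E addrAC subrr add0r mulrC.
  by apply: idealB => //; [apply: idealMl | apply: Jdec].
have [|s [r [Qs E]]] := JJ (q ^+ n); first by exists 1, 1.
have qn0 : q ^+ n <> 0.
  by elim: n {Hn JJ E} => [|n IH]; [apply/eqP/oner_neq0 | rewrite exprS => /dom[]].
apply: Qs; have -> : s = r * q; last exact: idealMl.
by apply: (domain_lreg dom qn0); rewrite mulrC E exprS; ring.
Qed.

Lemma minimal_prime_height_one (dom : is_domain R) f P : f <> 0 ->
  minimal_prime_over (principal f) P -> has_height 1 P.
Proof.
move=> f0 mP; have [hP fP _] := mP; split.
  split=> //; exists [set 0]; first exact: domain_prime.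
  split=> [_ ->|H]; first by case: hP => -[].
  by apply: f0; apply: H; apply: fP; apply: principal_refl.
move=> [_ [Q [hQ [Q' hQ' [Q'Q nQQ']]] [QP nPQ]]].
apply: nQQ' => q Qq; rewrite (krull_principal dom mP hQ QP nPQ Qq).
by case: hQ' => -[].
Qed.

End Krull.

(** * Tensor products over a field *)

Section LinearForms.
Variables (k : fieldType) (V : lmodType k).

Definition linear_form (l : V -> k) : Prop :=
  forall c x y, l (c *: x + y) = c * l x + l y.

Definition is_subspace (W : set V) : Prop :=
  W 0 /\ forall c x y, W x -> W y -> W (c *: x + y).

Section Form.
Variables (l : V -> k) (lP : linear_form l).

Lemma form0 : l 0 = 0.
Proof. by have := lP (-1) 0 0; rewrite scaler0 addr0 mulN1r addNr. Qed.

Lemma formZ c x : l (c *: x) = c * l x.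
Proof. by rewrite -[c *: x]addr0 lP form0 addr0. Qed.

Lemma formD x y : l (x + y) = l x + l y.
Proof. by rewrite -{1}[x]scale1r lP mul1r. Qed.

Lemma form_sum (I : Type) (r : seq I) (F : I -> V) :
  l (\sum_(i <- r) F i) = \sum_(i <- r) l (F i).
Proof. by elim/big_rec2: _ => [|i y x _ <-]; rewrite ?form0 ?formD. Qed.

End Form.

Section Subspace.
Variables (W : set V) (hW : is_subspace W).

Lemma subspaceZ c x : W x -> W (c *: x).
Proof. by case: hW => W0 H Wx; rewrite -[c *: x]addr0; apply: H. Qed.

Lemma subspaceD x y : W x -> W y -> W (x + y).
Proof. by case: hW => _ H; rewrite -{2}[x]scale1r; apply: H. Qed.

Lemma subspaceB x y : W x -> W y -> W (x - y).
Proof. by move=> Wx Wy; apply: subspaceD => //; rewrite -scaleN1r; apply: subspaceZ. Qed.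

Lemma subspace_sum (I : eqType) (r : seq I) (F : I -> V) :
  (forall i, i \in r -> W (F i)) -> W (\sum_(i <- r) F i).
Proof.
move=> HF; rewrite big_seq; apply: big_ind => //; first by case: hW.
by move=> *; apply: subspaceD.
Qed.

End Subspace.

Lemma subspace0 : is_subspace [set 0].
Proof. by split=> // c x y -> ->; rewrite scaler0 addr0. Qed.

(** A subspace maximal among those containing [W] and avoiding [v] is a complement of the line
    through [v]; the form reads off the coordinate along [v]. *)
Lemma separating_form (W : set V) (v : V) : is_subspace W -> ~ W v ->
  exists l, [/\ linear_form l, forall w, W w -> l w = 0 & l v = 1].
Proof.
move=> hW Wv.
have [//|F [X0 FX0] FQ Ftot|H [[hH Hv] WH Hmax]] :=
  @zorn_above V (fun X => is_subspace X /\ ~ X v) W.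
  split; last by move=> [X /FQ[_ ?]].
  split=> [|c x y [X FX Xx] [Y FY Yy]]; first by exists X0 => //; have [[]] := FQ _ FX0.
  have [XY|YX] := Ftot _ _ FX FY.
    by exists Y => //; have [[_ +] _] := FQ _ FY; apply=> //; apply: XY.
  by exists X => //; have [[_ +] _] := FQ _ FX; apply=> //; apply: YX.
have decomp x : exists c, H (x - c *: v).
  apply: contrapT => nx; apply: (nx); exists 0; rewrite scale0r subr0.
  apply: (Hmax [set y | exists c w, H w /\ y = w + c *: x]); last first.
  - by exists 1, 0; rewrite scale1r add0r; split=> //; case: hH.
  - by move=> w Hw; exists 0, w; rewrite scale0r addr0.
  split; first split.
  - by exists 0, 0; rewrite scale0r addr0; split=> //; case: hH.
  - move=> c y z [d [w [Hw ->]]] [e [u [Hu ->]]].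
    exists (c * d + e), (c *: w + u); split; first by case: hH => _; apply.
    by rewrite scalerDr scalerA scalerDl addrACA.
  move=> [c [w [Hw E]]]; have c0 : c != 0.
    by apply: contra_notN Hv => /eqP c0; rewrite E c0 scale0r addr0.
  apply: nx; exists c^-1; rewrite E scalerDr scalerA mulVf // scale1r opprD addrCA subrr addr0.
  by rewrite -scaleNr; apply: subspaceZ.
have uniq x c d : H (x - c *: v) -> H (x - d *: v) -> c = d.
  move=> Hc Hd; apply/eqP; rewrite -subr_eq0; apply: contra_notT Hv => cd.
  rewrite -[v]scale1r -(mulVf cd) -scalerA; apply: subspaceZ => //.
  have -> : (c - d) *: v = (x - d *: v) - (x - c *: v).
    by rewrite scalerBl opprB [RHS]addrC addrA subrK.
  exact: subspaceB.
have [l lP] := choice decomp; exists l; split.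
- move=> c x y; apply: uniq (lP _) _.
  have -> : c *: x + y - (c * l x + l y) *: v = c *: (x - l x *: v) + (y - l y *: v).
    by rewrite scalerBr scalerDl scalerA opprD addrACA.
  by case: hH => _; apply.
- by move=> w /WH Hw; apply: uniq (lP _) _; rewrite scale0r subr0.
- by apply: uniq (lP _) _; rewrite scale1r subrr; case: hH.
Qed.

Lemma form_neq0 (v : V) : v <> 0 -> exists2 l, linear_form l & l v = 1.
Proof. by case/(separating_form subspace0) => l [? _ ?]; exists l. Qed.

End LinearForms.

Lemma ideal_subspace (k : fieldType) (A : comAlgType k) (I : set A) :
  is_ideal I -> is_subspace I.
Proof.
move=> hI; split=> [|c x y Ix Iy]; first exact: ideal0.
by apply: idealD => //; rewrite -[x]mul1r scalerAl; apply: idealMl.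
Qed.

Lemma idealZ (k : fieldType) (A : comAlgType k) (I : set A) c x :
  is_ideal I -> I x -> I (c *: x).
Proof. by move=> /ideal_subspace hI; apply: subspaceZ. Qed.

Section Slices.
Variables (k : fieldType) (R A : comAlgType k).
Implicit Types (l : A -> k) (z w : tensor R A) (r : R) (a : A).

Lemma tensDr r a a' : r ⊗ (a + a') = r ⊗ a + r ⊗ a'.
Proof. by case: (tens_balanced R A). Qed.

Lemma tensZ c r a : r ⊗ (c *: a) = c *: (r ⊗ a).
Proof. by rewrite scale_tens; case: (tens_balanced R A). Qed.

Lemma tens0l a : (0 : R) ⊗ a = 0.
Proof. exact: (bal0l (tens_balanced R A)). Qed.

Lemma tens0r r : r ⊗ (0 : A) = 0.
Proof. exact: (bal0r (tens_balanced R A)). Qed.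

Lemma tens_suml (I : Type) (s : seq I) (F : I -> R) a :
  (\sum_(i <- s) F i) ⊗ a = \sum_(i <- s) F i ⊗ a.
Proof. exact: (bal_suml (tens_balanced R A)). Qed.

Lemma tens_sumr (I : Type) (s : seq I) (F : I -> A) r :
  r ⊗ (\sum_(i <- s) F i) = \sum_(i <- s) r ⊗ F i.
Proof. exact: (bal_sumr (tens_balanced R A)). Qed.

(* The map [id ⊗ l] from [R ⊗ A] to [R]. *)
Definition slice l : tensor R A -> R := tlift (fun r a => l a *: r).

Section Slice.
Variables (l : A -> k) (lP : linear_form l).

Lemma slice_balanced : balanced (fun (r : R) a => l a *: r).
Proof.
split=> [r r' a|r a a'|c r a]; first exact: scalerDr.
  by rewrite formD // scalerDl.
by rewrite formZ // scalerA mulrC.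
Qed.

Lemma slice_tens r a : slice l (r ⊗ a) = l a *: r.
Proof. by rewrite /slice tlift_tens //; exact: slice_balanced. Qed.

Lemma sliceD z w : slice l (z + w) = slice l z + slice l w.
Proof. by rewrite /slice tliftD //; exact: slice_balanced. Qed.

Lemma slice0 : slice l 0 = 0.
Proof. by rewrite /slice tlift0 //; exact: slice_balanced. Qed.

Lemma slice_sum (I : Type) (s : seq I) (F : I -> tensor R A) :
  slice l (\sum_(i <- s) F i) = \sum_(i <- s) slice l (F i).
Proof. by rewrite /slice tlift_sum //; exact: slice_balanced. Qed.

Lemma slice_mull r z : slice l ((r ⊗ 1) * z) = r * slice l z.
Proof.
rewrite [z]tensor_sum mulr_sumr !slice_sum mulr_sumr; apply: eq_bigr => p _.
by rewrite tens_mul mul1r !slice_tens // scalerAr.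
Qed.

Lemma sliceB z w : slice l (z - w) = slice l z - slice l w.
Proof. by apply: (addIr (slice l w)); rewrite -sliceD !subrK. Qed.

End Slice.

(** Induction on the number of terms. If the first factors are linearly independent modulo [V], the
    slices force every form of [L] to vanish on the second factors. Otherwise a relation modulo [V]
    eliminates one term, at the cost of a tensor with first factor in [V]. *)
Lemma tensor_separation (V : set R) (L : set (A -> k)) z : is_subspace V ->
  (forall l, L l -> linear_form l) -> (forall l, L l -> V (slice l z)) ->
  exists s t : seq (R * A), [/\ {in s, forall p, V p.1},
    {in t, forall p, forall l, L l -> l p.2 = 0} &
    z = \sum_(p <- s) p.1 ⊗ p.2 + \sum_(p <- t) p.1 ⊗ p.2].
Proof.
move=> hV hL; pose tsum (s : seq (R * A)) : tensor R A := \sum_(p <- s) p.1 ⊗ p.2.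
have [n [a [b ->]]] : exists n (a : 'I_n -> R) (b : 'I_n -> A), z = \sum_i a i ⊗ b i.
  exists (size (repr z)), (fun i => (nth (0, 0) (repr z) i).1).
  exists (fun i => (nth (0, 0) (repr z) i).2).
  by rewrite {1}[z]tensor_sum (big_nth (0, 0)) big_mkord.
elim: n a b => [|n IH] a b Vz.
  by exists [::], [::]; split=> //; rewrite big_ord0 !big_nil addr0.
have [indep|] := pselect (forall c, V (\sum_i c i *: a i) -> forall i : 'I_n.+1, c i = 0).
  exists [::], [seq (a i, b i) | i <- enum 'I_n.+1]; split=> //.
    move=> _ /mapP[i _ ->] l Ll /=; apply: (indep (l \o b)).
    have := Vz l Ll; rewrite slice_sum; last exact: hL.
    by under eq_bigr do rewrite (slice_tens (hL _ Ll)).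
  by rewrite big_nil add0r big_map big_enum.
move=> /existsNP[c /not_implyP[Vc /existsNP[j /eqP cj]]].
pose v := (c j)^-1 *: \sum_i c i *: a i.
have Vv : V v by apply: subspaceZ.
pose b' i := b (lift j i) - ((c j)^-1 * c (lift j i)) *: b j.
have E : \sum_i a i ⊗ b i = v ⊗ b j + \sum_i a (lift j i) ⊗ b' i.
  rewrite (bigD1_ord j) //= /v [X in _ *: X](bigD1_ord j) //= scalerDr scalerA mulVf // scale1r.
  rewrite tensDl -addrA; congr (_ + _).
  rewrite scaler_sumr tens_suml -big_split; apply: eq_bigr => i _ /=.
  by rewrite scalerA -scale_tens -tensZ -tensDr /b' addrC subrK.
have Vb l : L l -> V (slice l (\sum_i a (lift j i) ⊗ b' i)).
  move=> Ll; have lP := hL _ Ll; have := Vz l Ll; rewrite E sliceD // slice_tens //.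
  by move=> H; rewrite -[slice _ _](addKr (l (b j) *: v)) addrC; apply: subspaceB => //;
    apply: subspaceZ.
have [s [t [sV tL Est]]] := IH _ _ Vb.
exists ((v, b j) :: s), t; split=> //; last by rewrite E Est big_cons addrA.
by move=> p; rewrite inE => /orP[/eqP -> //|]; apply: sV.
Qed.

Lemma tensor_slice_in (V : set R) z : is_subspace V ->
  (forall l, linear_form l -> V (slice l z)) ->
  exists2 s : seq (R * A), {in s, forall p, V p.1} & z = \sum_(p <- s) p.1 ⊗ p.2.
Proof.
move=> hV Vz; have [|s [t [sV tL ->]]] := @tensor_separation V (@linear_form k A) z hV _ Vz.
  by [].
exists s => //; rewrite [X in _ + X]big1_seq ?addr0 // => p /andP[_ /tL pt].
suff -> : p.2 = 0 by rewrite tens0r.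
apply: contrapT => /form_neq0[l lP l1]; have := pt l lP; rewrite l1.
exact/eqP/oner_neq0.
Qed.

Lemma slice_inj z w : (forall l, linear_form l -> slice l z = slice l w) -> z = w.
Proof.
move=> zw; apply/eqP; rewrite -subr_eq0; apply/eqP.
have [l lP|s s0 ->] := tensor_slice_in (z := z - w) (subspace0 R).
  by rewrite sliceB // zw // subrr.
by rewrite big1_seq // => p /andP[_ /s0 ->]; rewrite tens0l.
Qed.

(** Flatness over a field: slices commute with multiplication by elements of [R], and they separate
    tensors. *)
Lemma tensorM_lreg (c : R) : (forall x y, c * x = c * y -> x = y) ->
  forall z w, (c ⊗ 1) * z = (c ⊗ 1) * w -> z = w.
Proof.
move=> cI z w E; apply: slice_inj => l lP; apply: cI.
by rewrite -!slice_mull // E.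
Qed.

End Slices.

Section UniversalProperty.
Variables (k : fieldType) (R A : comAlgType k).

Lemma tensor_ind (P : tensor R A -> Prop) : P 0 ->
  (forall z w, P z -> P w -> P (z + w)) -> (forall r a, P (r ⊗ a)) -> forall z, P z.
Proof. by move=> P0 PD Pt z; rewrite [z]tensor_sum; apply: big_ind. Qed.

Lemma tensor_ext (V : zmodType) (f g : {additive tensor R A -> V}) :
  (forall r a, f (r ⊗ a) = g (r ⊗ a)) -> f =1 g.
Proof. by move=> fg z; rewrite [z]tensor_sum !raddf_sum; apply: eq_bigr. Qed.

Lemma tlift_ext (V : zmodType) (f g : R -> A -> V) z :
  (forall r a, f r a = g r a) -> tlift f z = tlift g z.
Proof. by move=> fg; apply: eq_bigr. Qed.

Definition tinl (r : R) : tensor R A := r ⊗ 1.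
Definition tinr (a : A) : tensor R A := 1 ⊗ a.

Fact tinl_zmod : zmod_morphism tinl.
Proof. by move=> x y; rewrite /tinl tensDl -[- y]scaleN1r -scale_tens scaleN1r. Qed.
Fact tinl_monoid : monoid_morphism tinl.
Proof. by split=> // x y; rewrite /tinl tens_mul mulr1. Qed.
Fact tinl_scal : scalable tinl.
Proof. by move=> c x; rewrite /tinl scale_tens. Qed.
HB.instance Definition _ := GRing.isZmodMorphism.Build R (tensor R A) tinl tinl_zmod.
HB.instance Definition _ := GRing.isMonoidMorphism.Build R (tensor R A) tinl tinl_monoid.
HB.instance Definition _ := GRing.isScalable.Build k R (tensor R A) *:%R tinl tinl_scal.

Fact tinr_zmod : zmod_morphism tinr.
Proof. by move=> x y; rewrite /tinr tensDr -[- y]scaleN1r tensZ scaleN1r. Qed.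
Fact tinr_monoid : monoid_morphism tinr.
Proof. by split=> // x y; rewrite /tinr tens_mul mulr1. Qed.
Fact tinr_scal : scalable tinr.
Proof. by move=> c x; rewrite /tinr tensZ. Qed.
HB.instance Definition _ := GRing.isZmodMorphism.Build A (tensor R A) tinr tinr_zmod.
HB.instance Definition _ := GRing.isMonoidMorphism.Build A (tensor R A) tinr tinr_monoid.
HB.instance Definition _ := GRing.isScalable.Build k A (tensor R A) *:%R tinr tinr_scal.

Section Pairing.
Variables (C : comAlgType k) (f : {lrmorphism R -> C}) (g : {lrmorphism A -> C}).

(** The tensor product as a coproduct of commutative algebras. Maps out of it are brought to this
    form to obtain their multiplicativity. *)
Definition tpair : tensor R A -> C := tlift (fun r a => f r * g a).

Lemma tpair_balanced : balanced (fun r a => f r * g a).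
Proof.
split=> [r r' a|r a a'|c r a]; rewrite ?rmorphD ?mulrDl ?mulrDr //.
by rewrite !linearZ /= -scalerAl scalerAr.
Qed.

Lemma tpair_tens r a : tpair (r ⊗ a) = f r * g a.
Proof. exact/tlift_tens/tpair_balanced. Qed.

Fact tpair_zmod : zmod_morphism tpair.
Proof.
move=> x y; apply: (addIr (tpair y)).
by rewrite -[in LHS](tliftD tpair_balanced) !subrK.
Qed.
HB.instance Definition _ := GRing.isZmodMorphism.Build (tensor R A) C tpair tpair_zmod.

Fact tpair_monoid : monoid_morphism tpair.
Proof.
split=> [|x y]; first by rewrite [X in tpair X](erefl : 1 = 1 ⊗ 1) tpair_tens !rmorph1 mulr1.
rewrite [x]tensor_sum [y]tensor_sum mulr_suml !raddf_sum mulr_suml.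
apply: eq_bigr => p _; rewrite mulr_sumr !raddf_sum mulr_sumr; apply: eq_bigr => q _.
by rewrite /= tens_mul !tpair_tens !rmorphM mulrACA.
Qed.
HB.instance Definition _ := GRing.isMonoidMorphism.Build (tensor R A) C tpair tpair_monoid.

Fact tpair_scal : scalable tpair.
Proof.
move=> c x; have -> : c *: x = (c%:A ⊗ 1) * x by [].
by rewrite rmorphM /= tpair_tens rmorph1 mulr1 linearZ /= rmorph1 -scalerAl mul1r.
Qed.
HB.instance Definition _ := GRing.isScalable.Build k (tensor R A) C *:%R tpair tpair_scal.

End Pairing.
End UniversalProperty.

Section MapsAsPairings.
Variables (k : fieldType).
Implicit Types A B C D : comAlgType k.

(** [tmap] is a bare function; as a [tpair] it inherits the structure of an algebra morphism. *)
Lemma tmapE A B C D (f : {lrmorphism A -> C}) (g : {lrmorphism B -> D}) z :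
  tmap f g z = tpair (@tinl k C D \o f) (@tinr k C D \o g) z.
Proof. by apply: tlift_ext => a b; rewrite /= tens_mul mulr1 mul1r. Qed.

Definition tassoc_l A B C : tensor (tensor A B) C -> tensor A (tensor B C) :=
  tpair (tpair (@tinl k A (tensor B C)) (@tinr k A (tensor B C) \o @tinl k B C))
        (@tinr k A (tensor B C) \o @tinr k B C).

End MapsAsPairings.

(** * Quotient algebras *)

Section QuotientAlgebra.
Variables (k : fieldType) (B : comAlgType k) (I : set B).
Hypotheses (hI : is_ideal I) (nI1 : ~ I 1).

Definition ideal_pred of is_ideal I & ~ I 1 : {pred B} := fun x => `[< I x >].
Local Notation IP := (ideal_pred hI nI1).

Fact ideal_pred_closed : idealr_closed IP.
Proof.
split; [apply/asboolP; exact: ideal0 | by apply/negP => /asboolP |].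
move=> a x y /asboolP Ix /asboolP Iy; apply/asboolP.
by apply: idealD => //; apply: idealMl.
Qed.
HB.instance Definition _ := isIdealr.Build B IP ideal_pred_closed.

Definition quot_alg : Type := {ideal_quot IP}.
HB.instance Definition _ := GRing.ComNzRing.on quot_alg.

Definition quot_map (x : B) : quot_alg := \pi_({ideal_quot IP})%qT x.

Lemma quot_mapP x y : quot_map x = quot_map y <-> I (x - y).
Proof.
split=> [/eqP|Ixy]; first by rewrite -Quotient.idealrBE => /asboolP.
by apply/eqP; rewrite -Quotient.idealrBE; apply/asboolP.
Qed.

Lemma quot_map_eq0 x : quot_map x = 0 <-> I x.
Proof.
have -> : 0 = quot_map 0 by rewrite /quot_map pi_zeror.
by rewrite quot_mapP subr0.
Qed.

Lemma quot_map_surj (z : quot_alg) : exists x, quot_map x = z.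
Proof. by exists (repr z); apply: reprK. Qed.

Fact quot_map_zmod : zmod_morphism quot_map.
Proof. by move=> x y; rewrite /quot_map pi_addr pi_oppr. Qed.
Fact quot_map_monoid : monoid_morphism quot_map.
Proof. by split=> [|x y]; rewrite /quot_map ?pi_oner ?pi_mulr. Qed.
HB.instance Definition _ := GRing.isZmodMorphism.Build B quot_alg quot_map quot_map_zmod.
HB.instance Definition _ := GRing.isMonoidMorphism.Build B quot_alg quot_map quot_map_monoid.

Fact quot_scaleA (c d : k) (x : quot_alg) :
  quot_map c%:A * (quot_map d%:A * x) = quot_map (c * d)%:A * x.
Proof. by rewrite mulrA -rmorphM -scalerAl mul1r scalerA. Qed.
Fact quot_scale1 (x : quot_alg) : quot_map 1%:A * x = x.
Proof. by rewrite scale1r rmorph1 mul1r. Qed.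
Fact quot_scaleDr (c : k) (x y : quot_alg) :
  quot_map c%:A * (x + y) = quot_map c%:A * x + quot_map c%:A * y.
Proof. exact: mulrDr. Qed.
Fact quot_scaleDl (x : quot_alg) (c d : k) :
  quot_map (c + d)%:A * x = quot_map c%:A * x + quot_map d%:A * x.
Proof. by rewrite scalerDl rmorphD mulrDl. Qed.
HB.instance Definition _ := GRing.Zmodule_isLmodule.Build k quot_alg
  quot_scaleA quot_scale1 quot_scaleDr quot_scaleDl.
Fact quot_scaleAl (c : k) (x y : quot_alg) : c *: (x * y) = c *: x * y.
Proof. exact: mulrA. Qed.
HB.instance Definition _ := GRing.Lmodule_isLalgebra.Build k quot_alg quot_scaleAl.
HB.instance Definition _ := GRing.Lalgebra_isComAlgebra.Build k quot_alg.

Fact quot_map_scal : scalable quot_map.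
Proof. by move=> c x; rewrite -[x in LHS]mul1r scalerAl rmorphM. Qed.
HB.instance Definition _ := GRing.isScalable.Build k B quot_alg *:%R quot_map quot_map_scal.

Section Descent.
Variables (C : comAlgType k) (f : {lrmorphism B -> C}).
Hypothesis f0 : forall x, I x -> f x = 0.

Definition quot_desc of (forall x, I x -> f x = 0) : quot_alg -> C := fun z => f (repr z).
Local Notation g := (quot_desc f0).

Lemma quot_descE x : g (quot_map x) = f x.
Proof.
apply/eqP; rewrite -subr_eq0 -rmorphB; apply/eqP/f0/quot_mapP.
exact: reprK.
Qed.

Fact quot_desc_zmod : zmod_morphism g.
Proof.
move=> x y; have [[u <-] [v <-]] := (quot_map_surj x, quot_map_surj y).
by rewrite -rmorphB !quot_descE rmorphB.
Qed.
Fact quot_desc_monoid : monoid_morphism g.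
Proof.
split=> [|x y]; first by rewrite -(rmorph1 quot_map) quot_descE rmorph1.
have [[u <-] [v <-]] := (quot_map_surj x, quot_map_surj y).
by rewrite -rmorphM !quot_descE rmorphM.
Qed.
Fact quot_desc_scal : scalable g.
Proof.
by move=> c x; have [u <-] := quot_map_surj x; rewrite -linearZ !quot_descE linearZ.
Qed.
HB.instance Definition _ := GRing.isZmodMorphism.Build quot_alg C g quot_desc_zmod.
HB.instance Definition _ := GRing.isMonoidMorphism.Build quot_alg C g quot_desc_monoid.
HB.instance Definition _ := GRing.isScalable.Build k quot_alg C *:%R g quot_desc_scal.

End Descent.
End QuotientAlgebra.

(** * Coordinates at the identity of a smooth connected group *)

Section AdicFiltration.
Variables (k : fieldType) (A : comAlgType k) (eps : {lrmorphism A -> k^o}).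

(** The powers of the augmentation ideal, the maximal ideal of the point [eps]. *)
Fixpoint mpow (n : nat) : set A :=
  if n is n'.+1 then
    [set a | exists2 s : seq (A * A), {in s, forall p, eps p.1 = 0 /\ mpow n' p.2}
                                    & a = \sum_(p <- s) p.1 * p.2]
  else setT.

Lemma mpow_ideal n : is_ideal (mpow n).
Proof.
case: n => [//|n]; split=> [|_ _ [s Hs ->] [t Ht ->]|r _ [s Hs ->]].
- by exists [::]; rewrite ?big_nil.
- exists (s ++ t); last by rewrite big_cat.
  by move=> p; rewrite mem_cat => /orP[/Hs|/Ht].
- exists [seq (r * p.1, p.2) | p <- s].
    by move=> _ /mapP[p /Hs[e1 m2] ->]; rewrite /= rmorphM /= e1 mulr0.
  by rewrite big_map mulr_sumr; apply: eq_bigr => p _; rewrite mulrA.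
Qed.

Lemma mpowMl n u v : eps u = 0 -> mpow n v -> mpow n.+1 (u * v).
Proof.
move=> eu mv; exists [:: (u, v)]; last by rewrite big_seq1.
by move=> p; rewrite inE => /eqP ->.
Qed.

Lemma mpowS n : mpow n.+1 `<=` mpow n.
Proof.
move=> _ [s Hs ->]; apply: ideal_sum => [|p /Hs[_ mp] _]; first exact: mpow_ideal.
by apply: idealMl => //; apply: mpow_ideal.
Qed.

Lemma mpow_mono n m : (n <= m)%N -> mpow m `<=` mpow n.
Proof. by move=> /subnK <-; elim: (m - n)%N => //= d IH; apply: subset_trans (mpowS (n := _)) IH. Qed.

Lemma mpow1P a : mpow 1 a <-> eps a = 0.
Proof.
split=> [[s Hs ->]|ea]; last by rewrite -[a]mulr1; apply: mpowMl.
rewrite rmorph_sum big1_seq // => p /andP[_ /Hs[e1 _]].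
by rewrite /= rmorphM /= e1 mul0r.
Qed.

Lemma eps1 : eps 1 = 1. Proof. exact: rmorph1. Qed.

Lemma epsA c : eps c%:A = c.
Proof. by rewrite linearZ /= eps1; apply: mulr1. Qed.

Lemma eps_sub a : eps (a - (eps a : k)%:A) = 0.
Proof. by rewrite rmorphB /= epsA subrr. Qed.

(** With [U] and [V] the linear parts of [u] and [v], this exhibits the linear part of [u * v]
    prescribed by the Leibniz rule: the right-hand side lies in the square of the augmentation ideal
    as soon as the two errors do. *)
Lemma product_expansion u v U V :
  u * v - (eps (u * v) : k)%:A - ((eps u : k) *: V + (eps v : k) *: U) =
  (u - (eps u : k)%:A) * (v - (eps v : k)%:A) +
  ((eps u : k) *: (v - (eps v : k)%:A - V) + (eps v : k) *: (u - (eps u : k)%:A - U)).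
Proof.
rewrite rmorphM /= -[(eps u * eps v)%:A]scalerA.
rewrite -[(eps u : k) *: V]mulr_algl -[(eps v : k) *: U]mulr_algl.
rewrite -[(eps u : k) *: (_ - _)]mulr_algl -[(eps v : k) *: (_ - _)]mulr_algl.
rewrite -[(eps u : k) *: _%:A]mulr_algl; ring.
Qed.

Hypothesis ftA : finite_type A.

Definition cotangent_spans d (x : 'I_d -> A) : Prop :=
  (forall i, eps (x i) = 0) /\
  forall a, exists c : 'I_d -> k, mpow 2 (a - (eps a : k)%:A - \sum_i c i *: x i).

Lemma cotangent_spans_ex : exists d, exists x : 'I_d -> A, cotangent_spans x.
Proof.
have [gens Hgens] := ftA.
pose x (i : 'I_(size gens)) : A := gens`_i - (eps gens`_i : k)%:A.
exists (size gens), x; split=> [i|a]; first exact: eps_sub.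
pose B : {pred A} := fun a => `[< exists c : 'I_(size gens) -> k,
  mpow 2 (a - (eps a : k)%:A - \sum_i c i *: x i) >].
suff Ba : a \in B by apply/asboolP; exact: Ba.
have h2 := mpow_ideal 2.
apply: Hgens => [|y /(nthP 0)[i Hi <-]]; last first.
  apply/asboolP; exists (fun j => (j == Ordinal Hi)%:R).
  rewrite (bigD1 (Ordinal Hi)) //= eqxx scale1r big1 ?addr0 => [|j /negbTE ->].
    by rewrite /x /= subrr; exact: (ideal0 h2).
  by rewrite scale0r.
split=> [|c u v /asboolP[cu Hu] /asboolP[cv Hv]|u v /asboolP[cu Hu] /asboolP[cv Hv]];
  apply/asboolP.
- exists (fun=> 0); rewrite eps1 scale1r subrr sub0r big1 ?oppr0; first exact: (ideal0 h2).
  by move=> i _; rewrite scale0r.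
- exists (fun i => c * cu i + cv i).
  have -> : \sum_i (c * cu i + cv i) *: x i = c *: (\sum_i cu i *: x i) + \sum_i cv i *: x i.
    rewrite scaler_sumr -big_split; apply: eq_bigr => i _ /=.
    by rewrite scalerDl scalerA.
  have -> : (eps (c *: u + v) : k)%:A = c *: (eps u : k)%:A + (eps v : k)%:A :> A.
    by rewrite linearP scalerDl scalerA.
  set U := \sum_i cu i *: x i in Hu *; set V := \sum_i cv i *: x i in Hv *.
  have -> : c *: u + v - (c *: (eps u : k)%:A + (eps v : k)%:A) - (c *: U + V) =
      c *: (u - (eps u : k)%:A - U) + (v - (eps v : k)%:A - V).
    by rewrite !scalerBr; ring.
  by apply: idealD => //; apply: idealZ.
exists (fun i => (eps u : k) * cv i + (eps v : k) * cu i).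
have -> : \sum_i ((eps u : k) * cv i + (eps v : k) * cu i) *: x i =
    (eps u : k) *: (\sum_i cv i *: x i) + (eps v : k) *: \sum_i cu i *: x i.
  rewrite !scaler_sumr -big_split; apply: eq_bigr => i _ /=.
  by rewrite scalerDl !scalerA.
set U := \sum_i cu i *: x i in Hu *; set V := \sum_i cv i *: x i in Hv *.
rewrite product_expansion.
apply: idealD => //; last by apply: idealD => //; apply: idealZ.
by apply: mpowMl; [apply: eps_sub | apply/mpow1P/eps_sub].
Qed.

(* A regular system of parameters [x] at the point [eps] and the dual basis [dl]
   of the tangent space. *)
Definition cotangent_basis d (x : 'I_d -> A) (dl : 'I_d -> A -> k) : Prop :=
  [/\ forall i, eps (x i) = 0, forall i, linear_form (dl i),
      forall i j, dl i (x j) = (i == j)%:R,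
      forall i a b, dl i (a * b) = (eps a : k) * dl i b + (eps b : k) * dl i a &
      forall a, mpow 2 (a - (eps a : k)%:A - \sum_i dl i a *: x i)].

(** A spanning family of least size is a basis of the cotangent space, since a relation would allow
    one member to be dropped. Uniqueness of coefficients then gives linearity, duality and the
    Leibniz rule for [dl]. *)
Lemma cotangent_basis_ex : exists d (x : 'I_d -> A) (dl : 'I_d -> A -> k),
  cotangent_basis x dl.
Proof.
pose P d := `[< exists x : 'I_d -> A, cotangent_spans x >].
have exP : exists d, P d by have [d Hd] := cotangent_spans_ex; exists d; apply/asboolP.
case: (ex_minnP exP) => d /asboolP[x [ex Hx]] dmin.
have h2 := mpow_ideal 2.
have indep (c : 'I_d -> k) : mpow 2 (\sum_i c i *: x i) -> forall j, c j = 0.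
  move=> Hc j; apply: contrapT => /eqP cj.
  case: d x ex Hx dmin c Hc j cj => [|d] x ex Hx dmin c Hc j cj; first by have := ltn_ord j.
  suff : P d by move=> /dmin; rewrite ltnn.
  apply/asboolP; exists (fun i => x (lift j i)); split=> // a.
  have [b Hb] := Hx a; exists (fun i => b (lift j i) - b j * ((c j)^-1 * c (lift j i))).
  have -> : \sum_i (b (lift j i) - b j * ((c j)^-1 * c (lift j i))) *: x (lift j i) =
      \sum_i b i *: x i - (b j * (c j)^-1) *: \sum_i c i *: x i.
    rewrite (bigD1_ord j) //= [X in _ - _ *: X](bigD1_ord j) //=.
    rewrite scalerDr scalerA divfK // opprD addrACA subrr add0r.
    rewrite scaler_sumr -sumrB; apply: eq_bigr => i _.
    by rewrite scalerA mulrA scalerBl.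
  by rewrite opprB addrA -addrAC; apply: idealD => //; apply: idealZ.
have uniq (a : A) (c e : 'I_d -> k) : mpow 2 (a - \sum_i c i *: x i) ->
    mpow 2 (a - \sum_i e i *: x i) -> forall j, c j = e j.
  move=> Hc He j; apply/eqP; rewrite -subr_eq0; apply/eqP.
  apply: (indep (fun i => c i - e i)).
  have -> : \sum_i (c i - e i) *: x i = (a - \sum_i e i *: x i) - (a - \sum_i c i *: x i).
    by under eq_bigr do rewrite scalerBl; rewrite sumrB; ring.
  exact: idealB.
have [dl Hdl] := choice Hx; exists d, x, (fun i a => dl a i); split=> //.
- move=> i c a b; apply: (uniq (c *: a + b - (eps (c *: a + b) : k)%:A)
    _ (fun i => c * dl a i + dl b i)) => //.
  have -> : \sum_i (c * dl a i + dl b i) *: x i =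
      c *: (\sum_i dl a i *: x i) + \sum_i dl b i *: x i.
    rewrite scaler_sumr -big_split; apply: eq_bigr => j _ /=.
    by rewrite scalerDl scalerA.
  have -> : (eps (c *: a + b) : k)%:A = c *: (eps a : k)%:A + (eps b : k)%:A :> A.
    by rewrite linearP scalerDl scalerA.
  set U := \sum_i _; set V := \sum_i _.
  have -> : c *: a + b - (c *: (eps a : k)%:A + (eps b : k)%:A) - (c *: U + V) =
      c *: (a - (eps a : k)%:A - U) + (b - (eps b : k)%:A - V).
    by rewrite !scalerBr; ring.
  by apply: idealD => //; apply: idealZ => //; apply: Hdl.
- move=> i j; apply: (uniq (x j - (eps (x j) : k)%:A) _ (fun i => (i == j)%:R)) => //.
  rewrite (bigD1 j) //= eqxx scale1r big1 ?addr0 => [|l /negbTE ->].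
    by rewrite ex scale0r subr0 subrr; exact: (ideal0 h2).
  by rewrite scale0r.
move=> i a b; apply: (uniq (a * b - (eps (a * b) : k)%:A) _
  (fun i => (eps a : k) * dl b i + (eps b : k) * dl a i)) => //.
have -> : \sum_i ((eps a : k) * dl b i + (eps b : k) * dl a i) *: x i =
    (eps a : k) *: (\sum_i dl b i *: x i) + (eps b : k) *: \sum_i dl a i *: x i.
  rewrite !scaler_sumr -big_split; apply: eq_bigr => j _ /=.
  by rewrite scalerDl !scalerA.
have := Hdl b; have := Hdl a.
set U := \sum_i _; set V := \sum_i _ => HU HV.
rewrite product_expansion; apply: idealD => //.
  by apply: mpowMl; [apply: eps_sub | apply/mpow1P/eps_sub].
by apply: idealD => //; apply: idealZ.
Qed.

End AdicFiltration.

Lemma mnm_ind (d : nat) (P : 'X_{1..d} -> Prop) : P 0%MM ->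
  (forall i m, P m -> P (U_(i) + m)%MM) -> forall m, P m.
Proof.
move=> P0 PS m; elim: {m}(mdeg m) {-2}m (erefl (mdeg m)) => [m /eqP|n IH m mn].
  by rewrite mdeg_eq0 => /eqP ->.
have [i mi] : exists i, m i != 0%N.
  apply/existsP; apply: contra_eqT mn => /existsPn H.
  rewrite mdegE big1 // => i _; apply/eqP; exact: negbNE (H i).
have E : (U_(i) + (m - U_(i)))%MM = m by rewrite addmC submK // lep1mP.
rewrite -E; apply: PS; apply: IH; apply: succn_inj.
by rewrite -mn -[in RHS]E mdegD mdeg1.
Qed.

(** * Truncated polynomial rings and Taylor expansions *)

Section Truncation.
Variables (k : fieldType) (d : nat).
Local Notation pol := {mpoly k[d]}.

(** The [N]-th power of the ideal generated by the variables, read off coefficients. *)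
Definition trunc N : set pol := [set q | forall m, (mdeg m < N)%N -> q@_m = 0].

Lemma truncM a b q r : trunc a q -> trunc b r -> trunc (a + b) (q * r).
Proof.
move=> qa rb m mab; rewrite mcoeffM big1 // => -[[u Hu] [v Hv]] /= /eqP E.
have [ua|au] := ltnP (mdeg u) a; first by rewrite qa // mul0r.
rewrite (rb v) ?mulr0 //; rewrite -(ltn_add2l a); apply: leq_ltn_trans mab.
by rewrite E mdegD leq_add2r.
Qed.

Lemma trunc0 q : trunc 0 q. Proof. by []. Qed.

Lemma trunc_ideal N : is_ideal (trunc N).
Proof.
split=> [m _|q r qN rN m mN|q r rN]; first exact: mcoeff0.
  by rewrite mcoeffD qN // rN // addr0.
by rewrite -[N]add0n; apply: truncM.
Qed.

Lemma trunc_mono N M : (N <= M)%N -> trunc M `<=` trunc N.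
Proof. by move=> NM q qM m mN; apply: qM; apply: leq_trans NM. Qed.

Lemma truncX N m : (N <= mdeg m)%N -> trunc N 'X_[m].
Proof.
move=> Nm u uN; rewrite mcoeffX; case: eqP => // E.
by move: uN; rewrite -E ltnNge Nm.
Qed.

Lemma trunc1 N : ~ trunc N.+1 1.
Proof.
by move=> /(_ 0%MM); rewrite mdeg0 mcoeff1 eqxx => /(_ isT)/eqP; rewrite oner_eq0.
Qed.

Definition truncated N := quot_alg (trunc_ideal N.+1) (@trunc1 N).
Local Notation tr N := (quot_map (trunc_ideal N.+1) (@trunc1 N)).

Fact tr_drop N q : trunc N.+2 q -> tr N q = 0.
Proof. by move=> qN; apply/quot_map_eq0; apply: trunc_mono qN. Qed.

Definition drop_degree N : {lrmorphism truncated N.+1 -> truncated N} :=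
  quot_desc (@tr_drop N).

Lemma drop_degreeE N q : drop_degree N (tr N.+1 q) = tr N q.
Proof. exact: quot_descE. Qed.

Lemma drop_degree_surj N z : exists y, drop_degree N y = z.
Proof. by have [q <-] := quot_map_surj z; exists (tr N.+1 q); rewrite drop_degreeE. Qed.

(** Terms of degree at least [N + 1] multiply to degree at least [2 N + 2], which is zero in
    [truncated k d N.+1]. This is what makes the lifting property applicable. *)
Lemma drop_degree_sqr0 N y z : drop_degree N y = 0 -> drop_degree N z = 0 -> y * z = 0.
Proof.
have [[q <-] [r <-]] := (quot_map_surj y, quot_map_surj z).
rewrite !drop_degreeE -rmorphM => /quot_map_eq0 qN /quot_map_eq0 rN.
by apply/quot_map_eq0; apply: trunc_mono (truncM qN rN); rewrite addnS addSn ltnS leq_addr.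
Qed.

End Truncation.

(** The coefficient at [m] of the product of two power series with coefficients [a] and [b]; the
    bounded index type is the one of [mcoeffM]. *)
Definition conv (R : nzRingType) (d : nat) (a b : 'X_{1..d} -> R) (m : 'X_{1..d}) : R :=
  \sum_(p : 'X_{1..d < (mdeg m).+1, (mdeg m).+1} | m == (p.1 + p.2)%MM) a p.1 * b p.2.

Section FormalCoordinates.
Variables (k : fieldType) (A : comAlgType k) (eps : {lrmorphism A -> k^o}).
Hypothesis smA : smooth A.
Variables (d : nat) (x : 'I_d -> A) (dl : 'I_d -> A -> k).
Hypothesis xdl : cotangent_basis eps x dl.
Local Notation pol := {mpoly k[d]}.
Local Notation tr N := (quot_map (@trunc_ideal k d N.+1) (@trunc1 k d N)).

Definition tangent_pol (a : A) : pol := (eps a : k)%:MP + \sum_i dl i a *: 'X_i.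
Definition tangent_map (a : A) : truncated k d 1 := tr 1 (tangent_pol a).

Fact tangent_linear c a b : tangent_pol (c *: a + b) = c *: tangent_pol a + tangent_pol b.
Proof.
have [_ ldl _ _ _] := xdl.
rewrite /tangent_pol linearP /= scalerDr addrACA mpolyCD -mul_mpolyC mpolyCM; congr (_ + _).
rewrite scaler_sumr -big_split; apply: eq_bigr => i _ /=.
by rewrite ldl scalerDl scalerA.
Qed.

Fact tangent_zmod : zmod_morphism tangent_map.
Proof.
move=> a b; rewrite /tangent_map -rmorphB -scaleN1r addrC tangent_linear.
by rewrite scaleN1r addrC.
Qed.
Fact tangent_scal : scalable tangent_map.
Proof.
have t0 : tangent_pol 0 = 0.
  by have := tangent_linear (-1) 0 0; rewrite scaler0 addr0 scaleN1r addNr.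
by move=> c a; rewrite /tangent_map -linearZ -[c *: a]addr0 tangent_linear t0 addr0.
Qed.
Fact tangent_monoid : monoid_morphism tangent_map.
Proof.
have [_ ldl _ Ddl _] := xdl; split=> [|a b].
  rewrite /tangent_map /tangent_pol eps1 big1 ?addr0 ?rmorph1 // => i _.
  have := Ddl i 1 1; rewrite !mulr1 eps1 !mul1r => /eqP.
  by rewrite -subr_eq0 opprD addNKr oppr_eq0 => /eqP ->; rewrite scale0r.
rewrite /tangent_map -rmorphM; apply/quot_mapP.
pose D a : pol := \sum_i dl i a *: 'X_i.
have TD a' : trunc 1 (D a').
  apply: ideal_sum => [|i _ _]; first exact: trunc_ideal.
  by apply: (idealZ _ (@trunc_ideal k d 1)); apply: truncX; rewrite mdeg1.
suff -> : tangent_pol (a * b) - tangent_pol a * tangent_pol b = - (D a * D b).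
  by apply: (idealN (@trunc_ideal k d 2)); apply: (truncM (a := 1) (b := 1)).
have -> : tangent_pol (a * b) = (eps a : k)%:MP * (eps b : k)%:MP +
    ((eps a : k)%:MP * D b + (eps b : k)%:MP * D a).
  rewrite /tangent_pol rmorphM /= mpolyCM; congr (_ + _).
  rewrite !mulr_sumr -big_split; apply: eq_bigr => i _ /=.
  by rewrite !mul_mpolyC Ddl scalerDl !scalerA.
by rewrite /tangent_pol -!/(D _); ring.
Qed.
HB.instance Definition _ :=
  GRing.isZmodMorphism.Build A (truncated k d 1) tangent_map tangent_zmod.
HB.instance Definition _ :=
  GRing.isMonoidMorphism.Build A (truncated k d 1) tangent_map tangent_monoid.
HB.instance Definition _ :=
  GRing.isScalable.Build k A (truncated k d 1) *:%R tangent_map tangent_scal.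

Lemma lift_step N (f : {lrmorphism A -> truncated k d N}) :
  exists g : {lrmorphism A -> truncated k d N.+1}, forall a, drop_degree k d N (g a) = f a.
Proof.
by apply: smA.2; [exact: drop_degree_surj | exact: drop_degree_sqr0].
Qed.

(** A compatible system of lifts of the tangent map, standing for a ring map to power series. The
    index is offset by one because the tangent map already sees degree one. *)
Fixpoint lifts N : {lrmorphism A -> truncated k d N.+1} :=
  if N is N'.+1 then sval (cid (lift_step (lifts N'))) else tangent_map.

Lemma liftsS N a : drop_degree k d N.+1 (lifts N.+1 a) = lifts N a.
Proof. by rewrite /=; case: cid. Qed.

(* [q] is the Taylor polynomial of [a] up to degree [N + 1]. *)
Definition taylor N (a : A) (q : pol) : Prop := tr N.+1 q = lifts N a.

Lemma taylor_ex N a : exists q, taylor N a q.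
Proof. exact: quot_map_surj. Qed.

Lemma taylor_le N M a q : (N <= M)%N -> taylor M a q -> taylor N a q.
Proof.
move=> /subnK <-; elim: (M - N)%N => //= n IH Hq; apply: IH.
by rewrite /taylor -drop_degreeE Hq; apply: liftsS.
Qed.

Lemma taylor_uniq N a q r : taylor N a q -> taylor N a r -> trunc N.+2 (q - r).
Proof. rewrite /taylor => Hq Hr.
by apply/(quot_mapP (@trunc_ideal k d N.+2) (@trunc1 k d N.+1)); rewrite Hq Hr. Qed.

Lemma taylorD N a b q r : taylor N a q -> taylor N b r -> taylor N (a + b) (q + r).
Proof.
rewrite /taylor => Hq Hr; have -> : lifts N (a + b) = lifts N a + lifts N b by rewrite rmorphD.
by rewrite -Hq -Hr -rmorphD.
Qed.

Lemma taylorM N a b q r : taylor N a q -> taylor N b r -> taylor N (a * b) (q * r).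
Proof.
rewrite /taylor => Hq Hr; have -> : lifts N (a * b) = lifts N a * lifts N b by rewrite rmorphM.
by rewrite -Hq -Hr -rmorphM.
Qed.

Lemma taylorZ N c a q : taylor N a q -> taylor N (c *: a) (c *: q).
Proof.
rewrite /taylor => Hq; have -> : lifts N (c *: a) = c *: lifts N a by rewrite linearZ.
by rewrite -Hq -linearZ.
Qed.

Lemma taylor_0 N : taylor N 0 0.
Proof. by rewrite /taylor !rmorph0. Qed.

Lemma taylor_1 N : taylor N 1 1.
Proof. by rewrite /taylor !rmorph1. Qed.

Lemma taylor_tangent a : taylor 0 a (tangent_pol a).
Proof. by []. Qed.

(** The coefficient at [m] of the Taylor series. By [coordE], any other level that is precise
    enough, and any other representative, gives the same value. *)
Definition coord (m : 'X_{1..d}) (a : A) : k := (repr (lifts (mdeg m) a))@_m.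

Lemma coordE N m a q : taylor N a q -> (mdeg m < N.+2)%N -> q@_m = coord m a.
Proof.
move=> Hq mN; have [r Hr] := taylor_ex (maxn N (mdeg m)) a.
have Hc : taylor (mdeg m) a (repr (lifts (mdeg m) a)) by apply: reprK.
have /(_ m mN) := taylor_uniq Hq (taylor_le (leq_maxl _ _) Hr).
have /(_ m (leqW (leqnn _))) := taylor_uniq Hc (taylor_le (leq_maxr _ _) Hr).
by rewrite !mcoeffB => /subr0_eq E /subr0_eq ->; rewrite -E.
Qed.

Lemma coord_form m : linear_form (coord m).
Proof.
move=> c a b; have [q Hq] := taylor_ex (mdeg m) a; have [r Hr] := taylor_ex (mdeg m) b.
rewrite -(coordE Hq) // -(coordE Hr) // -(coordE (taylorD (taylorZ c Hq) Hr)) //.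
by rewrite mcoeffD mcoeffZ.
Qed.

Lemma coord0 a : coord 0%MM a = eps a.
Proof.
rewrite -(coordE (taylor_tangent a)) ?mdeg0 // mcoeffD mcoeffC eqxx mulr1.
rewrite raddf_sum big1 ?addr0 // => i _ /=.
by rewrite mcoeffZ mcoeffX -mdeg_eq0 mdeg1 mulr0.
Qed.

Lemma coordM m a b : coord m (a * b) = conv (coord^~ a) (coord^~ b) m.
Proof.
have [q Hq] := taylor_ex (mdeg m) a; have [r Hr] := taylor_ex (mdeg m) b.
rewrite -(coordE (taylorM Hq Hr)) // mcoeffM; apply: eq_bigr => -[[u Hu] [v Hv]] /= _.
by rewrite (coordE Hq) ?(coordE Hr) //; apply: ltnW.
Qed.

Lemma taylor_mpow N n a : mpow eps n a -> exists2 q, taylor N a q & trunc n q.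
Proof.
elim: n a => [|n IH] a; first by have [q Hq] := taylor_ex N a; exists q.
move=> [s Hs ->]; elim: s Hs => [|[u v] s IHs] Hs.
  by exists 0; [rewrite big_nil; apply: taylor_0 | apply: ideal0; apply: trunc_ideal].
have [p ps|q Hq qn] := IHs; first by apply: Hs; rewrite inE ps orbT.
have [/= eu /IH[r Hr rn]] := Hs _ (mem_head _ _).
have [t Ht] := taylor_ex N u.
have t1 : trunc 1 t.
  move=> m; rewrite ltnS leqn0 mdeg_eq0 => /eqP ->.
  by rewrite (coordE Ht) ?mdeg0 // coord0.
exists (t * r + q); first by rewrite big_cons; apply: taylorD => //; apply: taylorM.
by apply: (idealD (@trunc_ideal k d n.+1)) => //; apply: (truncM (a := 1)).
Qed.

Lemma taylor_x N i : exists2 q, taylor N (x i) q & trunc 2 (q - 'X_i).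
Proof.
have [ex _ dx _ _] := xdl; have [q Hq] := taylor_ex N (x i); exists q => //.
suff <- : tangent_pol (x i) = 'X_i.
  exact: taylor_uniq (taylor_le (leq0n N) Hq) (taylor_tangent _).
rewrite /tangent_pol ex (bigD1 i) //= dx eqxx scale1r big1 ?addr0 ?add0r // => j /negbTE ji.
by rewrite dx ji scale0r.
Qed.

Local Notation ev := (mmap (in_alg A) x).

Lemma taylor_monomial N m :
  exists2 q, taylor N (ev 'X_[m]) q & trunc (mdeg m).+1 (q - 'X_[m]).
Proof.
elim/mnm_ind: m => [|i m [q Hq qm]].
  exists 1; first by rewrite mpolyX0 rmorph1; apply: taylor_1.
  by rewrite mpolyX0 subrr; exact: (ideal0 (@trunc_ideal k d _)).
have [r Hr r2] := taylor_x N i; exists (r * q).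
  by rewrite mpolyXD rmorphM /= mmapX mmap1U; apply: taylorM.
have -> : r * q - 'X_[U_(i) + m] = (r - 'X_i) * (q - 'X_[m]) + (r - 'X_i) * 'X_[m]
    + 'X_i * (q - 'X_[m]) by rewrite mpolyXD; ring.
rewrite mdegD mdeg1 add1n; have hI := @trunc_ideal k d (mdeg m).+2.
apply: (idealD hI); first apply: (idealD hI).
- by apply: trunc_mono (truncM r2 qm); rewrite addnS.
- by apply: (truncM (a := 2) (b := mdeg m)) => //; apply: truncX.
- by apply: (truncM (a := 1) (b := (mdeg m).+1)) => //; apply: truncX; rewrite mdeg1.
Qed.

Lemma monomial_mpow m : mpow eps (mdeg m) (ev 'X_[m]).
Proof.
have [ex _ _ _ _] := xdl.
elim/mnm_ind: m => [|i m IH]; first by rewrite mdeg0.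
by rewrite mdegD mdeg1 add1n mpolyXD rmorphM /= mmapX mmap1U; apply: mpowMl.
Qed.

(** The parameters generate the adic filtration: a product [u * v] of two functions vanishing at the
    point is known to order [n.+2] once both factors are approximated to order [n.+1]. *)
Lemma polynomial_approx n a : exists q, mpow eps n (a - ev q).
Proof.
have [ex _ _ _ Hx] := xdl.
elim: n a => [|n IH] a; first by exists 0.
case: n IH => [|n] IH.
  by exists (eps a : k)%:MP; rewrite mmapC; apply/mpow1P; apply: eps_sub.
have hn := mpow_ideal eps n.+2.
have appD u v : (exists q, mpow eps n.+2 (u - ev q)) -> (exists q, mpow eps n.+2 (v - ev q)) ->
    exists q, mpow eps n.+2 (u + v - ev q).
  move=> [q Hq] [r Hr]; exists (q + r); rewrite rmorphD /= opprD addrACA.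
  exact: (idealD hn).
suff [s Hs Ea] : mpow eps 2 (a - (eps a : k)%:A - \sum_i dl i a *: x i).
  suff : exists q, mpow eps n.+2 (\sum_(p <- s) p.1 * p.2 - ev q).
    move=> [q Hq]; exists ((eps a : k)%:MP + \sum_i dl i a *: 'X_i + q).
    rewrite !rmorphD /= mmapC rmorph_sum /=.
    under eq_bigr do rewrite mmapZ mmapX mmap1U /= -scalerAl mul1r.
    by move: Hq; rewrite -Ea; congr (mpow eps _ _); ring.
  elim: s Hs {Ea} => [|[u v] s IHs] Hs.
    by exists 0; rewrite big_nil rmorph0 subrr; exact: (ideal0 hn).
  rewrite big_cons; apply: appD; last first.
    by apply: IHs => p ps; apply: Hs; rewrite inE ps orbT.
  have [/= eu /mpow1P ev0] := Hs _ (mem_head _ _).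
  have [[q Hq] [r Hr]] := (IH u, IH v); exists (q * r); rewrite rmorphM.
  have -> : u * v - ev q * ev r = u * (v - ev r) + (u - ev q) * ev r by ring.
  apply: (idealD hn); first exact: mpowMl.
  rewrite mulrC; apply: mpowMl => //.
  have : eps (v - ev r) = 0 by apply/mpow1P; apply: mpow_mono Hr.
  by rewrite rmorphB /= ev0 sub0r => /eqP; rewrite oppr_eq0 => /eqP.
exact: Hx.
Qed.

(* The leading form of a polynomial in the parameters [x] is the leading form of
   its Taylor expansion. *)
Lemma coord_kernel a : (forall m, coord m a = 0) -> forall n, mpow eps n a.
Proof.
(* The order [n.+2] is the precision of [taylor n]; the powers decrease, so the claim for [n]
   follows. *)
move=> a0 n; apply: (@mpow_mono _ _ eps n n.+2) => //; first by rewrite -addn2 leq_addr.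
have [q Hq] := polynomial_approx n.+2 a.
have [t Ht tn] := taylor_mpow n Hq.
have [b Hb] := taylor_ex n a.
have b0 : trunc n.+2 b by move=> m mn; rewrite (coordE Hb mn) a0.
suff qt j : (j <= n.+2)%N -> trunc j q.
  rewrite -[a](subrK (ev q)); apply: (idealD (mpow_ideal eps n.+2)) => //.
  rewrite [q]mpolyE rmorph_sum; apply: (ideal_sum (mpow_ideal eps n.+2)) => m mq _.
  rewrite /= mmapZ /= -scalerAl mul1r; apply: (idealZ _ (mpow_ideal eps n.+2)).
  apply: mpow_mono (monomial_mpow m); rewrite leqNgt; apply: contraTN mq => mn.
  by rewrite -mcoeff_eq0; apply/eqP; apply: (qt n.+2).
elim: j => [|j IH] jn; first exact: trunc0.
have qj := IH (ltnW jn) => m; rewrite ltnS leq_eqVlt => /orP[/eqP mj|]; last exact: qj.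
have [r Hr rm] : exists2 r, taylor n (ev q) r & trunc j.+1 (r - q).
  have {}qj u : u \in msupp q -> (j <= mdeg u)%N.
    by rewrite leqNgt; apply: contraTN => uj; rewrite -mcoeff_eq0 qj.
  rewrite [q]mpolyE; elim: (msupp q : seq _) qj => [|u s IHs] us.
    exists 0; rewrite big_nil ?rmorph0; first exact: taylor_0.
    by rewrite subrr; apply: ideal0; apply: trunc_ideal.
  have [v vs|r Hr rj] := IHs; first by apply: us; rewrite inE vs orbT.
  have [p Hp pu] := taylor_monomial n u.
  exists (q@_u *: p + r); rewrite big_cons.
    by rewrite rmorphD /= mmapZ /= -scalerAl mul1r; apply: taylorD => //; apply: taylorZ.
  rewrite opprD addrACA -scalerBr; apply: (idealD (@trunc_ideal k d j.+1)) => //.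
  apply: (idealZ _ (@trunc_ideal k d j.+1)); apply: trunc_mono pu.
  by rewrite ltnS; apply: us; rewrite mem_head.
have Htr : taylor n a (t + r) by have := taylorD Ht Hr; rewrite subrK.
have mn : (mdeg m < n.+2)%N by rewrite mj.
have E1 := taylor_uniq Htr Hb mn; have E2 := rm m; move: E1 E2.
rewrite !mcoeffB mcoeffD tn // b0 // add0r subr0 => ->; rewrite sub0r mj => H.
by apply/eqP; rewrite -oppr_eq0; apply/eqP; apply: H.
Qed.

End FormalCoordinates.

(** As for power series over a domain: at the sum of the smallest exponents, in the monomial order,
    where [a] and [b] leave [P], exactly one term of the convolution is outside [P]. *)
Lemma conv_prime (R : comNzRingType) (d : nat) (P : set R) (a b : 'X_{1..d} -> R) :
  is_prime_ideal P -> (forall m, P (conv a b m)) ->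
  (forall m, P (a m)) \/ (forall m, P (b m)).
Proof.
move=> hP Hab; have hPi := prime_ideal hP.
have min (c : 'X_{1..d} -> R) : ~ (forall m, P (c m)) ->
    exists m, ~ P (c m) /\ forall m', (m' < m)%O -> P (c m').
  move=> /existsNP[m]; elim/(ltmwf (n := d)): m => m IH Pm.
  have [H|/existsNP[m' /not_implyP[m'm Pm']]] := pselect (forall m', (m' < m)%O -> P (c m')).
    by exists m.
  exact: IH m'm Pm'.
apply: contrapT => /not_orP[/min[u [Pu Hu]] /min[v [Pv Hv]]].
have [_ _ PM] := hP; suff /PM[] : P (a u * b v) by [].
have Hu' : (mdeg u < (mdeg (u + v)).+1)%N by rewrite mdegD ltnS leq_addr.
have Hv' : (mdeg v < (mdeg (u + v)).+1)%N by rewrite mdegD ltnS leq_addl.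
pose p0 : 'X_{1..d < _, _} := (BMultinom Hu', BMultinom Hv').
have := Hab (u + v)%MM; rewrite /conv (bigD1 p0) //= => H.
apply: (idealDr hPi H); apply: ideal_sum => // -[[u' Hu1] [v' Hv1]] _ /andP[/= /eqP E].
move=> ne; have [lt|gt|Eu] := ltgtP u' u.
- by apply: idealMr => //; apply: Hu.
- apply: idealMl => //; apply: Hv; rewrite ltNge; apply/negP => le.
  by have := ltmc_le_add gt le; rewrite -E ltxx.
- case/negP: ne; apply/eqP; congr (_, _); apply: val_inj => //=.
  by move: E; rewrite Eu => /addmI.
Qed.

(** * Formal functions at a point and Krull's intersection theorem *)

Section FormalFunctions.
Variables (k : fieldType) (A : comAlgType k).

(** The [l m] are the coefficients of an algebra map from [A] to power series over [k] whose
    constant term is [eps]. *)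
Definition formal_coordinates (eps : {lrmorphism A -> k^o}) d (l : 'X_{1..d} -> A -> k) :=
  [/\ forall m, linear_form (l m), forall a, l 0%MM a = eps a &
      forall m a b, l m (a * b) = conv (l^~ a) (l^~ b) m].

Lemma formal_coordinates_ex (eps : {lrmorphism A -> k^o}) : smooth A ->
  exists d (l : 'X_{1..d} -> A -> k), formal_coordinates eps l /\
    forall a, (forall m, l m a = 0) -> forall n, mpow eps n a.
Proof.
move=> smA; have [d [x [dl xdl]]] := cotangent_basis_ex eps smA.1.
exists d, (coord smA xdl); split; last exact: coord_kernel.
by split=> [m|a|m a b]; [apply: coord_form | apply: coord0 | apply: coordM].
Qed.

Variables (eps : {lrmorphism A -> k^o}) (d : nat) (l : 'X_{1..d} -> A -> k).
Hypothesis hl : formal_coordinates eps l.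

(** The slices are the coefficients of the induced map from the tensor product to [R[[X]]], which is
    multiplicative. *)
Lemma slice_conv (R : comAlgType k) (z w : tensor R A) m :
  slice (l m) (z * w) = conv (fun m => slice (l m) z) (fun m => slice (l m) w) m.
Proof.
have [lP _ lM] := hl.
have E (y : tensor R A) m' : slice (l m') y = \sum_(p <- repr y) l m' p.2 *: p.1.
  by rewrite [in LHS](tensor_sum y) slice_sum //; apply: eq_bigr => p _; rewrite slice_tens.
rewrite [z in LHS]tensor_sum [w in LHS]tensor_sum /conv.
under [RHS]eq_bigr do rewrite !E big_distrlr /=.
rewrite big_distrlr /= slice_sum // exchange_big /=; apply: eq_bigr => p _.
rewrite slice_sum // exchange_big /=; apply: eq_bigr => q _.
rewrite tens_mul slice_tens // lM scaler_suml; apply: eq_bigr => r _.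
by rewrite -scalerAl -scalerAr scalerA.
Qed.

Lemma slice_prime (R : comAlgType k) (P : set R) (z w : tensor R A) : is_prime_ideal P ->
  (forall m, P (slice (l m) (z * w))) ->
  (forall m, P (slice (l m) z)) \/ (forall m, P (slice (l m) w)).
Proof.
by move=> hP H; apply: conv_prime => // m; rewrite -slice_conv.
Qed.

(** The functions vanishing on a formal neighbourhood of the point [eps]. *)
Definition formal_kernel : set A := [set a | forall m, l m a = 0].

Lemma formal_kernel_prime : is_prime_ideal formal_kernel.
Proof.
have [lP l0 lM] := hl; split; first split.
- by move=> m; apply: form0.
- by move=> x y Hx Hy m; rewrite formD // Hx Hy addr0.
- by move=> r x Hx m; rewrite lM /conv big1 // => p _; rewrite Hx mulr0.
- by move=> /(_ 0%MM); rewrite l0 eps1; apply/eqP/oner_neq0.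
move=> x y Hxy; have dk : is_domain k.
  by move=> u v /eqP; rewrite mulf_eq0 => /orP[] /eqP; [left|right].
by apply: (conv_prime (domain_prime dk)) => m; rewrite -lM.
Qed.

End FormalFunctions.

Section KrullIntersection.
Variables (k : fieldType) (A : comAlgType k) (eps : {lrmorphism A -> k^o}).
Hypothesis nA : noetherian A.

Lemma colons_mpow (U : set A) n y u :
  colons U [set a | eps a = 0] n y -> mpow eps n u -> is_ideal U -> U (u * y).
Proof.
move=> + + hU; elim: n y u => [|n IH] y u /=; first by move=> Uy _; apply: idealMl.
move=> Hy [s Hs ->]; rewrite mulr_suml; apply: ideal_sum => // p /Hs[e1 m2] _.
by rewrite mulrAC mulrC; apply: IH m2; apply: Hy.
Qed.

(** With [m] the augmentation ideal: if [x] is not in [m x], an ideal [J] maximal among those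
    containing [m x] but not [x] contains a power of [m], hence [x], which is absurd. So [x = a * x]
    with [a] in [m], and [b] is [1 - a]. *)
Lemma krull_intersection x : (forall n, mpow eps n x) -> exists2 b, eps b = 1 & b * x = 0.
Proof.
move=> Hx; apply: contrapT => nb.
pose mx : set A := [set y | exists2 a, eps a = 0 & y = a * x].
have hmx : is_ideal mx.
  split=> [|_ _ [a ea ->] [b eb ->]|r _ [a ea ->]].
  - by exists 0; rewrite ?rmorph0 ?mul0r.
  - by exists (a + b); rewrite ?rmorphD /= ?ea ?eb ?addr0 ?mulrDl.
  - by exists (r * a); rewrite ?rmorphM /= ?ea ?mulr0 ?mulrA.
have nmx : ~ mx x.
  move=> [a ea xa]; apply: nb; exists (1 - a); first by rewrite rmorphB /= eps1 ea subr0.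
  by rewrite mulrBl mul1r -xa subrr.
have [||J [hJ mJ nJ] Jmax] := nA (Q := fun I => [/\ is_ideal I, mx `<=` I & ~ I x]).
- by move=> I [].
- by exists mx; split.
(* If no power of [a] lies in [J], maximality writes [x] as [j + t * a ^+ n] with [n] beyond the
   point where the ideals [C n] are stationary; as [a * x] is in [J], so are [t * a ^+ n] and
   [x]. *)
have Jnil a : eps a = 0 -> exists n, J (a ^+ n).
  move=> ea; apply: contrapT => /forallNP Jn.
  pose C n := colon J (a ^+ n).
  have [n|n t|n Hn] := noetherian_acc (f := C) nA; first exact: colon_ideal.
    by rewrite /C /colon /= exprS mulrCA; apply: idealMl.
  apply: (Jn n); apply: (Jmax (adjoin J (a ^+ n))) (adjoin_mem _ hJ); last exact: adjoin_sub.
  split; [exact: adjoin_ideal | by move=> y /mJ; apply: adjoin_sub |].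
  move=> [j [t [Jj Ex]]]; apply: nJ; rewrite Ex; apply: idealD => //.
  apply: (Hn n.+1 (leqnSn n)); rewrite /C /colon /= exprS.
  have -> : t * (a * a ^+ n) = a * x - a * j by rewrite Ex; ring.
  by apply: idealB => //; [apply: mJ; exists a | apply: idealMl].
have [n y hC a /= ea|N HN] := colons_exhaust (U := J) (M := [set a | eps a = 0]) nA hJ.
  have [n' Jn'] := Jnil a ea; apply: (primeX (n := n')) hC _.
  apply: idealMr; first exact: colons_ideal.
  by elim: n => //= n IH; apply: colons_sub.
by apply: nJ; rewrite -[x]mulr1; apply: colons_mpow HN (Hx N) hJ.
Qed.

(** The values of [eps] being 1 is stable under products, so a largest annihilator [Ann b] already
    contains all of [p]. *)
Lemma uniform_annihilator (p : set A) : (forall x, p x -> exists2 b, eps b = 1 & b * x = 0) ->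
  exists2 b, eps b = 1 & forall x, p x -> b * x = 0.
Proof.
move=> Hp; pose Ann b : set A := [set x | b * x = 0].
have [||_ [b eb ->] bmax] := nA (Q := [set I | exists2 b, eps b = 1 & I = Ann b]).
- move=> _ [b _ ->]; split=> [|x y|r x]; rewrite /Ann /= ?mulr0 //.
    by rewrite mulrDr => -> ->; rewrite addr0.
  by rewrite mulrCA => ->; rewrite mulr0.
- by exists (Ann 1); exists 1; rewrite ?eps1.
exists b => // x px; have [c ec cx] := Hp x px.
apply: (bmax (Ann (b * c))).
- by exists (b * c) => //; rewrite rmorphM /= eb ec; apply: mulr1.
- by move=> y; rewrite /Ann /= mulrAC => ->; rewrite mul0r.
- by rewrite /Ann /= -mulrA cx mulr0.
Qed.

End KrullIntersection.

(** * Hopf algebra identities and the injectivity of formal coordinates *)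

Section Associativity.
Variable k : fieldType.
Implicit Types A B C D : comAlgType k.

Definition tassoc_r A B C : tensor A (tensor B C) -> tensor (tensor A B) C :=
  tpair (@tinl k (tensor A B) C \o @tinl k A B)
        (tpair (@tinl k (tensor A B) C \o @tinr k A B) (@tinr k (tensor A B) C)).
HB.instance Definition _ A B C := GRing.LRMorphism.on (@tassoc_r A B C).
HB.instance Definition _ A B C := GRing.LRMorphism.on (@tassoc_l k A B C).

Lemma tassoc_rE A B C (a : A) (b : B) (c : C) : tassoc_r (a ⊗ (b ⊗ c)) = (a ⊗ b) ⊗ c.
Proof. by rewrite /tassoc_r tpair_tens /= tpair_tens /= /tinl /tinr !tens_mul !mulr1 !mul1r. Qed.

Lemma tassoc_lE A B C (a : A) (b : B) (c : C) : tassoc_l ((a ⊗ b) ⊗ c) = a ⊗ (b ⊗ c).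
Proof. by rewrite /tassoc_l tpair_tens /= tpair_tens /= /tinl /tinr !tens_mul !mulr1 !mul1r. Qed.

Lemma tassocE A B C (z : tensor A (tensor B C)) : tassoc z = tassoc_r z.
Proof.
have H a (w : tensor B C) : tassoc (a ⊗ w) = tassoc_r (a ⊗ w).
  rewrite [LHS]tlift_tens; last exact: tassoc_balanced.
  rewrite {1}[w]tensor_sum tlift_sum; last exact: tassoc_balanced2.
  rewrite [w in RHS]tensor_sum tens_sumr rmorph_sum; apply: eq_bigr => p _.
  by rewrite /= tassoc_rE tlift_tens //; exact: tassoc_balanced2.
rewrite {1}[z]tensor_sum /tassoc tlift_sum; last exact: tassoc_balanced.
by rewrite [z in RHS]tensor_sum raddf_sum; apply: eq_bigr => p _; apply: H.
Qed.

End Associativity.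

Section HopfAlgebra.
Variables (k : fieldType) (G : affineGroup k).
Local Notation A := (coordRing G).
Local Notation eps := (counit G).

Lemma counit_form : linear_form (eps : A -> k).
Proof. by move=> c x y; rewrite linearP. Qed.

Lemma slice_counit_comul x : slice eps (comul G x) = x.
Proof. exact: counitr. Qed.

Lemma antipode_pairl x : tpair (antipode G) idfun (comul G x) = (eps x : k)%:A.
Proof. exact: antipodel. Qed.

Lemma antipode_pairr x : tpair idfun (antipode G) (comul G x) = (eps x : k)%:A.
Proof. exact: antipoder. Qed.

(* [r ⊗ a ⊗ b |-> r ⊗ f a * g b]. *)
Definition contract (R : comAlgType k) (f g : {lrmorphism A -> A}) :
    tensor (tensor R A) A -> tensor R A :=
  tpair (tpair (@tinl k R A) (@tinr k R A \o f)) (@tinr k R A \o g).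
HB.instance Definition _ R f g := GRing.LRMorphism.on (@contract R f g).

(** The antipode identity applied to the last two factors: comultiplying [a] and recombining by [f]
    and [g] leaves only [eps a]. *)
Lemma contractE R f g (z : tensor R A) :
  (forall x, tpair f g (comul G x) = (eps x : k)%:A) ->
  contract f g (tassoc (tmap id (comul G) z)) = slice eps z ⊗ 1.
Proof.
move=> H; rewrite tassocE.
have -> : tmap id (comul G) z = tmap (idfun : {lrmorphism R -> R}) (comul G) z by [].
rewrite tmapE; elim/tensor_ind: z => [|z w Hz Hw|r a].
- by rewrite slice0 ?tens0l ?rmorph0 //; exact: counit_form.
- by rewrite sliceD ?tensDl ?rmorphD; [rewrite -Hz -Hw -!rmorphD | exact: counit_form].
rewrite tpair_tens slice_tens; last exact: counit_form.
have -> : (@tinl k R (tensor A A) \o idfun) r * (@tinr k R (tensor A A) \o comul G) a = r ⊗ comul G a.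
  by rewrite /tinl /tinr /= tens_mul mulr1 mul1r.
have -> : contract f g (tassoc_r (r ⊗ comul G a)) = r ⊗ tpair f g (comul G a).
  elim/tensor_ind: (comul G a) => [|z w Hz Hw|b c].
  - by rewrite tens0r !rmorph0 tens0r.
  - have -> : contract f g (tassoc_r (r ⊗ (z + w))) =
        contract f g (tassoc_r (r ⊗ z)) + contract f g (tassoc_r (r ⊗ w)).
      by rewrite tensDr !rmorphD.
    have -> : tpair f g (z + w) = tpair f g z + tpair f g w by rewrite rmorphD.
    by rewrite Hz Hw tensDr.
  by rewrite tassoc_rE /contract tpair_tens /= !tpair_tens /= /tinl /tinr !tens_mul !mul1r !mulr1.

by rewrite H tensZ scale_tens.
Qed.

Section Smooth.
Hypotheses (smG : smooth A) (cG : Spec_connected A).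
Variables (d : nat) (l : 'X_{1..d} -> A -> k).
Hypothesis hl : formal_coordinates eps l.
Hypothesis hk : forall a, (forall m, l m a = 0) -> forall n, mpow eps n a.
Local Notation p := (formal_kernel l).

Lemma formal_kernel_eps x : p x -> eps x = 0.
Proof. by have [_ <- _] := hl => /(_ 0%MM). Qed.

(** The zero set of [p] is closed under products. Indeed [b * x = 0], and [p] is prime, so the
    slices of [comul G b] or those of [comul G x] lie in [p]; the former include [b] itself, by the
    counit axiom, and [eps b = 1]. Then [tensor_separation] applies. *)
Lemma comul_formal_kernel b x : eps b = 1 -> (forall y, p y -> b * y = 0) -> p x ->
  exists s t : seq (A * A), [/\ {in s, forall q, p q.1}, {in t, forall q, p q.2} &
    comul G x = \sum_(q <- s) q.1 ⊗ q.2 + \sum_(q <- t) q.1 ⊗ q.2].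
Proof.
have [lP l0 lM] := hl; have hp := formal_kernel_prime hl.
move=> eb bp px.
have [|H|H] := slice_prime hl (z := comul G b) (w := comul G x) hp.
- by rewrite -rmorphM bp // rmorph0 => m; rewrite slice0 //; exact: (ideal0 (prime_ideal hp)).
- have := H 0%MM; have -> : l 0%MM = eps by apply/funext.
  by rewrite slice_counit_comul => /formal_kernel_eps; rewrite eb => /eqP; rewrite oner_eq0.
have [_ [m ->]|_ [m ->]|s [t [sp tp E]]] := @tensor_separation k A A p
    [set f | exists m, f = l m] (comul G x) (ideal_subspace (prime_ideal hp)).
- by [].
- exact: H.
by exists s, t; split=> // q qt m; apply: (tp q qt); exists m.
Qed.

(* Functions on the subscheme [V(p)] translated by its generic point: [b x g^-1]
   kills [p], because [V(p)] is stable under products. *)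
Lemma formal_kernel_split b : eps b = 1 -> (forall y, p y -> b * y = 0) ->
  exists e1 e2, [/\ forall y, p y -> e1 * y = 0, p e2 & 1 = e1 + e2].
Proof.
have [lP l0 lM] := hl; have hp := formal_kernel_prime hl; have hpi := prime_ideal hp.
move=> eb bp.
(* On pairs [(x, g)], [f h] is the function [h (x g^-1)] and [T] is the pullback along
   [(x, g) |-> (x g^-1, g)]. Hence [TD], which says that [x g^-1 g = x]. *)
pose f : {lrmorphism A -> tensor A A} := tpair (@tinl k A A) (@tinr k A A \o antipode G) \o comul G.
pose T : {lrmorphism tensor A A -> tensor A A} := tpair f (@tinr k A A).
have TE h a : T (h ⊗ a) = f h * (1 ⊗ a) by rewrite /= tpair_tens.
have TD x : T (comul G x) = x ⊗ 1.
  rewrite -[x in RHS](slice_counit_comul x) -(contractE (f := antipode G) (g := idfun));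
    last exact: antipode_pairl.
  rewrite comulA; have -> : tmap (comul G) id (comul G x) =
    tmap (comul G) (idfun : {lrmorphism A -> A}) (comul G x) by [].
  rewrite tmapE; elim/tensor_ind: (comul G x) => [|z w Hz Hw|h a].
  - by rewrite !rmorph0.
  - have -> : T (z + w) = T z + T w by exact: rmorphD.
    by rewrite Hz Hw -!rmorphD.
  rewrite TE tpair_tens /contract /tinr /tinl rmorphM /= !tpair_tens /= rmorph1 mulr1.
  by rewrite rmorph1 mul1r.
pose N : set A := [set e | forall y, p y -> e * y = 0].
have hN : is_ideal N.
  split=> [y _|y z Ny Nz u pu|r y Ny u pu]; rewrite ?mul0r //.
    by rewrite mulrDl Ny // Nz // addr0.
  by rewrite -mulrA Ny // mulr0.
pose L : set (A -> k) := [set f | linear_form f /\ forall w, p w -> f w = 0].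
(* [(x ⊗ 1) * f b] is the image by [T] of [comul G x] times [b ⊗ 1]. Of the two parts of
   [comul G x], one is killed by [b] and the other by slicing with a form that vanishes on [p]. *)
have key g : L g -> N (slice g (f b)).
  move=> [gP g0] x px; rewrite mulrC -slice_mull //.
  have -> : (x ⊗ 1) * f b = T (comul G x * (b ⊗ 1)).
    have -> : T (comul G x * (b ⊗ 1)) = T (comul G x) * T (b ⊗ 1) by exact: rmorphM.
    by rewrite TD TE mulr1.
  have [s [t [sp tp ->]]] := comul_formal_kernel eb bp px.
  rewrite mulrDl mulr_suml big1_seq ?add0r => [|q /andP[_ qs]]; last first.
    by rewrite tens_mul mulrC bp ?tens0l //; apply: sp.
  rewrite mulr_suml raddf_sum slice_sum // big1_seq // => q /andP[_ qt].
  rewrite -[_ (_ * _)]/(T _) tens_mul mulr1 TE; elim/tensor_ind: (f _) => [|z w Hz Hw|r a].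
  - by rewrite mul0r slice0.
  - by rewrite mulrDl sliceD // Hz Hw addr0.
  rewrite tens_mul slice_tens // g0 ?scale0r //.
  by apply: (idealMl _ hpi); apply: tp.
have [|s [t [sN tp E]]] := tensor_separation (ideal_subspace hN) _ key; first by move=> ? [].
(* On the diagonal [x = g] the function [b (x g^-1)] is the constant [eps b], which is 1; the two
   parts of [f b] restrict to [e1] and [e2]. *)
have E1 : 1 = tpair idfun (idfun : {lrmorphism A -> A}) (f b).
  have -> : 1 = tpair idfun (antipode G) (comul G b) by rewrite antipode_pairr eb scale1r.
  apply: (tensor_ext (f := tpair idfun (antipode G))
    (g := tpair idfun idfun \o tpair (@tinl k A A) (@tinr k A A \o antipode G))).
  move=> h a /=; rewrite !tpair_tens /= /tinl /tinr tens_mul tpair_tens /=.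
  by rewrite mulr1 mul1r.
exists (\sum_(q <- s) q.1 * q.2), (\sum_(q <- t) q.1 * q.2); split.
- by apply: (ideal_sum hN) => q qs _; apply: (idealMr _ hN); apply: sN.
- apply: (ideal_sum hpi) => q qt _; apply: (idealMl _ hpi).
  apply: contrapT => /(separating_form (ideal_subspace hpi))[g [gP g0 g1]].
  by have := tp q qt g (conj gP g0); rewrite g1 => /eqP; rewrite oner_eq0.
rewrite E1 E rmorphD !rmorph_sum.
by congr (_ + _); apply: eq_bigr => q _; rewrite /= tpair_tens.
Qed.

(** From [e1 * e2 = 0] and [e1 + e2 = 1], the closed sets of [e1] and [e2] are disjoint and cover
    the spectrum. The identity lies on the second, so by connectedness the first is empty and [e1],
    which kills [p], is a unit. *)
Lemma formal_kernel0 x : p x -> x = 0.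
Proof.
have nA := finite_type_noetherian smG.1.
have hpi := prime_ideal (formal_kernel_prime hl).
have [|b eb bp] := uniform_annihilator nA (p := p) (eps := eps).
  by move=> y py; apply: krull_intersection => // n; apply: hk.
have [e1 [e2 [Ne1 pe2 E]]] := formal_kernel_split eb bp.
have [_ /(_ (principal e1) (principal e2))] := cG.
have hker : is_prime_ideal [set a : A | eps a = 0].
  split; first split => [|y z|r y] /=; rewrite ?rmorph0 ?rmorphD ?rmorphM //=.
  - by move=> -> ->; rewrite addr0.
  - by move=> ->; rewrite mulr0.
  - by rewrite eps1; apply/eqP/oner_neq0.
  move=> y z /=; rewrite rmorphM /= => /eqP; rewrite mulf_eq0.
  by move=> /orP[] /eqP; [left|right].
case.
- exact: principal_ideal.
- exact: principal_ideal.
- apply/seteqP; split=> [P [] []//|P hP].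
  have [_ _ /(_ e1 e2)] := hP; rewrite Ne1 // => /(_ (ideal0 (prime_ideal hP)))[Pe|Pe].
    by left; split=> //; apply: principal_sub => //; apply: prime_ideal.
  by right; split=> //; apply: principal_sub => //; apply: prime_ideal.
- apply/seteqP; split=> // P [[hP P1] [_ P2]]; have [hPi nP _] := hP.
  by apply: nP; rewrite E; apply: idealD => //; [apply: P1 | apply: P2]; apply: principal_refl.
- move=> H px; have [[r Er]|/prime_of_nonunit[P hP Pe]] := pselect (is_unit e1).
    by rewrite -[x]mul1r -Er mulrAC Ne1 // mul0r.
  exfalso; have : [set P | @Spec A P /\ principal e1 `<=` P] P.
    by split=> //; apply: principal_sub => //; apply: prime_ideal.
  by rewrite -/(Vset _) H.
- move=> H; exfalso; suff : Vset (principal e2) [set a : A | eps a = 0] by rewrite H.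
  by split=> //; apply: principal_sub (prime_ideal hker) _; apply: formal_kernel_eps.
Qed.

End Smooth.

(* Coordinates at the identity detect all functions and are multiplicative, so
   [k[G]] behaves like a subring of a power series ring over [k]. *)
Theorem smooth_connected_coordinates : smooth A -> Spec_connected A ->
  exists d (l : 'X_{1..d} -> A -> k), formal_coordinates eps l /\
    forall a, (forall m, l m a = 0) -> a = 0.
Proof.
move=> smG cG; have [d [l [hl hk]]] := formal_coordinates_ex eps smG.
by exists d, l; split=> // a; apply: formal_kernel0.
Qed.

End HopfAlgebra.

(** * Stable principal ideals *)

Section Span.
Variables (k : fieldType) (V : lmodType k).
Implicit Types (w s : seq V) (x y : V).

Definition span w : set V :=
  [set x | forall W : set V, is_subspace W -> {in w, forall y, W y} -> W x].

Lemma span_subspace w : is_subspace (span w).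
Proof.
split=> [W [W0 _]//|c x y xw yw W hW wW].
by case: (hW) => _; apply; [apply: xw | apply: yw].
Qed.

Lemma span_mem w x : x \in w -> span w x.
Proof. by move=> xw W _; apply. Qed.

Lemma span_sub w s x : {in w, forall y, span s y} -> span w x -> span s x.
Proof. by move=> ws; apply=> //; apply: span_subspace. Qed.

Lemma spanP w x : span w x <-> exists c : nat -> k, x = \sum_(i < size w) c i *: w`_i.
Proof.
split=> [|[c ->]]; last first.
  apply: (subspace_sum (span_subspace w)) => i _.
  by apply: (subspaceZ (span_subspace w)); apply: span_mem; apply: mem_nth (ltn_ord i).
move=> /(_ [set x | exists c : nat -> k, x = \sum_(i < size w) c i *: w`_i]).
apply=> [|y yw]; first split.
- by exists (fun=> 0); rewrite big1 // => i _; rewrite scale0r.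
- move=> c y z [d ->] [e ->]; exists (fun i => c * d i + e i).
  rewrite scaler_sumr -big_split; apply: eq_bigr => i _ /=.
  by rewrite scalerDl scalerA.
have yi : (index y w < size w)%N by rewrite index_mem.
exists (fun i => (i == index y w)%:R); rewrite (bigD1 (Ordinal yi)) //= eqxx scale1r.
rewrite nth_index // big1 ?addr0 // => j; rewrite -val_eqE /= => /negbTE ->.
by rewrite scale0r.
Qed.

Lemma span_cons w x y : span (x :: w) y <-> exists c, span w (y - c *: x).
Proof.
have hw := span_subspace w; have hxw := span_subspace (x :: w).
have sub z : span w z -> span (x :: w) z.
  by apply: span_sub => v vw; apply: span_mem; rewrite inE vw orbT.
split=> [|[c /sub Hc]]; last first.
  rewrite -[y](subrK (c *: x)); apply: (subspaceD hxw) => //.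
  by apply: (subspaceZ hxw); apply: span_mem; rewrite mem_head.
move=> /(_ [set y | exists c, span w (y - c *: x)]); apply=> [|z]; first split.
- by exists 0; rewrite scale0r subr0; case: hw.
- move=> c u v [d Hd] [e He]; exists (c * d + e).
  have -> : c *: u + v - (c * d + e) *: x = c *: (u - d *: x) + (v - e *: x).
    by rewrite scalerBr scalerDl scalerA opprD addrACA.
  by case: hw => _; apply.
rewrite inE => /orP[/eqP ->|zw]; first by exists 1; rewrite scale1r subrr; case: hw.
by exists 0; rewrite scale0r subr0; apply: span_mem.
Qed.

(** The spanning vectors must come from [T] itself, which need not be a subspace: a pivot [t0] in
    [T] with nonzero coordinate along [v] clears that coordinate from the others. *)
Lemma finite_subspan (T : set V) w : (forall x, T x -> span w x) ->
  exists2 s : seq V, {in s, forall x, T x} & forall x, T x -> span s x.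
Proof.
elim: w T => [|v w IH] T Tw; first by exists [::].
have [Tw'|/existsNP[t0 /not_implyP[Tt0 nt0]]] := pselect (forall x, T x -> span w x).
  exact: IH.
have hw := span_subspace w.
have [c0 Hc0] := (span_cons w v t0).1 (Tw _ Tt0).
have c00 : c0 != 0.
  by apply: contra_notN nt0 => /eqP c00; move: Hc0; rewrite c00 scale0r subr0.
have step t : T t -> exists c, span w (t - c *: t0).
  move=> /Tw /span_cons[c Hc]; exists (c / c0).
  have -> : t - (c / c0) *: t0 = (t - c *: v) - (c / c0) *: (t0 - c0 *: v).
    by rewrite scalerBr scalerA divfK // opprB addrA subrK.
  by apply: (subspaceB hw) => //; apply: (subspaceZ hw).
have [|s sT Ts] := IH [set y | span w y /\ exists c t, T t /\ y = t - c *: t0].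
  by move=> y [].
have [s' [s'T s's]] : exists s', {in s', forall x, T x} /\ {in s, forall y, span (t0 :: s') y}.
  elim: s sT {Ts} => [|y s IHs] sT; first by exists [::].
  have [z zs|s' [s'T s's]] := IHs; first by apply: sT; rewrite inE zs orbT.
  have [_ [c [t [Tt Ey]]]] := sT y (mem_head _ _).
  exists (t :: s'); split=> [z|z]; rewrite inE => /orP[/eqP ->//|zs]; first exact: s'T.
    have hs' := span_subspace [:: t0, t & s'].
    rewrite Ey; apply: (subspaceB hs'); first by apply: span_mem; rewrite !inE eqxx orbT.
    apply: (subspaceZ hs').
    by apply: span_mem; rewrite mem_head.
  apply: span_sub (s's z zs) => u; rewrite inE => /orP[/eqP ->|us'].
    by apply: span_mem; rewrite mem_head.
  by apply: span_mem; rewrite !inE us' !orbT.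
exists (t0 :: s') => [x|t Tt]; first by rewrite inE => /orP[/eqP ->//|/s'T].
have [c Hc] := step t Tt; have hs := span_subspace (t0 :: s').
rewrite -[t](subrK (c *: t0)); apply: (subspaceD hs).
  by apply: (span_sub s's); apply: Ts; split=> //; exists c, t.
by apply: (subspaceZ hs); apply: span_mem; rewrite mem_head.
Qed.

End Span.

Lemma spanM (k : fieldType) (A : comAlgType k) (w s : seq A) x y :
  span w x -> span s y -> span [seq a * b | a <- w, b <- s] (x * y).
Proof.
have hs := span_subspace [seq a * b | a <- w, b <- s].
move=> xw ys; apply: (xw (fun x => span _ (x * y))) => [|a aw].
  split=> [|c u v Hu Hv]; first by rewrite mul0r; case: hs.
  by rewrite mulrDl -scalerAl; case: hs => _; apply.
apply: (ys (fun y => span _ (a * y))) => [|b bs].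
  split=> [|c u v Hu Hv]; first by rewrite mulr0; case: hs.
  by rewrite mulrDr -scalerAr; case: hs => _; apply.
by apply: span_mem; apply/allpairsP; exists (a, b).
Qed.

Section AlgebraicElements.
Variables (k : fieldType) (S : idomAlgType k).
Local Notation iota := (@FracField.tofrac S \o in_alg S : {rmorphism k -> {fraction S}}).

Lemma idom_domain : is_domain S.
Proof. by move=> x y /eqP; rewrite mulf_eq0 => /orP[] /eqP; [left|right]. Qed.

Definition algebraic : set S := [set s | integralOver iota (FracField.tofrac s)].

Lemma algebraicP s : algebraic s <->
  exists2 p, p \is monic & (map_poly (in_alg S) p).[s] = 0.
Proof.
have E p : (map_poly iota p).[FracField.tofrac s] = FracField.tofrac (map_poly (in_alg S) p).[s].
  by rewrite -horner_map -map_poly_comp.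
split=> -[p mp]; [rewrite /root E => /eqP H | move=> H]; exists p => //.
  by apply/eqP; move/eqP: H; rewrite tofrac_eq0.
by rewrite /root E H rmorph0.
Qed.

Lemma algebraic_subspace : is_subspace algebraic.
Proof.
split=> [|c x y Hx Hy]; first by rewrite /algebraic /= rmorph0; apply: integral0.
have Hc : integralOver iota (FracField.tofrac (c%:A : S)) := integral_id iota c.
rewrite /algebraic /= rmorphD -mulr_algl rmorphM.
exact: (@integral_add _ _ iota _ _ (@integral_mul _ _ iota _ _ Hc Hx) Hy).
Qed.

Lemma algebraicM x y : algebraic x -> algebraic y -> algebraic (x * y).
Proof.
by move=> Hx Hy; rewrite /algebraic /= rmorphM; exact: (@integral_mul _ _ iota _ _ Hx Hy).
Qed.

(** Cayley-Hamilton: [y] multiplies a finite dimensional space containing 1 into itself, so it is an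
    eigenvalue of a matrix over [k], with eigenvector [w]. *)
Lemma algebraic_of_span (w : seq S) y : span w 1 ->
  {in w, forall x, span w (y * x)} -> algebraic y.
Proof.
move=> w1 yw; pose n := size w.
have H (i : 'I_n) : exists c : nat -> k, y * w`_i = \sum_(j < n) c j *: w`_j.
  by have := yw w`_i (mem_nth 0 (ltn_ord i)); move=> /spanP[c Ec]; exists c.
have [c Hc] := choice H; pose M : 'M[k]_n := \matrix_(i, j) c i j.
exists (char_poly M^T); first exact: char_poly_monic.
rewrite (map_char_poly iota) -eigenvalue_root_char; apply/eigenvalueP.
exists (\row_j FracField.tofrac w`_j).
  apply/rowP => i; rewrite !mxE -rmorphM Hc rmorph_sum; apply: eq_bigr => j _.
  by rewrite !mxE -rmorphM /= mulr_algr.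
apply/eqP => /rowP w0; have : span w 1 -> (1 : S) = 0; last by move=> /(_ w1)/eqP; rewrite oner_eq0.
move=> /spanP[e ->]; rewrite big1 // => i _.
have := w0 i; rewrite !mxE => /eqP; rewrite tofrac_eq0 => /eqP ->.
by rewrite scaler0.
Qed.

End AlgebraicElements.

Section SubRingTheory.
Variables (R : comNzRingType) (B : subringClosed R).
Implicit Types x y : subring B.

Lemma sr_val_inj x y : sr_val x = sr_val y -> x = y. Proof. exact: val_inj. Qed.
Lemma sr_valD x y : sr_val (x + y) = sr_val x + sr_val y. Proof. by []. Qed.
Lemma sr_valM x y : sr_val (x * y) = sr_val x * sr_val y. Proof. by []. Qed.
Lemma sr_val0 : sr_val (0 : subring B) = 0. Proof. by []. Qed.
Lemma sr_val_in x : sr_val x \in B. Proof. by case: x. Qed.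

Lemma sr_val_sum (I : Type) (r : seq I) (P : pred I) (F : I -> subring B) :
  sr_val (\sum_(i <- r | P i) F i) = \sum_(i <- r | P i) sr_val (F i).
Proof. exact: (big_morph (@sr_val _ _) sr_valD sr_val0). Qed.

Lemma sr_valX x n : sr_val (x ^+ n) = sr_val x ^+ n.
Proof. by elim: n => // n IH; rewrite !exprS sr_valM IH. Qed.

End SubRingTheory.

(** * Rees algebras and invertible series *)

Section Rees.
Variables (k : fieldType) (S : idomAlgType k) (t : seq S).
Local Notation r := (size t).
Local Notation ev := (mmap (in_alg S) (fun i : 'I_r => t`_i)).

Definition degree_le n : set S := [set x | exists2 q : {mpoly k[r]}, (msize q <= n.+1)%N & x = ev q].

Lemma degree_leM n m x y : degree_le n x -> degree_le m y -> degree_le (n + m) (x * y).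
Proof.
move=> [q qn ->] [p pm ->]; exists (q * p); last by rewrite rmorphM.
have [->|q0] := eqVneq q 0; first by rewrite mul0r msize0.
have [->|p0] := eqVneq p 0; first by rewrite mulr0 msize0.
by rewrite msizeM // -subn1 leq_subLR add1n -addnS -addSn leq_add.
Qed.

Lemma degree_leB n x y : degree_le n x -> degree_le n y -> degree_le n (x - y).
Proof.
move=> [q qn ->] [p pm ->]; exists (q - p); last by rewrite rmorphB.
by rewrite (leq_trans (msizeD_le _ _)) // msizeN geq_max qn.
Qed.

Lemma degree_le_scalar n c : degree_le n c%:A.
Proof.
by exists c%:MP; rewrite ?mmapC // mmeasureC; case: (c != 0).
Qed.

Lemma degree_le1 x : span t x -> degree_le 1 x.
Proof.
move=> /spanP[c ->]; exists (\sum_(i < r) c i *: 'X_i); last first.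
  rewrite rmorph_sum; apply: eq_bigr => i _ /=.
  by rewrite mmapZ mmapX mmap1U /= -scalerAl mul1r.
apply: (leq_trans (msize_sum _ _ _)); apply/bigmax_leqP => i _.
by rewrite (leq_trans (msizeZ_le _ _)) // msizeX mdeg1.
Qed.

Definition rees_pred : {pred {poly S}} := fun q => `[< forall n, degree_le n q`_n >].

Fact rees_closed : subring_closed rees_pred.
Proof.
split=> [|x y /asboolP Hx /asboolP Hy|x y /asboolP Hx /asboolP Hy]; apply/asboolP => n.
- rewrite coef1; case: n => [|n] /=; first by have := degree_le_scalar 0 1; rewrite scale1r.
  by have := degree_le_scalar n.+1 0; rewrite scale0r.
- by rewrite coefB; apply: degree_leB.
rewrite coefM; apply: (big_ind (degree_le n)) => [|u v Hu Hv|i _].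
- by have := degree_le_scalar n 0; rewrite scale0r.
- rewrite -[v]opprK; apply: degree_leB => //; rewrite -[- v]add0r; apply: degree_leB => //.
  by have := degree_le_scalar n 0; rewrite scale0r.
by have := degree_leM (Hx i) (Hy (n - i)%N); rewrite subnKC // -ltnS.
Qed.
HB.instance Definition _ := GRing.isSubringClosed.Build {poly S} rees_pred rees_closed.
Definition rees : comNzRingType := subring (rees_pred : subringClosed {poly S}).

Lemma degree0_mono c : degree_le 1 c -> c%:P * 'X \in rees_pred.
Proof.
move=> Hc; apply/asboolP => n; rewrite coefMX coefC.
case: n => [|[|n]] //=; try by have := degree_le_scalar 0 0; rewrite scale0r.
by have := degree_le_scalar n.+2 0; rewrite scale0r.
Qed.
(** A monomial in which the exponent of [i] exceeds [n i] is rewritten in smaller total degree, so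
    the monomials with exponents at most [N] span the algebra generated by [t]. *)
Lemma finite_of_degree_drop : (forall i : 'I_r, exists n, degree_le n (t`_i ^+ n.+1)) ->
  exists2 w : seq S, {in w, forall x, exists q, x = ev q} & forall q, span w (ev q).
Proof.
move=> /choice[n Hn]; pose N := (\max_i n i)%N.
pose mon (f : {ffun 'I_r -> 'I_N.+1}) : 'X_{1..r} := [multinom (f i : nat) | i < r].
pose w := [seq ev 'X_[mon f] | f : {ffun 'I_r -> 'I_N.+1}].
have hw := span_subspace w.
exists w; first by move=> _ /mapP[f _ ->]; eexists.
suff H d (m : 'X_{1..r}) : (mdeg m < d)%N -> span w (ev 'X_[m]).
  move=> q; rewrite [q]mpolyE rmorph_sum; apply: (subspace_sum hw) => m _ /=.
  by rewrite mmapZ /= -scalerAl mul1r; apply: (subspaceZ hw); apply: (H (mdeg m).+1).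
elim: d m => // d IH m; rewrite ltnS => md.
have [Hm|/existsNP[i /negP]] := pselect (forall i, (m i <= n i)%N).
  apply: span_mem; apply/mapP; exists [ffun i => inord (m i)]; first by rewrite mem_enum.
  congr (ev 'X_[_]); apply/mnmP => i; rewrite mnmE ffunE inordK // ltnS.
  by apply: leq_trans (Hm i) _; apply: leq_bigmax.
rewrite -ltnNge => Hi; have [p pn Ep] := Hn i.
have le : (U_(i) *+ (n i).+1 <= m)%MM.
  apply/mnm_lepP => j; rewrite mulmnE mnm1E; case: eqP => [<-|_]; last by rewrite mul0n.
  by rewrite mul1n.
pose m' := (m - U_(i) *+ (n i).+1)%MM.
have Em : m = (U_(i) *+ (n i).+1 + m')%MM by rewrite addmC submK.
have -> : ev 'X_[m] = ev (p * 'X_[m']).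
  by rewrite Em mpolyXD !rmorphM /= -Ep -mpolyXn rmorphXn /= mmapX mmap1U.
have : (msize p <= (n i).+1)%N by [].
rewrite [p in p * _]mpolyE mulr_suml rmorph_sum => pn'.
apply: (subspace_sum hw) => u up /=.
rewrite -scalerAl -mpolyXD mmapZ /= -scalerAl mul1r; apply: (subspaceZ hw); apply: IH.
apply: leq_trans md; rewrite Em !mdegD mdegMn mdeg1 mul1n ltn_add2r.
exact: leq_trans (msize_mdeg_lt up) pn'.
Qed.

End Rees.

(* In the Rees algebra [⊕ M_n z^n] of the filtration of [k[U_i V_j]] by degree,
   a prime containing [z] contains every [U_i V_j z], because the product of the
   series [z V_j U] and [z U_i V] is divisible by [z]; so the [U_i V_j z] are
   nilpotent modulo [z], which makes [k[U_i V_j]] finite dimensional. *)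
Theorem unit_series_algebraic (k : fieldType) (S : idomAlgType k) (d : nat)
    (U V : 'X_{1..d} -> S) (w w' : seq S) :
  U 0%MM = 1 -> V 0%MM = 1 -> (forall m, exists c : k, conv U V m = c%:A) ->
  (forall m, span w (U m)) -> (forall m, span w' (V m)) ->
  forall m, algebraic (U m).
Proof.
move=> U0 V0 UV Uw Vw.
pose T : set S := [set x | exists a b, x = U a * V b].
have [_ [a [b ->]]|t tT Tt] := @finite_subspan _ S T [seq x * y | x <- w, y <- w'].
  exact: spanM.
have Tdeg a b : degree_le t 1 (U a * V b) by apply: degree_le1; apply: Tt; exists a, b.
have one_deg : degree_le t 1 1 by have := Tdeg 0%MM 0%MM; rewrite U0 V0 mulr1.
pose E := rees t.
pose z : E := SubRing (degree0_mono one_deg).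
pose x a b : E := SubRing (degree0_mono (Tdeg a b)).
have zE : sr_val z = 'X by rewrite /= mul1r.
have nil a b : exists n, degree_le t n ((U a * V b) ^+ n.+1).
  have [P hP zP|n [e He]] := @radicalP E (principal z) (x a b) (principal_ideal z).
    have Pz : P z by apply: zP; apply: principal_refl.
    (* The two series have product coefficients [conv U V m] times [U a * V b] times the square of
       [z]. As [conv U V m] is a scalar, one factor [z] can be split off inside the Rees algebra. *)
    have [|H|H] := @conv_prime E d P (fun m => x m b) (fun m => x a m) hP; last 2 first.
    - exact: H.
    - exact: H.
    move=> m; suff [e ->] : exists e, conv (fun m => x m b) (fun m => x a m) m = e * z.
      by apply: idealMl => //; apply: prime_ideal.
    have [c Hc] := UV m.
    have Hcx : degree_le t 1 (c *: (U a * V b)).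
      by apply: degree_le1; apply: (subspaceZ (span_subspace t)); apply: Tt; exists a, b.
    exists (SubRing (degree0_mono Hcx)); apply: sr_val_inj.
    rewrite sr_valM zE /conv sr_val_sum /=.
    transitivity (\sum_(p : 'X_{1..d < (mdeg m).+1, (mdeg m).+1} | m == (p.1 + p.2)%MM)
      (U p.1 * V p.2 * (U a * V b))%:P * 'X * 'X).
      by apply: eq_bigr => p _; rewrite !polyCM; ring.
    rewrite -!mulr_suml -rmorph_sum -mulr_suml /=.
    have -> : \sum_(p : 'X_{1..d < (mdeg m).+1, (mdeg m).+1} | m == (p.1 + p.2)%MM)
      U p.1 * V p.2 = conv U V m by [].
    by rewrite Hc mulr_algl.
  have {}He : (U a * V b)%:P ^+ n * 'X^n = sr_val e * 'X.
    by move/(congr1 (@sr_val _ _)): He; rewrite sr_valX sr_valM zE /= exprMn.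
  (* Exponent zero would make 1 a multiple of [z]. Otherwise, comparing coefficients at ['X^n.+1],
     the factor ['X] on the right lowers the filtration degree by one. *)
  case: n He => [|n] He.
    have := congr1 (fun p : {poly S} => p`_0) He.
    by rewrite mulr1 coefMX coef1 /= => /eqP; rewrite oner_eq0.
  exists n; have := congr1 (fun p : {poly S} => p`_n.+1) He.
  rewrite -rmorphXn coefCM coefXn eqxx mulr1 coefMX /= => ->.
  by case: e {He} => q /= /asboolP; apply.
have [i|W WE HW] := @finite_of_degree_drop _ _ t.
  by have [a [b ->]] := tT _ (mem_nth 0 (ltn_ord i)); apply: nil.
move=> m; apply: (@algebraic_of_span _ _ W); first by have := HW 1; rewrite rmorph1.
move=> _ /WE[q ->]; have [p _ Ep] := Tdeg m 0%MM.
rewrite -[U m]mulr1 -V0 Ep -rmorphM; exact: HW.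
Qed.

Section AlgebraicZero.
Variables (k : fieldType) (B R : comAlgType k) (eta : {lrmorphism B -> R}).

(** The constant term of an equation for [y] vanishes, as [eta] shows; in a domain a factor [y] can
    then be cancelled until the equation is exhausted. *)
Lemma algebraic_zero (p : {poly k}) (y : B) : is_domain B ->
  p != 0 -> (map_poly (in_alg B) p).[y] = 0 -> eta y = 0 -> y = 0.
Proof.
move=> dom + + ey; elim/poly_ind: p => [|p c IH]; first by rewrite eqxx.
rewrite rmorphD rmorphM /= map_polyX map_polyC /= hornerMXaddC => pc0 E.
have c0 : c = 0.
  have : c *: (1 : R) = 0.
    by rewrite -(rmorph1 eta) -linearZ /= -[_ *: _](addKr ((map_poly (in_alg B) p).[y] * y))
      E addr0 rmorphN rmorphM /= ey mulr0 oppr0.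
  by move/eqP; rewrite scaler_eq0 oner_eq0 orbF => /eqP.
move: E pc0; rewrite c0 scale0r !addr0 => /dom[E|//]; rewrite mulf_eq0 negb_or.
by case/andP => p0 _; apply: IH.
Qed.

End AlgebraicZero.

(** * Stable primes and the cocycle of a stable principal ideal *)

Section Coordinates.
Variables (k : fieldType) (G : affineGroup k).
Local Notation A := (coordRing G).
Local Notation eps := (counit G).
Variables (d : nat) (l : 'X_{1..d} -> A -> k).
Hypothesis hl : formal_coordinates eps l.
Hypothesis hl0 : forall a, (forall m, l m a = 0) -> a = 0.

Section Slices.
Variable R : comAlgType k.
Implicit Types (P V I : set R) (z w : tensor R A).

Lemma coord_slice_in V z : is_subspace V -> (forall m, V (slice (l m) z)) ->
  exists2 s : seq (R * A), {in s, forall p, V p.1} & z = \sum_(p <- s) p.1 ⊗ p.2.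
Proof.
have [lP _ _] := hl; move=> hV Vz.
have [_ [m ->]|_ [m ->]|s [t [sV tL ->]]] :=
  @tensor_separation k R A V [set f | exists m, f = l m] z hV.
- exact: lP.
- exact: Vz.
exists s => //; rewrite [X in _ + X]big1_seq ?addr0 // => p /andP[_ pt].
by rewrite (hl0 (a := p.2)) ?tens0r // => m; apply: (tL p pt); exists m.
Qed.

Lemma coord_slice_all V z : is_subspace V -> (forall m, V (slice (l m) z)) ->
  forall f, linear_form f -> V (slice f z).
Proof.
move=> hV /(coord_slice_in hV)[s sV ->] f fP; rewrite slice_sum //.
by apply: (subspace_sum hV) => p /sV Vp; rewrite slice_tens //; apply: (subspaceZ hV).
Qed.

(** Slices describe the extension of [P] to the tensor product, by [tensor_idealP]. It is the
    preimage of the series with coefficients in [P], a prime by [conv_prime]; [coord_slice_all]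
    passes from coordinates to all forms. *)
Lemma tensor_prime P z w : is_prime_ideal P ->
  (forall f, linear_form f -> P (slice f (z * w))) ->
  (forall f, linear_form f -> P (slice f z)) \/ (forall f, linear_form f -> P (slice f w)).
Proof.
have [lP _ _] := hl; move=> hP H; have hV := ideal_subspace (prime_ideal hP).
have [m||] := slice_prime hl (z := z) (w := w) hP; first exact: H.
  by move=> Hz; left; apply: coord_slice_all.
by move=> Hw; right; apply: coord_slice_all.
Qed.

Lemma tensor_domain : is_domain R -> is_domain (tensor R A).
Proof.
move=> dom z w zw.
have Z y : (forall f, linear_form f -> [set (0 : R)] (slice f y)) -> y = 0.
  by move=> H; apply: slice_inj => f fP; rewrite slice0 //; apply: H.
have [f fP|/Z|/Z] := tensor_prime (z := z) (w := w) (domain_prime dom).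
- by rewrite zw slice0.
- by left.
- by right.
Qed.

Lemma tensor_idealP I z : is_ideal I ->
  tensor_ideal I z <-> forall f, linear_form f -> I (slice f z).
Proof.
move=> hI; have hV := ideal_subspace hI; split=> [[r Ir ->] f fP|H].
  rewrite slice_sum //; apply: (subspace_sum hV) => p /Ir Ip.
  by rewrite slice_tens //; apply: (subspaceZ hV).
by have [s sI ->] := tensor_slice_in hV H; exists s.
Qed.

Definition counit_scalar (a : A) : R := (eps a : k)%:A.
Fact counit_scalar_zmod : zmod_morphism counit_scalar.
Proof. by move=> x y; rewrite /counit_scalar rmorphB /= scalerBl. Qed.
Fact counit_scalar_monoid : monoid_morphism counit_scalar.
Proof.
split=> [|x y]; first by rewrite /counit_scalar eps1 scale1r.
by rewrite /counit_scalar rmorphM /= -scalerAl mul1r scalerA.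
Qed.
Fact counit_scalar_scal : scalable counit_scalar.
Proof. by move=> c x; rewrite /counit_scalar linearZ scalerA. Qed.
HB.instance Definition _ := GRing.isZmodMorphism.Build A R counit_scalar counit_scalar_zmod.
HB.instance Definition _ := GRing.isMonoidMorphism.Build A R counit_scalar counit_scalar_monoid.
HB.instance Definition _ := GRing.isScalable.Build k A R *:%R counit_scalar counit_scalar_scal.

Definition counit_map : tensor R A -> R := tpair idfun counit_scalar.
HB.instance Definition _ := GRing.LRMorphism.on counit_map.

Lemma slice_counit z : slice eps z = counit_map z.
Proof.
have eP := @counit_form k G; elim/tensor_ind: z => [|z w Hz Hw|r a].
- by rewrite slice0 // rmorph0.
- by rewrite sliceD // Hz Hw rmorphD.
- by rewrite slice_tens // /counit_map tpair_tens /= mulr_algr.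
Qed.

End Slices.

Variables (S : idomAlgType k) (omega : coaction G S).
Local Notation dS := (@idom_domain k S).

Lemma slice_counit_coact s : slice eps (omega s) = s.
Proof. exact: coact1. Qed.

Lemma stable_idealP (I : set S) : stable_ideal omega I <->
  is_ideal I /\ forall s f, I s -> linear_form f -> I (slice f (omega s)).
Proof.
split=> -[hI H]; split=> //.
  by move=> s f Is; have /(tensor_idealP _ hI) := H s Is; apply.
by move=> s Is; apply/tensor_idealP => // f fP; apply: H.
Qed.

(* The largest stable ideal inside a prime [P] is prime since [P ⊗ k[G]] is. *)
Lemma minimal_prime_stable (I P : set S) : stable_ideal omega I ->
  minimal_prime_over I P -> stable_ideal omega P.
Proof.
move=> /stable_idealP[hI sI] [hP IP Pmin]; have hPi := prime_ideal hP.
pose Q : set S := [set s | forall f, linear_form f -> P (slice f (omega s))].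
have QP : Q `<=` P by move=> s /(_ _ (@counit_form k G)); rewrite slice_counit_coact.
suff hQ : is_prime_ideal Q.
  have EQ : Q = P by apply: Pmin => // s Is f fP; apply: IP; apply: sI.
  by apply/stable_idealP; split=> // s f; rewrite -{1}EQ; apply.
split; first split.
- by move=> f fP; rewrite rmorph0 slice0 //; exact: (ideal0 hPi).
- by move=> s t Qs Qt f fP; rewrite rmorphD sliceD //; apply: (idealD hPi); [apply: Qs | apply: Qt].
- move=> r s Qs; have /(tensor_idealP _ hPi)[q qP Eq] := Qs.
  apply/(tensor_idealP _ hPi); exists [seq (p.1 * v.1, p.2 * v.2) | p <- repr (omega r), v <- q].
    by move=> _ /allpairsP[[p v] /= [_ /qP Pv ->]]; apply: idealMl.
  rewrite rmorphM /= Eq {1}[omega r]tensor_sum big_allpairs_dep mulr_suml.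
  apply: eq_bigr => p _; rewrite mulr_sumr; apply: eq_bigr => v _.
  by rewrite tens_mul.
- by move=> /QP; case: hP.
move=> x y Qxy; have := tensor_prime (z := omega x) (w := omega y) hP.
by apply=> f fP; rewrite -rmorphM; apply: Qxy.
Qed.

(** The difference [omega c - c ⊗ 1] is integral over [k] in a domain and is killed by the counit,
    hence zero by [algebraic_zero]. *)
Lemma algebraic_invariant c : algebraic c -> omega c = c ⊗ 1.
Proof.
move=> /algebraicP[p mp pc].
have int (f : {lrmorphism S -> tensor S A}) : integralOver (in_alg (tensor S A)) (f c).
  exists p => //; apply/eqP; have -> : map_poly (in_alg (tensor S A)) p =
      map_poly f (map_poly (in_alg S) p).
    rewrite -map_poly_comp; apply: eq_map_poly => x /=.
    by rewrite linearZ rmorph1.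
  by rewrite horner_map pc rmorph0.
have [q mq /eqP qy] := integral_sub (int omega) (int (@tinl k S A)).
apply/eqP; rewrite -subr_eq0; apply/eqP.
apply: (algebraic_zero (eta := @counit_map S)) (tensor_domain dS) (monic_neq0 mq) qy _.
by rewrite rmorphB /= -!slice_counit slice_counit_coact slice_tens ?eps1 ?scale1r ?subrr //;
  exact: counit_form.
Qed.

Section StablePrincipal.
Variable f : S.
Hypotheses (f0 : f <> 0) (fst : stable_ideal omega (principal f)).

Lemma coact_factor : exists u, omega f = (f ⊗ 1) * u.
Proof.
have [r rf ->] := fst.2 f (principal_refl f).
elim: r rf => [|p r IH] rf; first by exists 0; rewrite big_nil mulr0.
have [q qr|u Eu] := IH; first by apply: rf; rewrite inE qr orbT.
have [c Ec] := rf p (mem_head _ _).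
exists (c ⊗ p.2 + u); rewrite big_cons Eu mulrDr; congr (_ + _).
by rewrite tens_mul mul1r mulrC -Ec.
Qed.

Lemma f_lreg : forall x y, f * x = f * y -> x = y.
Proof. exact: domain_lreg dS f f0. Qed.

Variable u : tensor S A.
Hypothesis fu : omega f = (f ⊗ 1) * u.

Lemma cocycle_counit : slice eps u = 1.
Proof.
apply: f_lreg; rewrite -slice_mull; last exact: counit_form.
by rewrite -fu slice_counit_coact mulr1.
Qed.

(** Coassociativity of the coaction at [f], with the nonzerodivisor [f ⊗ 1 ⊗ 1] cancelled. *)
Lemma cocycle : tassoc (tmap id (comul G) u) = (u ⊗ 1) * tmap omega id u.
Proof.
have idE (B C D : comAlgType k) (g : {lrmorphism B -> C}) (z : tensor D B) : tmap id g z =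
    tmap (idfun : {lrmorphism D -> D}) g z by [].
have idE' (B C D : comAlgType k) (g : {lrmorphism B -> C}) (z : tensor B D) : tmap g id z =
    tmap g (idfun : {lrmorphism D -> D}) z by [].
pose L : {lrmorphism tensor S A -> tensor (tensor S A) A} :=
  @tassoc_r k S A A \o tpair (@tinl k S (tensor A A) \o idfun) (@tinr k S (tensor A A) \o comul G).
pose M : {lrmorphism tensor S A -> tensor (tensor S A) A} :=
  tpair (@tinl k (tensor S A) A \o omega) (@tinr k (tensor S A) A \o idfun).
have LE z : tassoc (tmap id (comul G) z) = L z by rewrite tassocE idE tmapE.
have ME z : tmap omega id z = M z by rewrite idE' tmapE.
have := coactA omega f; rewrite LE ME fu.
have -> : L ((f ⊗ 1) * u) = L (f ⊗ 1) * L u by exact: rmorphM.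
have -> : M ((f ⊗ 1) * u) = M (f ⊗ 1) * M u by exact: rmorphM.
have -> : L (f ⊗ 1) = (f ⊗ 1) ⊗ 1.
  by rewrite /L /= tpair_tens /= !rmorph1 /tinl mulr1 (tassoc_rE f 1 1).
have -> : M (f ⊗ 1) = ((f ⊗ 1) ⊗ 1) * (u ⊗ 1).
  by rewrite /M /= tpair_tens /= rmorph1 mulr1 fu /tinl tens_mul mulr1.
rewrite -mulrA LE ME; exact: (@tensorM_lreg k (tensor S A) A (f ⊗ 1) (@tensorM_lreg k S A f f_lreg)).
Qed.

(** Specializing the cocycle identity to a pair of mutually inverse group elements, which is what
    [contract] with the antipode does, leaves the value of [u] at the identity, namely 1. *)
Lemma cocycle_unit : exists v, u * v = 1.
Proof.
exists (contract idfun (antipode G) (tmap omega id u)).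
have -> : u * contract idfun (antipode G) (tmap omega id u) =
    contract idfun (antipode G) ((u ⊗ 1) * tmap omega id u).
  rewrite [RHS]rmorphM; congr (_ * _) => /=.
  rewrite /contract tpair_tens /= rmorph1 mulr1.
  elim/tensor_ind: u => [|z w Hz Hw|r a]; rewrite ?rmorph0 ?rmorphD /= -?Hz -?Hw //.
  by rewrite tpair_tens /= /tinl /tinr tens_mul mulr1 mul1r.
rewrite -cocycle contractE; last exact: antipode_pairr.
by rewrite cocycle_counit.
Qed.

Lemma slice_span (g : A -> k) z : linear_form g ->
  span [seq p.1 | p <- repr z] (slice g z : S).
Proof.
move=> gP; have hW := span_subspace [seq p.1 | p <- repr z].
rewrite [in slice _ _](tensor_sum z) slice_sum //; apply: (subspace_sum hW) => p pz.
by rewrite slice_tens //; apply: (subspaceZ hW); apply: span_mem; apply: map_f.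
Qed.

Lemma cocycle_algebraic : exists2 s : seq (S * A), {in s, forall p, algebraic p.1} &
  u = \sum_(p <- s) p.1 ⊗ p.2.
Proof.
have [lP l0 lM] := hl; have [v uv] := cocycle_unit.
have l0E : l 0%MM = eps by apply/funext.
apply: (coord_slice_in (@algebraic_subspace k S)) => m.
apply: (unit_series_algebraic (U := fun m => slice (l m) u) (V := fun m => slice (l m) v)
  (w := [seq p.1 | p <- repr u]) (w' := [seq p.1 | p <- repr v])).
- by rewrite l0E cocycle_counit.
- rewrite l0E; have := congr1 (slice eps) uv; rewrite !slice_counit rmorphM rmorph1.
  by rewrite /= -!slice_counit cocycle_counit mul1r.
- move=> m'; rewrite -(slice_conv hl) uv; exists (l m' 1).
  by rewrite -[1]/(1 ⊗ 1) slice_tens.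
- by move=> m'; apply: slice_span.
- by move=> m'; apply: slice_span.
Qed.

End StablePrincipal.

End Coordinates.

(** * From cocycles to characters over the constant field *)

Section CharacterDescent.
Variables (k : fieldType) (G : affineGroup k) (S : idomAlgType k) (omega : coaction G S).
Local Notation A := (coordRing G).
Local Notation eps := (counit G).
Local Notation K := (base_closure S).
Local Notation KG := (base_change K A).
Local Notation tb := (@to_base_change k K A).

(** The function is prescribed only on algebraic elements and is 0 elsewhere in the construction, so
    it is no morphism; [closure_ofM] and [closure_inj] supply what is needed of one. *)
Lemma closure_of_ex : exists closure_of : S -> K,
  forall c, algebraic c -> bc_val (closure_of c) = FracField.tofrac c.
Proof.
suff /choice[g Hg] : forall c : S, exists x : K, algebraic c -> bc_val x = FracField.tofrac c.
  by exists g.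
move=> c.
have [Hc|nc] := pselect (algebraic c); last by exists 0.
have Hb : FracField.tofrac c \in @integral_over_base k S by apply/asboolP.
by exists (BaseClosure Hb).
Qed.

Variable closure_of : S -> K.
Hypothesis closure_ofE : forall c, algebraic c -> bc_val (closure_of c) = FracField.tofrac c.

Lemma bc_val_inj (x y : K) : bc_val x = bc_val y -> x = y. Proof. exact: val_inj. Qed.

Lemma bc_valM (x y : K) : bc_val (x * y) = bc_val x * bc_val y. Proof. by []. Qed.

Lemma bc_valZ c (x : K) : bc_val (c *: x) = FracField.tofrac (c%:A : S) * bc_val x.
Proof. by []. Qed.

Lemma bc_val_sum (I : Type) (r : seq I) (F : I -> K) :
  bc_val (\sum_(i <- r) F i) = \sum_(i <- r) bc_val (F i).
Proof. exact: (big_morph (@bc_val _ _) (fun _ _ => erefl) erefl). Qed.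

Lemma closure_ofM c e : algebraic c -> algebraic e ->
  closure_of c * closure_of e = closure_of (c * e).
Proof.
move=> Hc He; apply: bc_val_inj.
rewrite bc_valM (closure_ofE Hc) (closure_ofE He) (closure_ofE (algebraicM Hc He)).
exact: (esym (tofracM c e)).
Qed.

Lemma slice_closure (B : comAlgType k) (g : B -> k) (s : seq (S * B)) : linear_form g ->
  {in s, forall p, algebraic p.1} ->
  bc_val (slice g (\sum_(p <- s) closure_of p.1 ⊗ p.2)) =
  FracField.tofrac (slice g (\sum_(p <- s) p.1 ⊗ p.2)).
Proof.
move=> gP Hs; rewrite !slice_sum // bc_val_sum rmorph_sum big_seq [RHS]big_seq.
apply: eq_bigr => p /Hs Hp; rewrite (slice_tens gP) (slice_tens gP) bc_valZ (closure_ofE Hp).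
by rewrite -tofracM mulr_algl.
Qed.

(** Slices decide equality of tensors, and after slicing both sides are compared inside the fraction
    field, which contains [S] and [K]. *)
Lemma closure_inj (B : comAlgType k) (s t : seq (S * B)) :
  {in s, forall p, algebraic p.1} -> {in t, forall p, algebraic p.1} ->
  \sum_(p <- s) p.1 ⊗ p.2 = \sum_(p <- t) p.1 ⊗ p.2 ->
  \sum_(p <- s) closure_of p.1 ⊗ p.2 = \sum_(p <- t) closure_of p.1 ⊗ p.2.
Proof.
move=> Hs Ht st; apply: slice_inj => g gP; apply: bc_val_inj.
by rewrite (slice_closure gP Hs) (slice_closure gP Ht) st.
Qed.

Definition pair_base_change (w : tensor A A) : tensor KG KG :=
  tlift (fun h1 h2 => tb h1 ⊗ tb h2) w.

Lemma pair_base_changeD v w :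
  pair_base_change (v + w) = pair_base_change v + pair_base_change w.
Proof. by rewrite /pair_base_change tliftD //; exact: comul_base_change_balanced2. Qed.

Lemma pair_base_change_tens a b : pair_base_change (a ⊗ b) = tb a ⊗ tb b.
Proof. by rewrite /pair_base_change tlift_tens //; exact: comul_base_change_balanced2. Qed.

Lemma pair_base_changeZ c w :
  pair_base_change (c *: w) = (c%:A : K) *: pair_base_change w.
Proof.
have D := pair_base_changeD.
have p0 : pair_base_change 0 = 0 by apply: (addIr (pair_base_change 0)); rewrite -D !add0r.
elim/tensor_ind: w => [|v w Hv Hw|a b]; first by rewrite scaler0 p0 scaler0.
  by rewrite scalerDr !D Hv Hw scalerDr.
by rewrite scale_tens !pair_base_change_tens to_base_changeZ -scale_tens.
Qed.

Lemma pair_lift_balanced : balanced (fun (c : K) w => c *: pair_base_change w).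
Proof.
split=> [c e w|c v w|a c w]; first exact: scalerDl.
  by rewrite pair_base_changeD scalerDr.
by rewrite pair_base_changeZ scalerA mulr_algr.
Qed.

(** The canonical map from [K] tensor two copies of [k[G]] to the tensor square over [K] of the base
    change. It carries the cocycle identity, transported to [K], to the group-like identity. *)
Definition pair_lift : tensor (K : comAlgType k) (tensor A A) -> tensor KG KG :=
  tlift (fun (c : K) w => c *: pair_base_change w).

Lemma pair_lift_sum (s : seq (S * tensor A A)) :
  pair_lift (\sum_(p <- s) closure_of p.1 ⊗ p.2) =
  \sum_(p <- s) closure_of p.1 *: pair_base_change p.2.
Proof.
rewrite /pair_lift tlift_sum; last exact: pair_lift_balanced.
by apply: eq_bigr => p _; rewrite tlift_tens //; exact: pair_lift_balanced.
Qed.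

Lemma base_changeE (c : K) (a : A) : c ⊗ a = c *: tb a :> KG.
Proof. by rewrite [RHS]tens_mul mulr1 mul1r. Qed.

Lemma tens_base_change (c e : K) (a b : A) :
  (c ⊗ a : KG) ⊗ (e ⊗ b : KG) = (c * e) *: (tb a ⊗ tb b).
Proof. by rewrite (base_changeE c a) (base_changeE e b) tensZ -scale_tens scalerA mulrC. Qed.

Lemma grouplike_descent (s : seq (S * A)) : {in s, forall p, algebraic p.1} ->
  slice eps (\sum_(p <- s) p.1 ⊗ p.2) = 1 ->
  \sum_(p <- s) p.1 ⊗ comul G p.2 =
    \sum_(p <- s) \sum_(q <- s) (p.1 * q.1) ⊗ (p.2 ⊗ q.2) ->
  character_base_change (\sum_(p <- s) closure_of p.1 ⊗ p.2 : KG).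
Proof.
move=> Hs e1 comul_s; split; last first.
  apply: bc_val_inj; rewrite /counit_base_change tlift_sum; last exact: counit_base_change_balanced.
  have <- : slice eps (\sum_(p <- s) closure_of p.1 ⊗ p.2) =
    \sum_(p <- s) tlift (fun (c : K) h => (eps h : k) *: c) (closure_of p.1 ⊗ p.2).
    by rewrite slice_sum //; exact: counit_form.
  by rewrite slice_closure ?e1 ?rmorph1 //; exact: counit_form.
pose s2 := [seq (p.1, comul G p.2) | p <- s].
pose s3 := [seq (p.1 * q.1, p.2 ⊗ q.2) | p <- s, q <- s].
have E : \sum_(p <- s2) closure_of p.1 ⊗ p.2 = \sum_(p <- s3) closure_of p.1 ⊗ p.2.
  apply: closure_inj; last by rewrite big_map big_allpairs_dep.
    by move=> _ /mapP[p /Hs Hp ->].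
  by move=> _ /allpairsP[[p q] /= [/Hs Hp /Hs Hq ->]]; exact: (algebraicM Hp Hq).
have := congr1 (@pair_lift) E; rewrite !pair_lift_sum big_map big_allpairs_dep /=.
rewrite /comul_base_change tlift_sum; last exact: comul_base_change_balanced.
under eq_bigr do rewrite -/(pair_base_change _).
move=> E2.
transitivity (\sum_(p <- s) closure_of p.1 *: pair_base_change (comul G p.2)).
  by apply: eq_bigr => p _; rewrite tlift_tens //; exact: comul_base_change_balanced.
rewrite E2 tens_suml; apply: eq_big_seq => p /Hs Hp.
rewrite tens_sumr; apply: eq_big_seq => q /Hs Hq.
rewrite pair_base_change_tens -(closure_ofM Hp Hq).
exact: (esym (tens_base_change _ _ _ _)).
Qed.

End CharacterDescent.

Lemma tassocK (k : fieldType) (A B C : comAlgType k) (z : tensor A (tensor B C)) :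
  tassoc_l (tassoc z) = z.
Proof.
rewrite tassocE; elim/tensor_ind: z => [|z w Hz Hw|a w].
- by rewrite !rmorph0.
- have -> : tassoc_l (tassoc_r (z + w)) = tassoc_l (tassoc_r z) + tassoc_l (tassoc_r w).
    by rewrite !rmorphD.
  by rewrite Hz Hw.
elim/tensor_ind: w => [|z w Hz Hw|b c]; first by rewrite tens0r !rmorph0.
  have -> : tassoc_l (tassoc_r (a ⊗ (z + w))) =
      tassoc_l (tassoc_r (a ⊗ z)) + tassoc_l (tassoc_r (a ⊗ w)).
    by rewrite tensDr !rmorphD.
  by rewrite Hz Hw tensDr.
by rewrite tassoc_rE tassoc_lE.
Qed.

(** Algebraic elements are invariant, so on a cocycle with algebraic coefficients the twist by
    [omega] disappears and the cocycle identity says that [u] is group-like. By [X_surjective] it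
    comes from a character over [k]. *)
Theorem stable_principal_homogeneous (k : fieldType) (G : affineGroup k)
  (G_smooth : smooth (coordRing G)) (G_connected : Spec_connected (coordRing G))
  (S : idomAlgType k) (omega : coaction G S)
  (X_surjective : forall u : base_change (base_closure S) (coordRing G),
     character_base_change u ->
     exists2 chi : coordRing G, character chi & to_base_change (base_closure S) chi = u)
  (f : S) : f <> 0 -> stable_ideal omega (principal f) -> homogeneous omega f.
Proof.
move=> f0 f_st; have [d [l [hl hl0]]] := smooth_connected_coordinates G_smooth G_connected.
have [u fu] := coact_factor f_st.
have [s Hs us] := cocycle_algebraic hl hl0 f0 fu.
have e1 := cocycle_counit f0 fu.
have [closure_of closure_ofE] := closure_of_ex S.
have /X_surjective[chi chiX chiE] :
    character_base_change (\sum_(p <- s) closure_of p.1 ⊗ p.2 : base_change (base_closure S) _).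
  apply: (grouplike_descent closure_ofE) => //; first by rewrite -us.
  have := congr1 (@tassoc_l _ _ _ _) (cocycle f0 fu); rewrite tassocK.
  have -> : tmap id (comul G) u = \sum_(p <- s) p.1 ⊗ comul G p.2.
    have -> : tmap id (comul G) u = tmap (idfun : {lrmorphism S -> S}) (comul G) u by [].
    rewrite tmapE us rmorph_sum; apply: eq_bigr => p _.
    by rewrite /= tpair_tens /= /tinl /tinr tens_mul mulr1 mul1r.
  move=> ->; have -> : tmap omega id u = \sum_(p <- s) (p.1 ⊗ 1) ⊗ p.2.
    have -> : tmap omega id u =
      tmap omega (idfun : {lrmorphism coordRing G -> coordRing G}) u by [].
    rewrite tmapE us rmorph_sum; apply: eq_big_seq => p /Hs Hp.
    by rewrite /= tpair_tens /= (algebraic_invariant hl hl0 omega Hp) /tinl /tinr tens_mul mulr1 mul1r.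
  rewrite us tens_suml mulr_suml rmorph_sum; apply: eq_bigr => p _ /=.
  rewrite mulr_sumr rmorph_sum; apply: eq_bigr => q _ /=.
  by rewrite !tens_mul mul1r mulr1 tassoc_lE.
exists chi => //; rewrite /semiinvariants /= fu; suff -> : u = 1 ⊗ chi by rewrite tens_mul mulr1 mul1r.
apply: slice_inj => g gP; apply/eqP; rewrite -tofrac_eq us -(slice_closure closure_ofE gP Hs).
rewrite -chiE /to_base_change !slice_tens //; apply/eqP.
by rewrite bc_valZ mulr1.
Qed.

(** * Factoriality of graded domains *)

Section Divisibility.
Variable A : comNzRingType.
Hypothesis dom : is_domain A.
Implicit Types x y z a b h t : A.

(** The ascending chain condition on principal ideals, as the existence of a maximal ideal in each
    nonempty family of them. *)
Definition accp : Prop := forall Q : set A, Q !=set0 ->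
  exists2 x, Q x & forall y, Q y -> divides y x -> divides x y.

Lemma divides_refl x : divides x x. Proof. by exists 1; rewrite mul1r. Qed.

Lemma divides_trans x y z : divides x y -> divides y z -> divides x z.
Proof. by move=> [r ->] [s ->]; exists (s * r); rewrite mulrA. Qed.

Lemma dividesMl x y z : divides x z -> divides x (y * z).
Proof. by move=> [r ->]; exists (y * r); rewrite mulrA. Qed.

Lemma dividesD x y z : divides x y -> divides x z -> divides x (y + z).
Proof. by move=> [r ->] [s ->]; exists (r + s); rewrite mulrDl. Qed.

Lemma divides_unit_l x e : is_unit e -> divides (x * e) x.
Proof. by move=> [u eu]; exists u; rewrite mulrCA [u * e]mulrC eu mulr1. Qed.

Lemma divides_mul_unit x y e : is_unit e -> divides x (y * e) -> divides x y.
Proof. by move=> eu xy; apply: divides_trans xy (divides_unit_l y eu). Qed.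

Lemma self_multiple_unit x e : e * x <> 0 -> divides (e * x) x -> is_unit e.
Proof.
move=> ex0 [r E]; exists r; apply: (domain_lreg dom (x := x)).
  by move=> x0; apply: ex0; rewrite x0 mulr0.
by rewrite mulr1 {2}E; ring.
Qed.

Lemma unitM x y : is_unit x -> is_unit y -> is_unit (x * y).
Proof. by move=> [u xu] [v yv]; exists (u * v); rewrite mulrACA xu yv mulr1. Qed.

Lemma unitMl x y : is_unit (x * y) -> is_unit x.
Proof. by move=> [u E]; exists (y * u); rewrite mulrA. Qed.

Lemma mul_neq0 x y : x <> 0 -> y <> 0 -> x * y <> 0.
Proof. by move=> x0 y0 /dom[]. Qed.

Lemma prime_associate x e : is_unit e -> prime_element x -> prime_element (e * x).
Proof.
move=> eu [x0 xu xp]; have [v ev] := eu; split.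
- by apply: mul_neq0 => // e0; move: ev; rewrite e0 mul0r => /esym/eqP; rewrite oner_eq0.
- by rewrite mulrC => /unitMl.
have H y : divides (e * x) y <-> divides x y.
  by split=> [[r ->]|[r ->]]; [exists (r * e); ring | exists (r * v); rewrite -[r in LHS]mulr1 -ev; ring].
by move=> y z; rewrite !H; apply: xp.
Qed.

Lemma prime_irreducible x : prime_element x -> irreducible_element x.
Proof.
move=> [x0 xu xp]; split=> // y z E; have [|[r Ey]|[r Ez]] := xp y z.
- by rewrite -E; apply: divides_refl.
- by right; exists r; apply: (domain_lreg dom x0); rewrite mulr1 [RHS]E Ey; ring.
- by left; exists r; apply: (domain_lreg dom x0); rewrite mulr1 [RHS]E Ez; ring.
Qed.

Hypothesis accpA : accp.

Lemma irreducible_divisor x : x <> 0 -> ~ is_unit x ->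
  exists2 h, irreducible_element h & divides h x.
Proof.
move=> x0 xu; have [|h [hx hu] hmin] := accpA (Q := [set y | divides y x /\ ~ is_unit y]).
  by exists x; split=> //; apply: divides_refl.
have h0 : h <> 0 by move=> h0; have [r] := hx; rewrite h0 mulr0.
exists h => //; split=> // y z E; apply: contrapT => /not_orP[yu zu].
apply: zu; apply: (@self_multiple_unit y); rewrite mulrC -E // .
apply: hmin; last by exists z; rewrite mulrC.
by split=> //; apply: divides_trans hx; exists z; rewrite mulrC.
Qed.

Lemma irreducible_factorization x : x <> 0 -> ~ is_unit x ->
  exists2 s : seq A, {in s, forall p, irreducible_element p} & x = \prod_(p <- s) p.
Proof.
pose fact y := exists2 s : seq A, {in s, forall p, irreducible_element p} & y = \prod_(p <- s) p.
move=> x0 xu; apply: contrapT => nx.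
have [|h [h0 hu nh] hmin] := accpA (Q := [set y | [/\ y <> 0, ~ is_unit y & ~ fact y]]).
  by exists x.
have : ~ irreducible_element h.
  by move=> hi; apply: nh; exists [:: h]; rewrite ?big_seq1 // => p; rewrite inE => /eqP ->.
move=> nhi; apply: nhi; split=> // y z E; apply: contrapT => /not_orP[yu zu].
have [y0 z0] : y <> 0 /\ z <> 0 by split=> H; apply: h0; rewrite E H ?mul0r ?mulr0.
have [[s Hs Es]|ny] := pselect (fact y); last first.
  apply: zu; apply: (@self_multiple_unit y); rewrite mulrC -E //.
  by apply: hmin => //; exists z; rewrite mulrC.
have [[t Ht Et]|nz] := pselect (fact z); last first.
  apply: yu; apply: (@self_multiple_unit z); rewrite -E //.
  by apply: hmin => //; exists y.
apply: nh; exists (s ++ t); last by rewrite big_cat /= -Es -Et.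
by move=> p; rewrite mem_cat => /orP[/Hs|/Ht].
Qed.

Hypothesis irr_prime : forall x, irreducible_element x -> prime_element x.

Lemma prime_divides_prod p (s : seq A) : prime_element p ->
  divides p (\prod_(q <- s) q) -> exists2 q, q \in s & divides p q.
Proof.
move=> [p0 pu pp]; elim: s => [|q s IH].
  by rewrite big_nil => -[r E]; exfalso; apply: pu; exists r; rewrite mulrC.
rewrite big_cons => /pp[pq|/IH[q' qs pq']]; first by exists q; rewrite ?mem_head.
by exists q'; rewrite // inE qs orbT.
Qed.

Lemma irreducible_divides (p q : A) : irreducible_element p -> irreducible_element q ->
  divides p q -> associate p q.
Proof.
move=> [p0 pu _] [q0 qu qi] [r E]; have [[v rv]|//] := qi _ _ E.
by exists v; [exists r; rewrite mulrC | rewrite E mulrA [v * r]mulrC rv mul1r].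
Qed.

(** The unit [e] collects the units that appear when a prime of [s] is cancelled against an
    associate in [t]. *)
Lemma factorization_unique (s t : seq A) e : is_unit e ->
  {in s, forall p, irreducible_element p} -> {in t, forall p, irreducible_element p} ->
  \prod_(p <- s) p = e * \prod_(p <- t) p ->
  size s = size t /\ exists2 t' : seq A, perm_eq t t' &
    forall i, (i < size s)%N -> associate s`_i t'`_i.
Proof.
elim: s t e => [|p s IH] t e eu Hs Ht.
  rewrite big_nil; case: t Ht => [|q t] Ht E; first by split=> //; exists [::].
  exfalso; have [_ qu _] := Ht q (mem_head _ _); apply: qu.
  by exists (e * \prod_(p <- t) p); rewrite [RHS]E big_cons mulrCA.
rewrite big_cons => E; have pi := Hs p (mem_head _ _); have pp := irr_prime pi.
have [q qt pq] : exists2 q, q \in t & divides p q.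
  apply: prime_divides_prod => //; have [v ev] := eu.
  exists (v * \prod_(j <- s) j).
  have -> : v * \prod_(j <- s) j * p = v * (p * \prod_(j <- s) j) by ring.
  by rewrite E mulrA [v * e]mulrC ev mul1r.
have [w wu Epq] := irreducible_divides pi (Ht q qt) pq.
have tq := perm_to_rem qt; have p0 : p <> 0 by case: pi.
have [||||st [t' tt' Ht']] := IH (rem q t) (e * (sval (cid wu))).
- have := svalP (cid wu); set w' := sval _ => ww'; apply: unitM => //.
  by exists w; rewrite mulrC.
- by move=> r rs; apply: Hs; rewrite inE rs orbT.
- by move=> r /mem_rem; apply: Ht.
- have := svalP (cid wu); set w' := sval _ => ww'; apply: (domain_lreg dom p0).
  rewrite E (perm_big _ tq) /= big_cons Epq.
  have -> : w * q * (e * w' * \prod_(j <- rem q t) j) =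
    (w * w') * (e * (q * \prod_(j <- rem q t) j)) by ring.
  by rewrite ww' mul1r.
have tpos : (0 < size t)%N by case: (t) qt.
split; first by rewrite /= st size_rem // prednK.
exists (q :: t'); first by apply: perm_trans tq _; rewrite perm_cons.
by case=> [|i] //= i_s; [exists w | apply: Ht'].
Qed.

Lemma irreducible_prime_UFD : is_UFD A.
Proof.
split=> //; first exact: irreducible_factorization.
move=> s t Hs Ht E; apply: (factorization_unique (e := 1)) => //; first by exists 1; rewrite mulr1.
by rewrite mul1r.
Qed.

End Divisibility.

(** * Orders and rank one extensions in abelian groups *)

Section TorsionFree.
Variable Gam : zmodType.
Implicit Types (Sg P W : set Gam) (x y g : Gam).

Definition is_subgroup Sg : Prop := Sg 0 /\ forall x y, Sg x -> Sg y -> Sg (x - y).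

(** The quotient by [Sg] is torsion free. *)
Definition is_saturated Sg : Prop := forall x n, Sg (x *+ n.+1) -> Sg x.

Section Subgroup.
Variables (Sg : set Gam) (hS : is_subgroup Sg).

Lemma subgroupN x : Sg x -> Sg (- x).
Proof. by case: hS => S0 SB Sx; rewrite -[- x]add0r; apply: SB. Qed.

Lemma subgroupD x y : Sg x -> Sg y -> Sg (x + y).
Proof. by case: (hS) => _ SB Sx Sy; rewrite -[y]opprK; apply: SB => //; apply: subgroupN. Qed.

Lemma subgroupMz x (m : int) : Sg x -> Sg (x *~ m).
Proof.
have Mn n : Sg x -> Sg (x *+ n).
  by elim: n => [|n IH] Sx; [case: hS | rewrite mulrS; apply: subgroupD => //; apply: IH].
by case: m => n Sx; [apply: Mn | apply: subgroupN; apply: Mn].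
Qed.

End Subgroup.

(* A translation invariant total preorder, given by its nonnegative elements,
   whose associated equivalence is congruence modulo [Sg]. *)
Definition cone Sg P : Prop :=
  [/\ forall x y, P x -> P y -> P (x + y), forall x, P x \/ P (- x) &
      forall x, P x -> P (- x) -> Sg x].

Lemma cone_opp Sg P : cone Sg P -> cone Sg [set x | P (- x)].
Proof.
case=> PD Ptot PS; split=> [x y Px Py|x|x Px Px'] /=.
- by rewrite opprD; apply: PD.
- by rewrite opprK; case: (Ptot x); [right | left].
- by apply: PS; rewrite /= opprK in Px' *.
Qed.

(** Levi's theorem that torsion free abelian groups can be ordered. A maximal submonoid [P] that
    meets its opposite inside [Sg] is total: if [x] and [- x] were outside, adjoining either would
    fail, which puts a positive and a negative multiple of [x] in [P]; then a multiple of [x], hence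
    [x], is in [Sg]. *)
Lemma levi Sg : is_subgroup Sg -> is_saturated Sg -> exists2 P, cone Sg P & Sg `<=` P.
Proof.
move=> hS satS.
pose Q W := [/\ Sg `<=` W, forall x y, W x -> W y -> W (x + y) &
               forall x, W x -> W (- x) -> Sg x].
have [|F [X0 FX0] FQ Ftot|P [[SP PD PS] _ Pmax]] := @zorn_above _ Q Sg.
- split=> // x y; exact: subgroupD.
- have mem2 x y : (\bigcup_(X in F) X) x -> (\bigcup_(X in F) X) y ->
      exists X, [/\ F X, X x & X y].
    move=> [X FX Xx] [Y FY Yy]; have [XY|YX] := Ftot _ _ FX FY.
      by exists Y; split=> //; apply: XY.
    by exists X; split=> //; apply: YX.
  split=> [x Sx|x y Hx Hy|x Hx Hx'].
  + by exists X0 => //; have [SX _ _] := FQ _ FX0; apply: SX.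
  + have [X [FX Xx Xy]] := mem2 _ _ Hx Hy.
    by exists X => //; have [_ XD _] := FQ _ FX; apply: XD.
  + have [X [FX Xx Xy]] := mem2 _ _ Hx Hx'.
    by have [_ _ XS] := FQ _ FX; apply: XS.
exists P => //; split=> // x; apply: contrapT => /not_orP[Px Px'].
have PMn y n : P y -> P (y *+ n.+1).
  by move=> Py; elim: n => [|n IH]; [rewrite mulr1n | rewrite mulrS; apply: PD].
have key y : ~ P y -> exists n, P (- (y *+ n.+1)).
  move=> Py; apply: contrapT => /forallNP nP; apply: (Py).
  apply: (Pmax [set z | exists p n, P p /\ z = p + y *+ n]); last first.
  - by exists 0, 1%N; rewrite add0r mulr1n; split=> //; apply: SP; case: hS.
  - by move=> p Pp; exists p, 0%N; rewrite mulr0n addr0.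
  split=> [s Ss|_ _ [p [n [Pp ->]]] [q [m [Pq ->]]]|z [p [n [Pp Ez]]] [q [m [Pq Ez']]]].
  - by exists s, 0%N; rewrite mulr0n addr0; split=> //; apply: SP.
  - by exists (p + q), (n + m)%N; rewrite mulrnDr addrACA; split=> //; apply: PD.
  have E : p + q = - (y *+ (n + m)).
    apply/eqP; rewrite -addr_eq0 mulrnDr -addrA [q + _]addrA [q + _]addrC -addrA addrA.
    by rewrite -Ez -Ez' subrr.
  case nm : (n + m)%N => [|nm']; last by exfalso; apply: (nP nm'); rewrite -nm -E; apply: PD.
  move: nm Ez Ez' => /eqP; rewrite addn_eq0 => /andP[/eqP -> /eqP ->].
  by rewrite !mulr0n !addr0 => -> E'; apply: PS => //; rewrite E'.
have [[n Pn] [m Pm]] := (key x Px, key _ Px').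
move: Pm; rewrite mulNrn opprK => Pm.
apply: Px; apply: SP; apply: (satS x (n * m + n + m)%N).
have -> : (n * m + n + m).+1 = (n.+1 * m.+1)%N by rewrite mulnS mulSn; lia.
apply: PS; first by rewrite mulnC mulrnA; apply: PMn.
by rewrite mulrnA -mulNrn; apply: PMn.
Qed.

Definition saturation Sg (chi : Gam) : set Gam :=
  [set x | exists (n : nat) (m : int), Sg (x *+ n.+1 - chi *~ m)].

Section Saturation.
Variables (Sg : set Gam) (chi : Gam).
Hypotheses (hS : is_subgroup Sg) (satS : is_saturated Sg).

Lemma saturation_subgroup : is_subgroup (saturation Sg chi).
Proof.
split=> [|x y [n [m Hx]] [p [q Hy]]]; first by exists 0%N, 0; rewrite mul0rn mulr0z subrr; case: hS.
exists (n * p + n + p)%N, (m * p.+1%:Z - q * n.+1%:Z).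
have -> : (x - y) *+ (n * p + n + p).+1 - chi *~ (m * p.+1%:Z - q * n.+1%:Z) =
    (x *+ n.+1 - chi *~ m) *~ p.+1%:Z - (y *+ p.+1 - chi *~ q) *~ n.+1%:Z.
  have -> : (n * p + n + p).+1 = (n.+1 * p.+1)%N by lia.
  rewrite !pmulrn PoszM !(mulrzBl, mulrzBr) -!mulrzA [p.+1%:Z * n.+1%:Z]mulrC.
  by rewrite !opprD !opprK addrACA.
by case: (hS) => _; apply; apply: subgroupMz.
Qed.

Lemma saturation_sub : Sg `<=` saturation Sg chi.
Proof. by move=> x Sx; exists 0%N, 0; rewrite mulr1n mulr0z subr0. Qed.

Lemma saturation_mem : saturation Sg chi chi.
Proof. by exists 0%N, 1; rewrite mulr1n mulr1z subrr; case: hS. Qed.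

Lemma saturation_saturated : is_saturated (saturation Sg chi).
Proof.
move=> x n [p [m Hx]]; exists (n * p + n + p)%N, m.
have -> : (n * p + n + p).+1 = (n.+1 * p.+1)%N by lia.
by rewrite mulrnA.
Qed.

(* [saturation Sg chi] has rank one modulo [Sg], so its finitely generated
   subgroups are cyclic modulo [Sg]. *)
Lemma saturation_pair x y : saturation Sg chi x -> saturation Sg chi y ->
  exists psi (i j : int), [/\ saturation Sg chi psi, Sg (x - psi *~ i) & Sg (y - psi *~ j)].
Proof.
move=> Hx Hy; have [n [m Sx]] := Hx; have [p [q Sy]] := Hy.
have hS' := saturation_subgroup.
have zero z (e : nat) (f : int) : f = 0 -> Sg (z *+ e.+1 - chi *~ f) -> Sg z.
  by move=> ->; rewrite mulr0z subr0; apply: satS.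
have [m0|m0] := eqVneq m 0.
  exists y, 0, 1; rewrite mulr0z subr0 mulr1z subrr; split=> //; first exact: zero Sx.
  by case: hS.
have [q0|q0] := eqVneq q 0.
  exists x, 1, 0; rewrite mulr0z subr0 mulr1z subrr; split=> //; last exact: zero Sy.
  by case: hS.
(* Eliminating [chi] from the relations of [x] and [y] gives [x *~ M = y *~ N] modulo [Sg];
   saturation allows division by the gcd. *)
pose M : int := n.+1%:Z * q; pose N : int := p.+1%:Z * m.
have SMN : Sg (x *~ M - y *~ N).
  have -> : x *~ M - y *~ N = (x *+ n.+1 - chi *~ m) *~ q - (y *+ p.+1 - chi *~ q) *~ m.
    rewrite !mulrzBl /M /N !mulrzA -!mulrzA [q * m]mulrC !mulrzA opprB addrA addrNK.
    by [].
  by case: (hS) => _; apply; apply: subgroupMz.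
have M0 : M != 0 by rewrite mulf_neq0.
pose g := gcdz M N; have g0 : g != 0 by rewrite gcdz_eq0 negb_and M0.
have EM : M = (M %/ g)%Z * g by rewrite divzK // dvdz_gcdl.
have EN : N = (N %/ g)%Z * g by rewrite divzK // dvdz_gcdr.
set M' := (M %/ g)%Z in EM; set N' := (N %/ g)%Z in EN.
have [u [v uv]] : exists u v : int, u * M' + v * N' = 1.
  have [u [v uv]] := Bezoutz M N; exists u, v; apply: (mulIf g0).
  by rewrite mulrDl -!mulrA -EM -EN uv mul1r.
have S' : Sg (x *~ M' - y *~ N').
  have Sz : Sg ((x *~ M' - y *~ N') *~ g) by rewrite mulrzBl -!mulrzA -EM -EN.
  have [e Eg] : exists e : nat, g = e%:Z by exists (gcdn `|M| `|N|).
  move: Sz g0; rewrite Eg; case: (e) => [|e'] // Sz _; exact: satS Sz.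
(* With [x *~ M' = y *~ N'] modulo [Sg] and the Bezout relation [uv], this element has [N']-th
   multiple [x] and [M']-th multiple [y]. *)
exists (y *~ u + x *~ v), N', M'; split.
- by apply: subgroupD => //; apply: subgroupMz.
- have -> : x - (y *~ u + x *~ v) *~ N' = (x *~ M' - y *~ N') *~ u.
    rewrite -{1}[x]mulr1z -uv mulrzDl mulrzBl mulrzDr -!mulrzA.
    by rewrite [M' * u]mulrC [N' * u]mulrC opprD addrACA subrr addr0.
  exact: subgroupMz.
- have -> : y - (y *~ u + x *~ v) *~ M' = - ((x *~ M' - y *~ N') *~ v).
    rewrite -{1}[y]mulr1z -uv mulrzDl mulrzBl mulrzDr -!mulrzA.
    by rewrite [M' * v]mulrC [N' * v]mulrC opprD addrACA subrr add0r opprB.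
  by apply: subgroupN => //; apply: subgroupMz.
Qed.

Lemma saturation_cyclic (L : seq Gam) : {in L, forall x, saturation Sg chi x} ->
  exists2 psi, saturation Sg chi psi & {in L, forall x, exists i : int, Sg (x - psi *~ i)}.
Proof.
have hS' := saturation_subgroup.
elim: L => [|x L IH] HL; first by exists 0 => //; case: hS'.
have [y yL|phi Hphi HLphi] := IH; first by apply: HL; rewrite inE yL orbT.
have [psi [i [j [Hpsi Si Sj]]]] := saturation_pair (HL x (mem_head _ _)) Hphi.
exists psi => // y; rewrite inE => /orP[/eqP ->|/HLphi[e Se]]; first by exists i.
exists (j * e); have -> : y - psi *~ (j * e) = (y - phi *~ e) + (phi - psi *~ j) *~ e.
  by rewrite mulrzBl -mulrzA addrA subrK.
by apply: subgroupD => //; apply: subgroupMz.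
Qed.

End Saturation.

End TorsionFree.

(** * Leading components in graded domains *)

Section Graded.
Variables (A : comNzRingType) (Gam : zmodType) (gr : Gam -> set A) (pr : set Gam -> A -> A).
Implicit Types (T U Sg P : set Gam) (g h : Gam) (x y a b p : A).

(* [pr T] is the projection to the components of degree in [T]. *)
Definition grading : Prop :=
  [/\ gr 0 1, forall g h x y, gr g x -> gr h y -> gr (g + h) (x * y),
      forall g x y, gr g x -> gr g y -> gr g (x + y) &
      forall x, exists2 s : seq (Gam * A), {in s, forall q, gr q.1 q.2} & x = \sum_(q <- s) q.2] /\
  [/\ forall T x y, pr T (x + y) = pr T x + pr T y,
      forall T g x, gr g x -> T g -> pr T x = x &
      forall T g x, gr g x -> ~ T g -> pr T x = 0].

Hypothesis hgr : grading.
Hypothesis dom : is_domain A.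

Lemma prD T x y : pr T (x + y) = pr T x + pr T y.
Proof. by case: hgr => _ []. Qed.

Lemma pr0 T : pr T 0 = 0.
Proof. by apply: (addIr (pr T 0)); rewrite -prD !add0r. Qed.

Lemma pr_sum T (I : Type) (r : seq I) (F : I -> A) :
  pr T (\sum_(i <- r) F i) = \sum_(i <- r) pr T (F i).
Proof. exact: (big_morph (pr T) (prD T) (pr0 T)). Qed.

Lemma prB T x y : pr T (x - y) = pr T x - pr T y.
Proof. by apply: (addIr (pr T y)); rewrite -prD !subrK. Qed.

Lemma gr_sum x : exists2 s : seq (Gam * A),
  {in s, forall q, gr q.1 q.2} & x = \sum_(q <- s) q.2.
Proof. by case: hgr => -[]. Qed.

Lemma pr_gr T g x : gr g x -> pr T x = if `[< T g >] then x else 0.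
Proof.
case: hgr => _ [_ H1 H0] Hx; case: asboolP => Tg; [exact: H1 Hx Tg | exact: H0 Hx Tg].
Qed.

Lemma prI T U x : pr T (pr U x) = pr (T `&` U) x.
Proof.
have [s Hs ->] := gr_sum x; rewrite !pr_sum; apply: eq_big_seq => q /Hs Hq.
rewrite (pr_gr U Hq) (pr_gr (T `&` U) Hq); case: asboolP => Uq; last first.
  by rewrite pr0; case: asboolP => [[]|].
rewrite (pr_gr T Hq); case: asboolP => Tq; case: asboolP => //; first by case.
by move=> [].
Qed.

Lemma pr_set0 x : pr set0 x = 0.
Proof.
have [s Hs ->] := gr_sum x; rewrite pr_sum big1_seq // => q /andP[_ /Hs Hq].
by rewrite (pr_gr _ Hq); case: asboolP.
Qed.

Lemma pr_setU T U x : T `&` U = set0 -> pr (T `|` U) x = pr T x + pr U x.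
Proof.
move=> TU; have [s Hs ->] := gr_sum x; rewrite !pr_sum -big_split.
apply: eq_big_seq => q /Hs Hq /=; rewrite !(pr_gr _ Hq).
case: (asboolP (T q.1)) => Tq; case: (asboolP (U q.1)) => Uq; case: asboolP => TUq;
  rewrite ?addr0 ?add0r //; try by exfalso; apply: TUq; auto; [left | right].
- by have : set0 q.1 by rewrite -TU.
- by have : set0 q.1 by rewrite -TU.
- by exfalso; apply: TUq; left.
- by exfalso; apply: TUq; right.
- by case: TUq.
Qed.

Lemma pr_setT x : pr setT x = x.
Proof.
have [s Hs ->] := gr_sum x; rewrite pr_sum; apply: eq_big_seq => q /Hs Hq.
by rewrite (pr_gr _ Hq); case: asboolP => // -[].
Qed.

Definition supp_in T x : Prop := pr T x = x.

Lemma supp_pr T x : supp_in T (pr T x).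
Proof. by rewrite /supp_in prI setIid. Qed.

Lemma supp_in_sub T U x : T `<=` U -> supp_in T x -> supp_in U x.
Proof. by rewrite /supp_in => TU <-; rewrite prI; congr pr; apply/setIidPr. Qed.

Lemma supp_inD T x y : supp_in T x -> supp_in T y -> supp_in T (x + y).
Proof. by rewrite /supp_in prD => -> ->. Qed.

Lemma supp_inB T x y : supp_in T x -> supp_in T y -> supp_in T (x - y).
Proof. by rewrite /supp_in prB => -> ->. Qed.

Lemma supp_in_gr T g x : gr g x -> T g -> supp_in T x.
Proof. by rewrite /supp_in => Hx Tg; rewrite (pr_gr _ Hx); case: asboolP. Qed.

Lemma supp_in_sum T x : supp_in T x ->
  exists2 s : seq (Gam * A), {in s, forall q, gr q.1 q.2 /\ T q.1} & x = \sum_(q <- s) q.2.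
Proof.
have [s Hs ->] := gr_sum x; rewrite /supp_in pr_sum => <-.
exists [seq q <- s | `[< T q.1 >]].
  by move=> q; rewrite mem_filter => /andP[/asboolP Tq /Hs].
rewrite big_filter [RHS]big_mkcond; apply: eq_big_seq => q /Hs Hq.
exact: pr_gr.
Qed.

Lemma pr_disjoint T U x : T `&` U = set0 -> supp_in U x -> pr T x = 0.
Proof. by move=> TU <-; rewrite prI TU pr_set0. Qed.

Lemma supp_inM T U W x y : (forall g h, T g -> U h -> W (g + h)) ->
  supp_in T x -> supp_in U y -> supp_in W (x * y).
Proof.
move=> TUW /supp_in_sum[s Hs ->] /supp_in_sum[t Ht ->].
rewrite /supp_in mulr_suml pr_sum; apply: eq_big_seq => q /Hs[Hq Tq].
rewrite mulr_sumr pr_sum; apply: eq_big_seq => r /Ht[Hr Ur].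
have [[_ GM _ _] _] := hgr.
exact: supp_in_gr (GM _ _ _ _ Hq Hr) (TUW _ _ Tq Ur).
Qed.

Definition coset Sg g : set Gam := [set h | Sg (h - g)].

(** Homogeneity for the coarser grading by the quotient by [Sg]: plain homogeneity when [Sg] is 0,
    no condition when it is everything. *)
Definition homog_mod Sg x : Prop := exists g, supp_in (coset Sg g) x.

Section Congruence.
Variables (Sg : set Gam) (hS : is_subgroup Sg).

Lemma cosetI0 g h : ~ Sg (g - h) -> coset Sg g `&` coset Sg h = set0.
Proof.
move=> nS; apply/seteqP; split=> // x [xg xh]; apply: nS.
have -> : g - h = (x - h) - (x - g) by rewrite opprB [RHS]addrC addrA subrK.
by case: hS => _; apply.
Qed.

Lemma coset_refl g : coset Sg g g.
Proof. by rewrite /coset /= subrr; case: hS. Qed.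

Lemma cosetM g h x y : supp_in (coset Sg g) x -> supp_in (coset Sg h) y ->
  supp_in (coset Sg (g + h)) (x * y).
Proof.
apply: supp_inM => u v ug vh; rewrite /coset /= opprD addrACA.
exact: subgroupD.
Qed.

Lemma homogM x y : homog_mod Sg x -> homog_mod Sg y -> homog_mod Sg (x * y).
Proof. by move=> [g xg] [h yh]; exists (g + h); apply: cosetM. Qed.

Variables (P : set Gam) (hP : cone Sg P) (SP : Sg `<=` P).

Definition above Q g : set Gam := [set h : Gam | Q (h - g) /\ ~ Sg (h - g)].
Definition below Q g : set Gam := above [set x : Gam | Q (- x)] g.

Lemma pr_split x g : x = pr (above P g) x + pr (coset Sg g) x + pr (below P g) x.
Proof.
have [PD Ptot PS] := hP.
rewrite -pr_setU; last by apply/seteqP; split=> // h [[_ nS]].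
rewrite -pr_setU; last first.
  apply/seteqP; split=> // h [[[Ph nS]|Sh] [Ph' nS']] //.
  by apply: nS; apply: PS.
rewrite -{1}[x]pr_setT; congr pr; apply/seteqP; split=> // h _.
have [Sh|nS] := pselect (Sg (h - g)); first by left; right.
by case: (Ptot (h - g)) => Ph; [left; left | right].
Qed.

Definition stable_set T : Prop := forall g h, T g -> Sg h -> T (g + h).

Lemma coset_stable g : stable_set (coset Sg g).
Proof. by move=> u h; rewrite /coset /= addrAC => *; apply: subgroupD. Qed.

Lemma above_stable g : stable_set (above P g).
Proof.
have [PD _ _] := hP; move=> u h [Pu nu] Sh; split; rewrite addrAC.
  by apply: PD => //; apply: SP.
by move=> Su; apply: nu; rewrite -[_ - g](addrK h); case: (hS) => _; apply.
Qed.

Definition graded_ideal (D : set A) : Prop :=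
  is_ideal D /\ forall T x, stable_set T -> D x -> D (pr T x).

Lemma max_degree (s : seq (Gam * A)) : s != [::] ->
  exists2 q, q \in s & {in s, forall r, P (q.1 - r.1)}.
Proof.
have [PD Ptot _] := hP; have P0 : P 0 by apply: SP; case: hS.
elim: s => // q s IH _; have [->|/IH[r rs Hr]] := eqVneq s [::].
  by exists q; rewrite ?mem_head // => r; rewrite inE => /eqP ->; rewrite subrr.
case: (Ptot (q.1 - r.1)) => Pqr.
  exists q; rewrite ?mem_head // => t; rewrite inE => /orP[/eqP ->|/Hr Pt].
    by rewrite subrr.
  by rewrite -(subrK r.1 q.1) -addrA; apply: PD.
rewrite opprB in Pqr; exists r; first by rewrite inE rs orbT.
by move=> t; rewrite inE => /orP[/eqP ->|/Hr].
Qed.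

(** The top coset is removed as long as its component lies in [D]; the number of homogeneous terms
    drops each time. *)
Lemma leading_component D x : graded_ideal D -> ~ D x ->
  exists2 g, ~ D (pr (coset Sg g) x) & D (pr (above P g) x).
Proof.
have [PD Ptot PS] := hP; move=> [hD gD]; have [s] := gr_sum x.
have [n] := ubnP (size s); elim: n s x => // n IH s x; rewrite ltnS => sn Hs Ex Dx.
have s0 : s != [::].
  by apply: contra_notN Dx => /eqP s0; rewrite Ex s0 big_nil; apply: ideal0.
have [q0 q0s Hq0] := max_degree s0; pose T := coset Sg q0.1.
have aboveD : D (pr (above P q0.1) x).
  suff -> : pr (above P q0.1) x = 0 by apply: ideal0.
  rewrite Ex pr_sum big1_seq // => q /andP[_ qs].
  rewrite (pr_gr _ (Hs q qs)); case: asboolP => // -[Pq nSq]; exfalso.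
  by apply: nSq; apply: PS => //; rewrite opprB; apply: Hq0.
have [DT|nDT] := pselect (D (pr T x)); last by exists q0.1.
have E : x - pr T x = \sum_(q <- [seq q <- s | ~~ `[< T q.1 >]]) q.2.
  rewrite big_filter Ex pr_sum (bigID (fun q : Gam * A => `[< T q.1 >])) /=.
  have -> : \sum_(q <- s) pr T q.2 = \sum_(q <- s | `[< T q.1 >]) q.2.
    by rewrite [RHS]big_mkcond; apply: eq_big_seq => q /Hs Hq; apply: pr_gr.
  by rewrite addrAC subrr add0r.
have [||||g nDg Dg] := IH [seq q <- s | ~~ `[< T q.1 >]] (x - pr T x).
- apply: leq_trans sn; rewrite size_filter -(count_predC (fun q : Gam * A => ~~ `[< T q.1 >]) s).
  rewrite -addn1 leq_add2l -has_count; apply/hasP; exists q0 => //=.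
  by rewrite negbK; apply/asboolP; apply: coset_refl.
- by move=> q; rewrite mem_filter => /andP[_ /Hs].
- exact: E.
- by move=> DxT; apply: Dx; rewrite -(subrK (pr T x) x); apply: idealD.
have DTc U : stable_set U -> D (pr U (pr T x)) by move=> sU; apply: gD.
exists g => [Dgx|].
  apply: nDg; rewrite prB; apply: idealB => //; apply: DTc; exact: coset_stable.
rewrite -(subrK (pr T x) x) prD; apply: idealD => //; apply: DTc; exact: above_stable.
Qed.

(** Modulo [D] the parts above the leading cosets disappear, and any product involving a part below
    falls strictly below [g + h]; only the product of the leading components remains there. *)
Lemma leading_product D x y g h : graded_ideal D ->
  D (pr (above P g) x) -> D (pr (above P h) y) -> D (pr (coset Sg (g + h)) (x * y)) ->
  D (pr (coset Sg g) x * pr (coset Sg h) y).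
Proof.
have [PD Ptot PS] := hP.
move=> [hD gD] Dx Dy Dxy.
set x0 := pr (coset Sg g) x; set y0 := pr (coset Sg h) y.
pose xb := pr (below P g) x; pose yb := pr (below P h) y.
pose xa := pr (above P g) x; pose ya := pr (above P h) y.
have E : x * y = (x0 * y0 + (x0 * yb + xb * y0 + xb * yb)) + (xa * y + (x0 + xb) * ya).
  have -> : x * y = xa * y + (x - xa) * y by ring.
  have -> : x - xa = x0 + xb by rewrite {1}(pr_split x g) -/xa -/x0 -/xb; ring.
  have {2}-> : y = ya + y0 + yb by apply: pr_split.
  by ring.
rewrite E prD in Dxy.
have /(idealDr hD Dxy) : D (pr (coset Sg (g + h)) (xa * y + (x0 + xb) * ya)).
  apply: gD; first exact: coset_stable.
  by apply: idealD => //; [apply: idealMr | apply: idealMl].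
rewrite prD.
have subDD (a b : Gam) : a + b - (g + h) = (a - g) + (b - h) by rewrite opprD addrACA.
have sum0 : supp_in (below P (g + h)) (x0 * yb + xb * y0 + xb * yb).
  apply: supp_inD; first apply: supp_inD.
  - apply: (supp_inM _ (supp_pr _ _) (supp_pr _ _)) => a b Sa [Pb nb]; split.
      by rewrite /= subDD opprD; apply: PD => //; apply: SP; apply: subgroupN.
    rewrite subDD => Sab; apply: nb; rewrite -[b - h](addKr (a - g)).
    by apply: subgroupD => //; apply: subgroupN.
  - apply: (supp_inM _ (supp_pr _ _) (supp_pr _ _)) => a b [Pa na] Sb; split.
      by rewrite /= subDD opprD; apply: PD => //; apply: SP; apply: subgroupN.
    rewrite subDD => Sab; apply: na; rewrite -[a - g](addrK (b - h)).
    by case: (hS) => _; apply.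
  - apply: (supp_inM _ (supp_pr _ _) (supp_pr _ _)) => a b [Pa na] [Pb nb]; split.
      by rewrite /= subDD opprD; apply: PD.
    rewrite subDD => Sab; apply: na; apply: PS => //.
    rewrite -[a - g](addrK (b - h)); apply: PD; first exact: SP.
    exact: Pb.
rewrite (pr_disjoint _ sum0) ?addr0; last first.
  by apply/seteqP; split=> // u [Su [_ nSu]].
suff {2}<- : pr (coset Sg (g + h)) (x0 * y0) = x0 * y0 by [].
by apply: cosetM; apply: supp_pr.
Qed.

End Congruence.

Lemma graded_zero Sg : graded_ideal Sg [set 0].
Proof. by split=> [|T x _ ->]; [exact: zero_ideal | rewrite /= pr0]. Qed.

Lemma graded_principal Sg p : is_subgroup Sg -> homog_mod Sg p -> graded_ideal Sg (principal p).
Proof.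
move=> hS [c /supp_in_sum[t Ht Ep]]; split; first exact: principal_ideal.
(* The generator has degree [c] modulo [Sg], so projecting [r * p] amounts to projecting [r] to
   degrees shifted by [c]. *)
move=> T _ sT [r ->]; exists (pr [set h | T (h + c)] r).
have [s Hs ->] := gr_sum r; rewrite Ep pr_sum !mulr_suml pr_sum; apply: eq_big_seq => q /Hs Hq.
rewrite !mulr_sumr pr_sum; apply: eq_big_seq => u /Ht[Hu Su].
have [[_ GM _ _] _] := hgr; rewrite (pr_gr _ (GM _ _ _ _ Hq Hu)) (pr_gr _ Hq).
have -> : `[< T (q.1 + u.1) >] = `[< T (q.1 + c) >].
  apply/asboolP/asboolP => H.
    have -> : q.1 + c = q.1 + u.1 + - (u.1 - c) by rewrite opprB -addrA [u.1 + _]addrC subrK.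
    by apply: sT => //; apply: subgroupN.
  have -> : q.1 + u.1 = q.1 + c + (u.1 - c) by rewrite -addrA [c + _]addrC subrK.
  exact: sT.
by rewrite /=; case: asboolP; rewrite ?mul0r.
Qed.

(** For the order of [levi] and for its opposite, the extreme components of [x] and [y] have a
    nonzero product, so both sums of extreme degrees are [c] modulo [Sg]. As top degrees dominate
    bottom ones, the two agree for [x]. *)
Lemma homog_mod_divisor Sg x y : is_subgroup Sg -> is_saturated Sg ->
  x * y <> 0 -> homog_mod Sg (x * y) -> homog_mod Sg x.
Proof.
move=> hS satS xy0 [c xyc]; have [P hP SP] := levi hS satS.
have hP' := cone_opp hP; have SP' : Sg `<=` [set x | P (- x)].
  by move=> u Su; apply: SP; apply: subgroupN.
have x0 : x <> 0 by move=> x0; apply: xy0; rewrite x0 mul0r.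
have y0 : y <> 0 by move=> y0; apply: xy0; rewrite y0 mulr0.
have [PD _ PS] := hP.
have D0 := graded_zero Sg.
have lead Q : cone Sg Q -> Sg `<=` Q -> exists g h, [/\ pr (coset Sg g) x <> 0,
    pr (above Sg Q g) x = 0, pr (coset Sg h) y <> 0, pr (above Sg Q h) y = 0 & Sg (g + h - c)].
  move=> hQ SQ; have [g xg xa] := leading_component hS hQ SQ D0 (x := x) x0.
  have [h yh ya] := leading_component hS hQ SQ D0 (x := y) y0.
  exists g, h; split=> //; apply: contrapT => nS.
  have := leading_product hS hQ SQ (g := g) (h := h) D0 xa ya.
  rewrite (pr_disjoint (cosetI0 hS nS) xyc) => /(_ erefl) /dom[]; [exact: xg | exact: yh].
have top z g u : pr (coset Sg u) z <> 0 -> pr (above Sg P g) z = 0 -> P (g - u).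
  move=> zu zg; have [PD' Ptot _] := hP; case: (Ptot (g - u)) => //; rewrite opprB => Pug.
  have [Sug|nSug] := pselect (Sg (u - g)); first by rewrite -opprB; exact: (SP' _ Sug).
  exfalso; apply: zu; have <- : pr (coset Sg u) (pr (above Sg P g) z) = pr (coset Sg u) z.
    rewrite prI; congr pr; apply/setIidPl => v Sv; have E : v - g = (u - g) + (v - u).
      by rewrite [RHS]addrC addrA subrK.
    split; first by rewrite E; apply: PD => //; apply: SP.
    move=> Svg; apply: nSug; rewrite -[u - g](addrK (v - u)) -E.
    by case: (hS) => _; apply.
  by rewrite zg pr0.
have [g [h [xg xa yh ya Sgh]]] := lead P hP SP.
have [g' [h' [xg' xa' yh' ya' Sgh']]] := lead _ hP' SP'.
have Sgg' : Sg (g - g').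
  apply: PS; first exact: top xg' xa.
  have -> : - (g - g') = (h - h') + - ((g + h - c) - (g' + h' - c)).
    have -> : (g + h - c) - (g' + h' - c) = (g - g') + (h - h').
      by rewrite opprB addrA subrK opprD addrACA.
    by rewrite [g - g' + _]addrC [in RHS]opprD addrA subrr add0r. 
  apply: PD; first exact: top yh' ya.
  by apply: SP; apply: subgroupN => //; case: (hS) => _; apply.
exists g; rewrite /supp_in {2}(pr_split hP x g) xa add0r.
suff -> : pr (below Sg P g) x = 0 by rewrite addr0.
have <- : pr (below Sg P g) (pr (above Sg [set u | P (- u)] g') x) = pr (below Sg P g) x.
  rewrite prI; congr pr; apply/setIidPl => u [/= Pu nu].
  have E : u - g' = (u - g) + (g - g') by rewrite addrA subrK.
  split=> /=; first by rewrite E opprD; apply: PD => //; exact: (SP' _ Sgg').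
  by rewrite E => H; apply: nu; rewrite -[u - g](addrK (g - g')); case: (hS) => _; apply.
by rewrite xa' pr0.
Qed.

(** If [p] divided neither factor, the leading components modulo the graded ideal of [p] would be
    homogeneous factors with the same defect. *)
Lemma homog_mod_prime Sg p : is_subgroup Sg -> is_saturated Sg -> homog_mod Sg p ->
  (forall b c, homog_mod Sg b -> homog_mod Sg c -> divides p (b * c) -> divides p b \/ divides p c) ->
  forall b c, divides p (b * c) -> divides p b \/ divides p c.
Proof.
move=> hS satS hp Hp b c pbc; apply: contrapT => /not_orP[nb nc].
have [P hP SP] := levi hS satS; have gD := graded_principal hS hp.
have [g bg ba] := leading_component hS hP SP gD (x := b) nb.
have [h ch ca] := leading_component hS hP SP gD (x := c) nc.
have := leading_product hS hP SP (g := g) (h := h) gD ba ca.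
case: (gD) => _ gD' /(_ (gD' _ _ (@coset_stable _ hS _) pbc)).
by case/Hp => //; [exists g; apply: supp_pr | exists h; apply: supp_pr].
Qed.

End Graded.

(** * Gauss' lemma for graded domains *)

Section GradedFactorial.
Variables (A : comNzRingType) (Gam : zmodType) (gr : Gam -> set A) (pr : set Gam -> A -> A).
Hypothesis hgr : grading gr pr.
Hypothesis dom : is_domain A.
Hypothesis accpA : accp A.
Implicit Types (T U Sg : set Gam) (g psi rho : Gam) (x y a b d t h : A).
Local Notation supp_in := (supp_in pr).
Local Notation homog_mod := (homog_mod pr).

Definition homog_irreducible_prime Sg : Prop :=
  forall a, irreducible_element a -> homog_mod Sg a -> prime_element a.

Section Step.
Variables (Sg : set Gam) (chi : Gam).
Hypotheses (hS : is_subgroup Sg) (satS : is_saturated Sg).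
Hypothesis primeS : homog_irreducible_prime Sg.

Definition primitive y : Prop :=
  forall h, irreducible_element h -> homog_mod Sg h -> ~ divides h y.

(** Gauss' lemma. A constant [e] with [y] dividing [e * x] is chosen minimal for divisibility. An
    irreducible factor of [e] is a prime constant that does not divide the primitive [y], so it
    cancels from the cofactor, contradicting minimality unless [e] is a unit. *)
Lemma primitive_divides y t x : primitive y -> t <> 0 -> homog_mod Sg t ->
  divides y (t * x) -> divides y x.
Proof.
move=> py t0 ht ytx.
have [|e [e0 he ye] emin] := accpA (Q := [set e | [/\ e <> 0, homog_mod Sg e & divides y (e * x)]]).
  by exists t.
have [[v ev]|ne] := pselect (is_unit e).
  apply: (divides_trans ye); exists v; rewrite mulrA [v * e]mulrC ev mul1r //.
exfalso; have [h hi [e' E]] := irreducible_divisor dom accpA e0 ne.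
have hh : homog_mod Sg h.
  by apply: (homog_mod_divisor hgr dom hS satS (y := e')); rewrite mulrC -E.
have e'0 : e' <> 0 by move=> e'0; apply: e0; rewrite E e'0 mul0r.
have he' : homog_mod Sg e'.
  by apply: (homog_mod_divisor hgr dom hS satS (y := h)); rewrite -E.
have [h0 _ hp] := primeS hi hh.
have [z Ez] := ye; have [hz|/(py h hi hh)//] : divides h z \/ divides h y.
  by apply: hp; exists (e' * x); rewrite -Ez E; ring.
have [z' Ez'] := hz.
have ye' : divides y (e' * x).
  exists z'; apply: (domain_lreg dom h0).
  have -> : h * (e' * x) = e' * h * x by ring.
  by rewrite -E Ez Ez'; ring.
have [_ hu _] := hi; apply: hu; apply: (@self_multiple_unit _ dom e').
  by rewrite mulrC -E.
rewrite mulrC -E; apply: emin; first by split.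
by exists h; rewrite mulrC.
Qed.

Lemma primitive_part d : d <> 0 -> exists s d',
  [/\ s <> 0, homog_mod Sg s, d = s * d' & primitive d'].
Proof.
move=> d0; have one : homog_mod Sg 1.
  exists 0; have [[g1 _ _ _] _] := hgr; apply: (supp_in_gr hgr g1); exact: coset_refl.
have [|e [s [s0 hs E]] emin] := accpA (Q := [set e | exists s, [/\ s <> 0, homog_mod Sg s & d = s * e]]).
  by exists d, 1; rewrite mul1r; split=> //; apply/eqP/oner_neq0.
exists s, e; split=> // h hi hh [e' E']; have [h0 hu _] := hi; apply: hu.
apply: (@self_multiple_unit _ dom e').
  by rewrite mulrC -E' => e0; apply: d0; rewrite E e0 mulr0.
rewrite mulrC -E'; apply: emin; last by exists h; rewrite E' mulrC.
exists (s * h); split; first exact: mul_neq0.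
  exact: (homogM hgr hS).
by rewrite E E'; ring.
Qed.

(** Elements supported here behave like polynomials with at most [n] consecutive coefficients in a
    variable of degree [psi], times something of degree [rho]. The variable need not exist in [A];
    only degrees matter. *)
Definition strip psi rho (n : nat) : set Gam :=
  [set g | exists2 i : nat, (i < n)%N & Sg (g - rho - psi *+ i)].

Lemma strip0 psi rho x : supp_in (strip psi rho 0) x -> x = 0.
Proof.
move=> <-; have -> : strip psi rho 0 = set0; last exact: (pr_set0 hgr).
by apply/seteqP; split=> // g [].
Qed.

Lemma strip_split psi rho n x : supp_in (strip psi rho n.+1) x -> exists y z,
  [/\ x = y + z, supp_in (coset Sg (rho + psi *+ n)) y & supp_in (strip psi rho n) z].
Proof.
move=> Hx; set C := coset _ _; exists (pr C x), (x - pr C x); split.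
- by rewrite addrC subrK.
- exact: (supp_pr hgr).
have [s Hs E] := supp_in_sum hgr Hx.
have -> : x - pr C x = \sum_(q <- s) (q.2 - pr C q.2).
  by rewrite sumrB -(pr_sum hgr) -E.
rewrite big_seq; apply: (big_ind (supp_in (strip psi rho n))) => [|u v|q /Hs[Hq [i ni Si]]].
- exact: (pr0 hgr).
- exact: (supp_inD hgr).
rewrite (pr_gr hgr _ Hq); case: asboolP => Cq; first by rewrite subrr; exact: (pr0 hgr).
rewrite subr0; apply: (supp_in_gr hgr Hq); exists i => //.
move: ni; rewrite ltnS leq_eqVlt => /orP[/eqP Ei|//].
by exfalso; apply: Cq; rewrite /C /coset /= opprD addrA -Ei.
Qed.

Lemma coset_strip psi g rho n x y : supp_in (coset Sg g) x -> supp_in (strip psi rho n) y ->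
  supp_in (strip psi (g + rho) n) (x * y).
Proof.
apply: (supp_inM hgr) => u v Su [i ni Si]; exists i => //.
have -> : u + v - (g + rho) - psi *+ i = (u - g) + (v - rho - psi *+ i).
  by rewrite opprD addrACA -!addrA.
exact: subgroupD.
Qed.

Lemma strip_shift psi rho n m j : (n + j <= m)%N -> strip psi (rho + psi *+ j) n `<=` strip psi rho m.
Proof.
move=> njm g [i ni Si]; exists (i + j)%N; first by apply: leq_trans njm; rewrite ltn_add2r.
have -> : g - rho - psi *+ (i + j) = g - (rho + psi *+ j) - psi *+ i; last exact: Si.
by rewrite mulrnDr !opprD !addrA addrAC.
Qed.

Section Euclid.
Variables (psi : Gam) (a b : A).
Hypothesis a0 : a <> 0.

Definition combination x : Prop := exists u v, x = u * a + v * b.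

Lemma combination_sub x y u v : combination x -> combination y ->
  combination (u * x - v * y).
Proof.
move=> [p [q ->]] [r [s ->]]; exists (u * p - v * r), (u * q - v * s); ring.
Qed.

(* Euclidean division of [y] by [d], where the leading coefficients are made
   invertible by multiplying with them. *)
Lemma euclid_division n rd d : combination d -> d <> 0 -> supp_in (strip psi rd n.+1) d ->
  (forall rho e, combination e -> supp_in (strip psi rho n) e -> e = 0) ->
  forall m rho y, combination y -> supp_in (strip psi rho m) y ->
  exists t q, [/\ t <> 0, homog_mod Sg t & t * y = q * d].
Proof.
move=> Cd d0 Sd nmin; have [dt [dr [Ed Sdt Sdr]]] := strip_split Sd.
have dt0 : dt <> 0.
  by move=> dt0; apply: d0; apply: (nmin rd) => //; rewrite Ed dt0 add0r.
have hdt : homog_mod Sg dt by exists (rd + psi *+ n).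
have zero y : y = 0 -> exists t q, [/\ t <> 0, homog_mod Sg t & t * y = q * d].
  by move=> ->; exists dt, 0; rewrite mulr0 mul0r.
elim=> [|m IH] rho y Cy Sy; first by apply: zero; apply: strip0 Sy.
have [mn|nm] := ltnP m n.
  apply: zero; apply: (nmin rho) => //; apply: (supp_in_sub hgr _ Sy) => g [i im Si].
  by exists i => //; apply: leq_trans im _.
have [yt [yr [Ey Syt Syr]]] := strip_split Sy.
(* Cross multiplication by the top parts cancels them and leaves a strip of length [m], whose base
   is shifted by the degree [rd + psi *+ n] of [dt]. *)
have [||t [q [t0 ht E]]] := IH (rd + psi *+ n + rho) (dt * y - yt * d).
- exact: combination_sub.
- have -> : dt * y - yt * d = dt * yr - yt * dr by rewrite Ey Ed; ring.
  apply: (supp_inB hgr); first exact: coset_strip.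
  apply: (supp_in_sub hgr _ (coset_strip Syt Sdr)).
  have -> : rho + psi *+ m + rd = rd + psi *+ n + rho + psi *+ (m - n).
    by rewrite -{1}(subnKC nm) mulrnDr [LHS]addrC [rho + (_ + _)]addrCA !addrA.
  by apply: strip_shift; rewrite subnKC.
exists (t * dt), (q + t * yt); split; first exact: mul_neq0.
  exact: (homogM hgr hS).
have -> : t * dt * y = t * (dt * y - yt * d) + t * yt * d by ring.
by rewrite E; ring.
Qed.

(** A nonzero combination of [a] and [b] with shortest strip is a gcd over the homogeneous
    fractions: a remainder is again a combination, with a shorter strip, hence 0. *)
Lemma euclid_gcd ra na rb nb : supp_in (strip psi ra na) a -> supp_in (strip psi rb nb) b ->
  exists d, [/\ combination d, d <> 0,
    exists t q, [/\ t <> 0, homog_mod Sg t & t * a = q * d] &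
    exists t q, [/\ t <> 0, homog_mod Sg t & t * b = q * d]].
Proof.
move=> Sa Sb.
have Ca : combination a by exists 1, 0; rewrite mul1r mul0r addr0.
have Cb : combination b by exists 0, 1; rewrite mul1r mul0r add0r.
pose ok n := `[< exists rho d, [/\ combination d, d <> 0 & supp_in (strip psi rho n) d] >].
have exok : exists n, ok n by exists na; apply/asboolP; exists ra, a.
case: (ex_minnP exok) => -[|n] /asboolP[rd [d [Cd d0 Sd]]] nmin.
  by exfalso; apply: d0; apply: strip0 Sd.
have {}nmin rho e : combination e -> supp_in (strip psi rho n) e -> e = 0.
  move=> Ce Se; apply: contrapT => e0; have : ok n by apply/asboolP; exists rho, e.
  by move/nmin; rewrite ltnn.
exists d; split=> //.
- exact: (euclid_division Cd d0 Sd nmin Ca Sa).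
- exact: (euclid_division Cd d0 Sd nmin Cb Sb).
Qed.

End Euclid.

Lemma strip_bound psi (L : seq Gam) : {in L, forall g, exists i : int, Sg (g - psi *~ i)} ->
  exists c n : nat, {in L, forall g, strip psi (- (psi *+ c)) n g}.
Proof.
elim: L => [|g L IH] HL; first by exists 0%N, 0%N.
have [h hL|c [n Hn]] := IH; first by apply: HL; rewrite inE hL orbT.
have [i Si] := HL g (mem_head _ _).
pose e0 := absz i.
(* Lowering the base by the absolute value of [i] makes the new exponent nonnegative; the length
   grows enough for both old and new degrees. *)
have [j Ej] : exists j : nat, j%:Z = i + (c + e0)%:Z.
  by exists (absz (i + (c + e0)%:Z)); rewrite /e0; lia.
exists (c + e0)%N, (n + e0 + j.+1)%N => h; rewrite inE => /orP[/eqP ->|/Hn[e en Se]].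
  exists j; first by lia.
  have -> : g - - (psi *+ (c + e0)) - psi *+ j = g - psi *~ i; last exact: Si.
  by rewrite opprK -addrA; congr (_ + _); rewrite !pmulrn Ej mulrzDr opprD addrCA subrr addr0.
exists (e + e0)%N; first by lia.
have -> : h - - (psi *+ (c + e0)) - psi *+ (e + e0) = h - - (psi *+ c) - psi *+ e; last exact: Se.
by rewrite !opprK !mulrnDr addrA opprD addrACA -addrA subrr addr0.
Qed.

Lemma common_strip a b : homog_mod (saturation Sg chi) a -> homog_mod (saturation Sg chi) b ->
  exists psi ra rb n, supp_in (strip psi ra n) a /\ supp_in (strip psi rb n) b.
Proof.
move=> [al /(supp_in_sum hgr)[s Hs Ea]] [be /(supp_in_sum hgr)[t Ht Eb]].
pose L := [seq q.1 - al | q <- s] ++ [seq q.1 - be | q <- t].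
have [g|psi _ Hpsi] := saturation_cyclic (L := L) hS satS (chi := chi).
  by rewrite mem_cat => /orP[] /mapP[q]; [case/Hs => _ ? -> | case/Ht => _ ? ->].
have [c [n Hn]] := strip_bound Hpsi.
have shift be' g : strip psi (- (psi *+ c)) n (g - be') -> strip psi (be' - psi *+ c) n g.
  by move=> [i ni Si]; exists i; rewrite // opprD addrA.
exists psi, (al - psi *+ c), (be - psi *+ c), n; split.
- rewrite Ea big_seq; apply: (big_ind (supp_in _)) => [|u v|q qs].
  + exact: (pr0 hgr).
  + exact: (supp_inD hgr).
  have [Hq _] := Hs q qs; apply: (supp_in_gr hgr Hq); apply: shift; apply: Hn.
  by rewrite mem_cat; apply/orP; left; apply/mapP; exists q.
- rewrite Eb big_seq; apply: (big_ind (supp_in _)) => [|u v|q qt].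
  + exact: (pr0 hgr).
  + exact: (supp_inD hgr).
  have [Hq _] := Ht q qt; apply: (supp_in_gr hgr Hq); apply: shift; apply: Hn.
  by rewrite mem_cat; apply/orP; right; apply/mapP; exists q.
Qed.

(** If a constant irreducible divides [a], the two are associate. Otherwise [a] is primitive. When
    [a] divides [b * c], the primitive part [d'] of a gcd of [a] and [b] divides both. Either [d']
    is associate to [a], which then divides [b], or [d'] is a unit and the Bezout identity gives
    that [a] divides [c], up to a constant that [primitive_divides] removes. *)
Lemma saturation_irreducible_prime : homog_irreducible_prime (saturation Sg chi).
Proof.
have hS' := saturation_subgroup chi hS; have satS' : is_saturated (saturation Sg chi).
  exact: saturation_saturated.
move=> a ai ha; have [a0 au adec] := ai.
have [[h [hi hh [e E]]]|pa] := pselect (exists h, [/\ irreducible_element h, homog_mod Sg h & divides h a]).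
  have hp := primeS hi hh; have [_ hu _] := hi; have [eu|//] := adec _ _ E.
  by rewrite E; apply: prime_associate.
have {}pa : primitive a by move=> h hi hh hda; apply: pa; exists h.
split=> //; apply: (homog_mod_prime hgr hS' satS') => // b c hb hc abc.
have [psi [ra [rb [n [Sa Sb]]]]] := common_strip ha hb.
have [d [[u [v Ed]] d0 [t [q [t0 ht Ea]]] [t' [q' [t'0 ht' Eb]]]]] := euclid_gcd a0 Sa Sb.
have [s [d' [s0 hs Es pd']]] := primitive_part d0.
have d'a : divides d' a.
  by apply: (primitive_divides pd' t0 ht); rewrite Ea Es mulrA; exists (q * s).
have d'b : divides d' b.
  by apply: (primitive_divides pd' t'0 ht'); rewrite Eb Es mulrA; exists (q' * s).
have [e Eae] := d'a; have [eu|d'u] := adec _ _ Eae.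
  left; have [w ew] := eu; apply: divides_trans d'b; exists w.
  by rewrite Eae mulrA [w * e]mulrC ew mul1r.
right; have sc : divides a (s * (c * d')).
  have -> : s * (c * d') = u * c * a + v * (b * c).
    have -> : s * (c * d') = c * d by rewrite Es; ring.
    by rewrite Ed; ring.
  by apply: dividesD; [apply: dividesMl; exact: divides_refl | apply: dividesMl].
exact: divides_mul_unit d'u (primitive_divides pa s0 hs sc).
Qed.

End Step.

Hypothesis torsion_free : forall g n, g *+ n.+1 = 0 -> g = 0.
Hypothesis gr0 : forall g, gr g 0.
Hypothesis homog_prime : forall g a, gr g a -> irreducible_element a -> prime_element a.

Theorem graded_irreducible_prime a : irreducible_element a -> prime_element a.
Proof.
move=> ai; have [s Hs Ea] := gr_sum hgr a.
have [Sg [hS satS pS] Ls] : exists2 Sg, [/\ is_subgroup Sg, is_saturated Sg &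
    homog_irreducible_prime Sg] & {in s, forall q, Sg q.1}.
  elim: s Hs {Ea} => [|q s IH] Hs.
    (* The zero subgroup is saturated by [torsion_free], and homogeneity modulo it is ordinary
       homogeneity, so [homog_prime] starts the induction. *)
    exists [set 0] => //; split=> [|g n /torsion_free //|b bi [g /(supp_in_sum hgr)[t Ht Eb]]].
      by split=> // g h -> ->; rewrite subrr.
    apply: (homog_prime (g := g)) => //; rewrite Eb big_seq; have [[_ _ gD _] _] := hgr.
    apply: (big_ind (gr g)) => // [|r rt]; first exact: gD.
    by have [Hr /subr0_eq <-] := Ht r rt.
  have [r rs|Sg [hS satS pS] Ls] := IH; first by apply: Hs; rewrite inE rs orbT.
  exists (saturation Sg q.1).
    split; [exact: saturation_subgroup | exact: saturation_saturated |].
    exact: saturation_irreducible_prime.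
  move=> r; rewrite inE => /orP[/eqP ->|/Ls Sr]; first exact: saturation_mem.
  exact: saturation_sub.
apply: pS => //; exists 0; rewrite Ea big_seq; apply: (big_ind (supp_in _)) => [|u v|q qs].
- exact: (pr0 hgr).
- exact: (supp_inD hgr).
by apply: (supp_in_gr hgr (Hs q qs)); rewrite /coset /= subr0; apply: Ls.
Qed.

End GradedFactorial.

(** * Semiinvariants *)

Section Characters.
Variables (k : fieldType) (G : affineGroup k).
Local Notation A := (coordRing G).
Local Notation eps := (counit G).
Implicit Types chi psi : A.

Lemma character_inv chi : character chi -> antipode G chi * chi = 1.
Proof.
move=> [dc ec]; have := antipode_pairl chi; rewrite dc tpair_tens /= ec scale1r.
by [].
Qed.

Lemma characterV chi : character chi -> character (antipode G chi).
Proof.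
move=> hc; have inv := character_inv hc; have [dc ec] := hc; split.
  have E1 : comul G (antipode G chi) * (chi ⊗ chi) = 1.
    by rewrite -dc -rmorphM inv rmorph1.
  have E2 : (antipode G chi ⊗ antipode G chi) * (chi ⊗ chi) = 1 :> tensor A A.
    by rewrite tens_mul inv.
  by rewrite -[LHS]mulr1 -{1}E2 mulrCA E1 mulr1.
have := congr1 eps inv; rewrite rmorphM rmorph1 /= ec.
by move=> <-; rewrite mulr1.
Qed.

Lemma character_neq0 chi : character chi -> chi <> 0.
Proof. by move=> [_ ec] c0; move: ec; rewrite c0 rmorph0 => /esym/eqP; rewrite oner_eq0. Qed.

(** Dedekind's independence of characters. By induction a form dual to [psi] exists on the span of
    [r]; slicing the comultiplication of the relation by it gives [c i *: chi = c i *: psi], so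
    every coefficient is 0. *)
Lemma character_independent (r : seq A) chi : {in r, forall psi, character psi} -> uniq r ->
  character chi -> chi \notin r -> ~ span r chi.
Proof.
have [n] := ubnP (size r); elim: n r chi => // n IH r chi; rewrite ltnS => rn Hr ur hc ncr sc.
have [c Ec] := (spanP r chi).1 sc.
apply: (character_neq0 hc); rewrite Ec big1 // => i _.
set psi := r`_i; have psir : psi \in r by apply: mem_nth.
have npsi : ~ span (rem psi r) psi.
  apply: IH; [| by move=> ? /mem_rem/Hr | exact: rem_uniq | exact: Hr | by rewrite mem_rem_uniqF].
  by rewrite size_rem // prednK // (leq_trans _ (ltn_ord i)).
have [f [fP f0 f1]] := separating_form (span_subspace _) npsi.
have fr j : f r`_j = ((r`_j == psi) && (j < size r)%N)%:R.
  have [jr|rj] := ltnP j (size r); last by rewrite andbF nth_default // form0.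
  rewrite andbT; case: eqP => [->//|/eqP ne]; apply: f0; apply: span_mem.
  by rewrite mem_rem_uniq // inE ne mem_nth.
have fe (j : 'I_(size r)) : f r`_j = (j == i)%:R.
  by rewrite fr ltn_ord andbT /psi nth_uniq.
have fchi : f chi = c i.
  rewrite Ec form_sum // (bigD1 i) //= formZ // fe eqxx mulr1 big1 ?addr0 // => j /negbTE ji.
  by rewrite formZ // fe ji mulr0.
have E : c i *: chi = c i *: psi.
  rewrite -{1}fchi -slice_tens // -hc.1 {1}Ec rmorph_sum slice_sum //.
  rewrite (bigD1 i) //= big1 ?addr0 => [|j /negbTE ji].
    by rewrite linearZ /= (Hr _ psir).1 scale_tens slice_tens // f1 scale1r.
  by rewrite linearZ /= (Hr _ (mem_nth 0 (ltn_ord j))).1 scale_tens slice_tens // fe ji scale0r.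
have /eqP : c i *: (chi - psi) = 0 by rewrite scalerBr E subrr.
rewrite scaler_eq0 => /orP[/eqP ->|]; first by rewrite scale0r.
by rewrite subr_eq0 => /eqP Ecp; rewrite Ecp psir in ncr.
Qed.

(** This makes the indicator function of [T] extend to a well-defined form on the span of the
    characters; lists are allowed to repeat a character. *)
Lemma character_relation (T : set A) (s : seq (k * A)) : {in s, forall q, character q.2} ->
  \sum_(q <- s) q.1 *: q.2 = 0 -> \sum_(q <- s | `[< T q.2 >]) q.1 = 0.
Proof.
have [n] := ubnP (size s); elim: n s => // n IH [|[c chi] s]; first by rewrite !big_nil.
rewrite ltnS /= => sn Hs; set s0 := (c, chi) :: s.
rewrite (bigID (fun q => q.2 == chi)) /=.
rewrite [X in _ -> X = _](bigID (fun q : k * A => q.2 == chi)) /=.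
set s' := [seq q <- s0 | q.2 != chi].
have -> : \sum_(q <- s0 | q.2 != chi) q.1 *: q.2 = \sum_(q <- s') q.1 *: q.2 by rewrite big_filter.
have -> : \sum_(q <- s0 | `[< T q.2 >] && (q.2 != chi)) q.1 = \sum_(q <- s' | `[< T q.2 >]) q.1.
  by rewrite big_filter_cond; apply: eq_bigl => q; rewrite andbC.
pose C := \sum_(q <- s0 | q.2 == chi) q.1.
have -> : \sum_(q <- s0 | q.2 == chi) q.1 *: q.2 = C *: chi.
  by rewrite scaler_suml; apply: eq_bigr => q /eqP ->.
have -> : \sum_(q <- s0 | `[< T q.2 >] && (q.2 == chi)) q.1 = if `[< T chi >] then C else 0.
  case: asboolP => Tc; [apply: eq_bigl => q | rewrite big_pred0 // => q];
    case: eqP => [->|_]; rewrite ?andbF ?andbT //; first exact/asboolP.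
  exact/asboolP.
move=> E; have C0 : C = 0.
  apply: contrapT => /eqP C0.
  apply: (@character_independent (undup [seq q.2 | q <- s']) chi).
  - move=> psi; rewrite mem_undup => /mapP[q]; rewrite mem_filter => /andP[_ qs] ->.
    exact: Hs.
  - exact: undup_uniq.
  - exact: (Hs _ (mem_head _ _)).
  - rewrite mem_undup; apply/mapP => -[q]; rewrite mem_filter => /andP[/eqP ne _] E'.
    by apply: ne.
  have hW := span_subspace (undup [seq q.2 | q <- s']).
  have -> : chi = - C^-1 *: \sum_(q <- s') q.1 *: q.2.
    by move/eqP: E; rewrite addrC addr_eq0 => /eqP ->; rewrite scalerN scaleNr opprK scalerA mulVf // scale1r.
  apply: (subspaceZ hW); apply: (subspace_sum hW) => q qs; apply: (subspaceZ hW).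
  by apply: span_mem; rewrite mem_undup; apply: map_f.
rewrite C0 if_same add0r; apply: IH.
- by rewrite /s' /s0 /= eqxx /=; apply: leq_trans sn; rewrite ltnS size_filter count_size.
- by move=> q; rewrite mem_filter => /andP[_]; apply: Hs.
- by move: E; rewrite C0 scale0r add0r.
Qed.

Lemma character_form (T : set A) : exists2 f : A -> k, linear_form f &
  forall chi, character chi -> f chi = (`[< T chi >])%:R.
Proof.
pose W : set (A * k^o)%type := [set x | exists2 s : seq (k * A),
  {in s, forall q, character q.2} &
  x = (\sum_(q <- s) q.1 *: q.2, \sum_(q <- s | `[< T q.2 >]) q.1)].
have hW : is_subspace W.
  split=> [|c x y [s Hs ->] [t Ht ->]]; first by exists [::]; rewrite ?big_nil.
  exists ([seq (c * q.1, q.2) | q <- s] ++ t).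
    by move=> q; rewrite mem_cat => /orP[/mapP[r /Hs Hr ->]|/Ht].
  rewrite !big_cat !big_map /=; congr (_, _); congr (_ + _).
    by apply: (etrans (scaler_sumr _ _ _ _)); apply: eq_bigr => q _; rewrite scalerA.
  by apply: (etrans (mulr_sumr _ _ _ _)); apply: eq_bigr.
have nW : ~ W (0, 1).
  move=> [s Hs [/esym s0 s1]]; have := character_relation T Hs s0.
  by rewrite -s1 => /eqP; rewrite oner_eq0.
have [f [fP f0 f1]] := separating_form hW nW.
(* [f] vanishes on the graph [W] of the indicator of [T] and is 1 at [(0, 1)], so minus its value at
   [(chi, 0)] is the indicator at [chi]. *)
exists (fun a => - f (a, 0)) => [c x y|chi hc].
  rewrite /= mulrN -opprD -fP; congr (- f _); congr (_, _).
  exact: (esym (etrans (addr0 (c * 0)) (mulr0 c))).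
have : f (chi, (`[< T chi >])%:R) = 0.
  apply: f0; exists [:: (1, chi)]; first by move=> q; rewrite inE => /eqP ->.
  by rewrite big_seq1 scale1r big_cons big_nil /=; case: asboolP; rewrite ?addr0.
have -> : (chi, (`[< T chi >])%:R) = (`[< T chi >])%:R *: (0, 1) + (chi, 0) :> (A * k^o)%type.
  by congr (_, _); rewrite /= ?scaler0 ?add0r ?addr0 //; apply/esym/mulr1.
by rewrite fP f1 mulr1 => /eqP; rewrite addr_eq0 => /eqP ->.
Qed.

Definition character_pred : {pred A} := fun chi => `[< character chi >].

(** The group [X(G)], written additively below to serve as a group of degrees. *)
Record char_group : Type := CharGroup { ch_val : A; _ : ch_val \in character_pred }.
HB.instance Definition _ := [isSub for ch_val].
HB.instance Definition _ := [Choice of char_group by <:].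

Lemma ch_valP (g : char_group) : character (ch_val g).
Proof. by case: g => chi /= /asboolP. Qed.

Definition to_char_group chi (hc : character chi) : char_group :=
  CharGroup (introT (asboolP (character chi)) hc : chi \in character_pred).

Definition ch_mul (g h : char_group) := to_char_group (characterM (ch_valP g) (ch_valP h)).
Definition ch_inv (g : char_group) := to_char_group (characterV (ch_valP g)).
Definition ch_one : char_group := to_char_group (character1 G).

Fact ch_mulA : associative ch_mul.
Proof. by move=> g h i; apply: val_inj; apply: mulrA. Qed.
Fact ch_mulC : commutative ch_mul.
Proof. by move=> g h; apply: val_inj; apply: mulrC. Qed.
Fact ch_mul1 : left_id ch_one ch_mul.
Proof. by move=> g; apply: val_inj; apply: mul1r. Qed.
Fact ch_mulV : left_inverse ch_one ch_inv ch_mul.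
Proof. by move=> g; apply: val_inj; apply: character_inv; apply: ch_valP. Qed.
HB.instance Definition _ := GRing.isZmodule.Build char_group ch_mulA ch_mulC ch_mul1 ch_mulV.

Lemma ch_valD (g h : char_group) : ch_val (g + h) = ch_val g * ch_val h. Proof. by []. Qed.

Lemma ch_val0 : ch_val 0 = 1. Proof. by []. Qed.

Lemma ch_valMn (g : char_group) n : ch_val (g *+ n) = ch_val g ^+ n.
Proof. by elim: n => // n IH; rewrite mulrS exprS ch_valD IH. Qed.

(** Since [k[G]] is a domain and a character of finite order minus 1 is algebraic over [k] and
    killed by the counit, [algebraic_zero] makes it 0. *)
Lemma char_group_torsion_free : smooth A -> Spec_connected A ->
  forall (g : char_group) n, g *+ n.+1 = 0 -> g = 0.
Proof.
move=> smG cG g n gn; have [d [l [hl hl0]]] := smooth_connected_coordinates smG cG.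
have dA : is_domain A.
  move=> x y xy; have [_ _ /(_ x y)] := formal_kernel_prime hl.
  by rewrite xy => -[m||]; [apply: form0; case: hl | left; apply: hl0 | right; apply: hl0].
apply: val_inj => /=; apply/eqP; rewrite -subr_eq0; apply/eqP.
pose p : {poly k} := ('X - (- 1)%:P) ^+ n.+1 - 1.
apply: (algebraic_zero (eta := @counit_scalar k G A) (p := p)) => //.
- rewrite subr_eq0; apply/eqP => /(congr1 (fun q : {poly k} => size q)).
  by rewrite size_exp_XsubC size_poly1.
- rewrite rmorphB rmorphXn rmorphB /= map_polyX map_polyC /= rmorph1 hornerD hornerN.
  rewrite horner_exp hornerXsubC hornerC scaleNr scale1r opprK subrK.
  by rewrite -ch_valMn gn subrr.
by rewrite rmorphB rmorph1 /= /counit_scalar (ch_valP g).2 scale1r subrr.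
Qed.

End Characters.

(** * The grading of the ring of semiinvariants *)

Section SemiinvariantRing.
Variables (k : fieldType) (G : affineGroup k) (S : idomAlgType k) (omega : coaction G S).
Local Notation A := (coordRing G).
Local Notation B := (semiinv_ring omega).
Local Notation dS := (@idom_domain k S).
Implicit Types (g h : char_group G) (T : set (char_group G)) (s f : S).

Lemma homogeneousP s : homogeneous omega s <-> exists g, semiinvariants omega (ch_val g) s.
Proof.
split=> [[chi hc Hs]|[g Hs]]; first by exists (to_char_group hc).
by exists (ch_val g); first exact: ch_valP.
Qed.

Lemma homogeneous_in s : homogeneous omega s -> s \in in_semiinv_ring omega.
Proof.
by move=> hs; apply/asboolP; exists [:: s]; rewrite ?big_seq1 // => x; rewrite inE => /eqP ->.
Qed.

Lemma semiinv_ringP s : s \in in_semiinv_ring omega <->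
  exists2 r : seq (char_group G * S),
    {in r, forall q, semiinvariants omega (ch_val q.1) q.2} & s = \sum_(q <- r) q.2.
Proof.
split=> [/asboolP[r + ->]|[r Hr ->]].
  elim: r => [|x r IH] Hr; first by exists [::]; rewrite ?big_nil.
  have [|t Ht Et] := IH; first by move=> y yr; apply: Hr; rewrite inE yr orbT.
  have /homogeneousP[g Hg] := Hr x (mem_head _ _).
  exists ((g, x) :: t); last by rewrite !big_cons Et.
  by move=> q; rewrite inE => /orP[/eqP ->|/Ht].
apply/asboolP; exists [seq q.2 | q <- r]; last by rewrite big_map.
by move=> _ /mapP[q /Hr Hq ->]; apply/homogeneousP; exists q.1.
Qed.

Lemma semiinvariants0 chi : semiinvariants omega chi 0.
Proof. by rewrite /semiinvariants /= rmorph0 tens0l. Qed.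

Lemma semiinvariantsD chi s t : semiinvariants omega chi s -> semiinvariants omega chi t ->
  semiinvariants omega chi (s + t).
Proof. by rewrite /semiinvariants /= => Hs Ht; rewrite rmorphD /= Hs Ht tensDl. Qed.

Definition degree_form T : A -> k :=
  sval (cid2 (character_form [set ch_val g | g in T])).

Lemma degree_formP T : linear_form (degree_form T).
Proof. exact: (svalP (cid2 (character_form [set ch_val g | g in T]))).1. Qed.

Lemma degree_form_ch T g : degree_form T (ch_val g) = (`[< T g >])%:R.
Proof.
rewrite /degree_form (svalP (cid2 (character_form [set ch_val g | g in T]))).2; last exact: ch_valP.
congr (_ (nat_of_bool _)); apply/asboolP/asboolP => [[h Th /val_inj <-]//|Tg].
by exists g.
Qed.

(* The projection of [S_G] to its components of degree in [T], defined on all of [S]. *)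
Definition degree_proj T s : S := slice (degree_form T) (omega s).

Lemma degree_projD T s t : degree_proj T (s + t) = degree_proj T s + degree_proj T t.
Proof. by rewrite /degree_proj rmorphD sliceD //; exact: degree_formP. Qed.

Lemma degree_proj0 T : degree_proj T 0 = 0.
Proof. by rewrite /degree_proj rmorph0 slice0 //; exact: degree_formP. Qed.

Lemma degree_proj_hom T g s : semiinvariants omega (ch_val g) s ->
  degree_proj T s = if `[< T g >] then s else 0.
Proof.
move=> Hs; rewrite /degree_proj Hs slice_tens; last exact: degree_formP.
by rewrite degree_form_ch; case: asboolP => _; rewrite ?scale1r ?scale0r.
Qed.

Definition component g : set B := [set a | semiinvariants omega (ch_val g) (sr_val a)].

Lemma semiinv_ring_spanned (a : B) : exists2 r : seq (char_group G * B),
  {in r, forall q, component q.1 q.2} & a = \sum_(q <- r) q.2.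
Proof.
have /semiinv_ringP[r Hr Er] := sr_val_in a; elim: r a Hr Er => [|q r IH] a Hr Er.
  by exists [::] => //; apply: sr_val_inj; rewrite Er !big_nil.
have Hq := Hr q (mem_head _ _).
have hq : homogeneous omega q.2 by apply/homogeneousP; exists q.1.
pose b : B := SubRing (homogeneous_in hq).
have [||t Ht Et] := IH (a - b).
- by move=> p pr; apply: Hr; rewrite inE pr orbT.
- by rewrite -[sr_val (a - b)]/(sr_val a - q.2) Er big_cons addrC addKr.
exists ((q.1, b) :: t); last by rewrite big_cons -Et addrC subrK.
by move=> p; rewrite inE => /orP[/eqP ->|/Ht].
Qed.

Fact degree_proj_in T (a : B) : degree_proj T (sr_val a) \in in_semiinv_ring omega.
Proof.
have [r Hr ->] := semiinv_ring_spanned a; rewrite sr_val_sum.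
rewrite (big_morph _ (degree_projD T) (degree_proj0 T)).
suff -> : \sum_(q <- r) degree_proj T (sr_val q.2) =
    sr_val (\sum_(q <- r | `[< T q.1 >]) q.2) by exact: sr_val_in.
rewrite sr_val_sum [RHS]big_mkcond; apply: eq_big_seq => q /Hr Hq.
exact: degree_proj_hom.
Qed.

Definition component_proj T (a : B) : B := SubRing (degree_proj_in T a).

Lemma semiinv_grading : grading component component_proj.
Proof.
do 2?split.
- exact: (rmorph1 omega).
- move=> g h x y; rewrite /component /semiinvariants /= rmorphM /= => -> ->.
  by rewrite tens_mul.
- by move=> g x y; apply: semiinvariantsD.
- exact: semiinv_ring_spanned.
- by move=> T x y; apply: sr_val_inj; apply: degree_projD.
- by move=> T g x Hx Tg; apply: sr_val_inj; rewrite /= (degree_proj_hom T Hx); case: asboolP.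
- by move=> T g x Hx Tg; apply: sr_val_inj; rewrite /= (degree_proj_hom T Hx); case: asboolP.
Qed.

Lemma coact_div f g s : semiinvariants omega (ch_val g) f ->
  (f ⊗ 1) * omega s = (1 ⊗ ch_val (- g)) * omega (f * s).
Proof.
move=> Hf; have -> : omega (f * s) = omega f * omega s by exact: rmorphM.
rewrite mulrA; congr (_ * _); rewrite Hf tens_mul mul1r; congr (_ ⊗ _).
by rewrite -ch_valD addNr ch_val0.
Qed.

Lemma idom_lreg f : f <> 0 -> forall x y, f * x = f * y -> x = y.
Proof. exact: domain_lreg dS f. Qed.

Lemma homogeneous_divr f s : f <> 0 -> homogeneous omega f -> homogeneous omega (f * s) ->
  homogeneous omega s.
Proof.
move=> f0 /homogeneousP[g Hf] /homogeneousP[h Hfs]; apply/homogeneousP; exists (h - g).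
apply: (tensorM_lreg (idom_lreg f0)).
rewrite (coact_div s Hf) Hfs !tens_mul !mul1r; congr (_ ⊗ _).
by rewrite -ch_valD addrC.
Qed.

(** Because [f] has one degree [g], multiplying a projection of [s] by [f] gives the components of
    [f * s] in degrees shifted by [g]. So the finitely many nonzero projections of [s] are
    homogeneous and sum to [s]. Divisibility by homogeneous elements is thereby the same in [S] and
    in [S_G]. *)
Lemma semiinv_divr f s : f <> 0 -> homogeneous omega f ->
  f * s \in in_semiinv_ring omega -> s \in in_semiinv_ring omega.
Proof.
move=> f0 hf /semiinv_ringP[r Hr Er]; have /homogeneousP[g Hf] := hf.
have E T : f * degree_proj T s = \sum_(q <- r | `[< T (q.1 - g) >]) q.2.
  have lP := degree_formP T; rewrite /degree_proj -slice_mull // (coact_div s Hf) Er.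
  have -> : omega (\sum_(q <- r) q.2) = \sum_(q <- r) omega q.2 by exact: rmorph_sum.
  rewrite mulr_sumr slice_sum // [RHS]big_mkcond.
  apply: eq_big_seq => q /Hr Hq; rewrite Hq tens_mul mul1r slice_tens //.
  rewrite -ch_valD addrC degree_form_ch.
  by case: asboolP => _; rewrite ?scale1r ?scale0r.
pose D := undup [seq q.1 - g | q <- r].
apply/asboolP; exists [seq degree_proj [set d] s | d <- D].
  move=> _ /mapP[d dD ->]; apply: (homogeneous_divr f0 hf); rewrite E.
  apply/homogeneousP; exists (d + g); rewrite big_seq_cond.
  apply: (big_ind (semiinvariants omega (ch_val (d + g)))).
  - exact: semiinvariants0.
  - exact: semiinvariantsD.
  - by move=> q /andP[/Hr Hq /asboolP <-]; rewrite subrK.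
rewrite big_map; apply: (idom_lreg f0); rewrite Er mulr_sumr.
under [RHS]eq_bigr => d _ do rewrite E.
rewrite (exchange_big_dep predT) //=; apply: eq_big_seq => q qr.
rewrite (eq_bigl (pred1 (q.1 - g))) => [|d]; last first.
  by apply/asboolP/eqP.
rewrite -big_filter filter_pred1_uniq ?big_seq1 ?undup_uniq //.
by rewrite mem_undup (map_f (fun q => q.1 - g)).
Qed.

End SemiinvariantRing.

Lemma principal_prime_element (R : comNzRingType) (f : R) : f <> 0 ->
  is_prime_ideal (principal f) -> prime_element f.
Proof. by move=> f0 [_ f1 fp]; split=> // -[u fu]; apply: f1; exists u; rewrite mulrC. Qed.

(** The ring type [subring] depends on the bundled structure, so identifying invariants with
    semiinvariants needs the closure proofs to agree as well. *)
Lemma subring_closed_eq (R : pzRingType) (X Y : subringClosed R) :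
  (X : {pred R}) =i (Y : {pred R}) -> X = Y.
Proof.
case: X => X [[a] [b] [c] [d]]; case: Y => Y [[a'] [b'] [c'] [d']] /= XY.
have E : X = Y by apply/funext => x; exact: XY x.
rewrite {XY}; case: _ / E a' b' c' d' => a' b' c' d'.
by rewrite (Prop_irrelevance a a') (Prop_irrelevance b b') (Prop_irrelevance c c')
  (Prop_irrelevance d d').
Qed.

(** * Factoriality of the ring of semiinvariants *)

Section Factoriality.
Variables (k : fieldType) (G : affineGroup k).
Hypotheses (G_smooth : smooth (coordRing G)) (G_connected : Spec_connected (coordRing G)).
Variables (S : idomAlgType k) (omega : coaction G S).
Hypothesis S_finite_type : finite_type S.
Hypothesis X_surjective : forall u : base_change (base_closure S) (coordRing G),
  character_base_change u ->
  exists2 chi : coordRing G, character chi & to_base_change (base_closure S) chi = u.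
Hypothesis special_principal : forall P : set S, special_prime omega P ->
  exists f : S, P = principal f.
Local Notation B := (semiinv_ring omega).
Local Notation dS := (@idom_domain k S).
Implicit Types (a b e x y : B) (P : set S) (f s : S).

Lemma semiinv_domain : is_domain B.
Proof.
by move=> x y /(congr1 (@sr_val _ _)) /dS[x0|y0]; [left | right]; apply: sr_val_inj.
Qed.

Lemma sr_val_neq0 x : x <> 0 -> sr_val x <> 0.
Proof. by move=> x0 E; apply: x0; apply: sr_val_inj. Qed.

Lemma homogeneous_stable f : homogeneous omega f -> stable_ideal omega (principal f).
Proof.
move=> [chi hc Hf]; split; first exact: principal_ideal.
move=> _ [r ->]; exists [seq (p.1 * f, p.2 * chi) | p <- repr (omega r)].
  by move=> _ /mapP[p _ ->]; exists p.1.
have -> : omega (r * f) = omega r * omega f by exact: rmorphM.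
rewrite Hf {1}[omega r]tensor_sum mulr_suml big_map.
by apply: eq_bigr => p _; rewrite tens_mul.
Qed.

(** A unit generates the stable ideal [S], so it is homogeneous by [stable_principal_homogeneous];
    its inverse is then in [S_G] by [semiinv_divr]. *)
Lemma semiinv_unit a : is_unit (sr_val a) -> is_unit a.
Proof.
move=> [t at1]; have a0 : sr_val a <> 0.
  by move=> a0; move/eqP: at1; rewrite a0 mul0r eq_sym oner_eq0.
have ha : homogeneous omega (sr_val a).
  apply: stable_principal_homogeneous => //; split; first exact: principal_ideal.
  move=> s _; exists (repr (omega s)); last exact: tensor_sum.
  by move=> p _; exists (p.1 * t); rewrite -mulrA [t * _]mulrC at1 mulr1.
have ht : t \in in_semiinv_ring omega.
  apply: (semiinv_divr a0 ha); rewrite at1; exact: rpred1.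
by exists (SubRing ht); apply: sr_val_inj.
Qed.

(** A family of principal ideals is extended to the noetherian ring [S]. Equality of extended ideals
    makes the quotient of generators a unit of [S], hence of [S_G] by [semiinv_unit]. *)
Lemma semiinv_accp : accp B.
Proof.
move=> Q [x0 Qx0]; pose F := [set I : set S | exists2 x : B, Q x & I = principal (sr_val x)].
have [_ [x _ ->]||_ [x Qx ->] xmax] := finite_type_noetherian S_finite_type (Q := F).
- exact: principal_ideal.
- by exists (principal (sr_val x0)); exists x0.
exists x => // y Qy [r Er].
have [||s Es] := xmax (principal (sr_val y)) _ _ (sr_val y) (principal_refl _).
- by exists y.
- by move=> _ [s ->]; exists (s * sr_val r); rewrite Er sr_valM mulrA.
have [y0|y0] := pselect (y = 0); first by exists 0; rewrite y0 mul0r.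
have [|t rt] := @semiinv_unit r.
  exists s; apply: (idom_lreg (sr_val_neq0 y0)); rewrite mulr1 {2}Es Er sr_valM.
  by ring.
by exists t; rewrite Er mulrA [t * r]mulrC rt mul1r.
Qed.

Lemma sr_val_divides a x : sr_val a <> 0 -> homogeneous omega (sr_val a) ->
  principal (sr_val a) (sr_val x) -> divides a x.
Proof.
move=> a0 ha [r E]; have hr : r \in in_semiinv_ring omega.
  by apply: (semiinv_divr a0 ha); rewrite mulrC -E sr_val_in.
by exists (SubRing hr); apply: sr_val_inj.
Qed.

(** A minimal prime [Q] of [a] in [S_G] is the trace of some [P]: as [a] is homogeneous, the trace
    of [S a] is [S_G a], so [S a] avoids the complement of [Q] in [S_G]. A minimal prime of [S a]
    avoiding it has trace inside [Q], hence equal to [Q]. *)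
Lemma special_prime_over a : homogeneous omega (sr_val a) -> a <> 0 -> ~ is_unit a ->
  exists2 P, special_prime omega P & P (sr_val a).
Proof.
move=> ha a0 ua; have [d [l [hl hl0]]] := smooth_connected_coordinates G_smooth G_connected.
have sa0 := sr_val_neq0 a0.
have [Q0 hQ0 Q0a] := prime_of_nonunit ua.
have [|Q [hQ aQ Qmin] _] := @minimal_prime_below B (principal a) Q0 hQ0.
  by move=> _ [r ->]; apply: idealMl => //; apply: prime_ideal.
pose M : set S := [set x | exists2 b : B, ~ Q b & x = sr_val b].
have [|x y [b Qb ->] [c Qc ->]|_ [r ->] [b Qb E]|P0 [hP0 aP0 P0M]] :=
    @prime_avoiding S (principal (sr_val a)) M (principal_ideal _).
- by exists 1 => //; case: hQ.
- by exists (b * c) => //; case: hQ => _ _ H /H[].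
- by apply: Qb; apply: aQ; apply: sr_val_divides => //; exists r.
have [P mP PP0] := minimal_prime_below hP0 aP0; have [hP aP _] := mP.
exists P; last exact/aP/principal_refl.
split=> //.
- exact: (minimal_prime_stable hl hl0 (homogeneous_stable ha) mP).
- exact: (minimal_prime_height_one (finite_type_noetherian S_finite_type) dS sa0 mP).
exists a => //; suff -> : contraction P = Q by [].
apply: Qmin.
- have [[P_0 PD PM] P1 Pp] := hP; split; first split=> //.
  + by move=> x y; apply: PD.
  + by move=> x y; apply: PM.
  + by [].
  + by move=> x y; apply: Pp.
- by move=> x [r ->]; apply: aP; exists (sr_val r).
- by move=> x Px; apply: contrapT => Qx; apply: (P0M _ (PP0 _ Px)); exists x.
Qed.

Lemma homogeneous_prime_semiinv a : homogeneous omega (sr_val a) ->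
  prime_element (sr_val a) -> prime_element a.
Proof.
move=> ha [a0 ua pa]; split.
- by move=> E; apply: a0; rewrite E.
- by move=> [b ab]; apply: ua; exists (sr_val b); rewrite -sr_valM ab.
move=> x y [r E]; have [|H|H] := pa (sr_val x) (sr_val y).
- by exists (sr_val r); rewrite -!sr_valM E.
- by left; apply: sr_val_divides.
- by right; apply: sr_val_divides.
Qed.

Lemma special_prime_generator P : special_prime omega P -> exists a,
  [/\ homogeneous omega (sr_val a), prime_element (sr_val a) & P = principal (sr_val a)].
Proof.
move=> sP; have [f Pf] := special_principal sP; have [stP hP [[_ [Q hQ [QP nPQ]]] _] _] := sP.
(* Height one supplies a prime strictly below [P], so [P] is not the zero ideal. *)
have f0 : f <> 0.
  move=> f0; apply: nPQ; rewrite Pf f0 => _ [r ->]; rewrite mulr0.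
  exact: (ideal0 (prime_ideal hQ)).
have hf : homogeneous omega f by apply: stable_principal_homogeneous; rewrite -?Pf.
exists (SubRing (homogeneous_in hf)); split=> //; apply: principal_prime_element => //.
by rewrite -Pf.
Qed.

(** The generator of a special prime through [a] divides [a] in [S_G] and is no unit, so
    irreducibility makes it associate to [a]. *)
Lemma homogeneous_irreducible a : homogeneous omega (sr_val a) -> irreducible_element a ->
  prime_element (sr_val a).
Proof.
move=> ha [a0 ua ia]; have [P sP Pa] := special_prime_over ha a0 ua.
have [b [hb pb Pb]] := special_prime_generator sP.
have [r E] : divides b a by apply: sr_val_divides; rewrite -?Pb //; case: pb.
have [|[t rt]|ub] := ia r b; first exact: E.
  rewrite E sr_valM; apply: prime_associate => //; first exact: dS.
  by exists (sr_val t); rewrite -sr_valM rt.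
by have [_ + _] := homogeneous_prime_semiinv hb pb; case.
Qed.

Lemma semiinv_UFD : is_UFD B.
Proof.
apply: (irreducible_prime_UFD semiinv_domain semiinv_accp).
apply: (graded_irreducible_prime (semiinv_grading omega) semiinv_domain semiinv_accp).
- exact: char_group_torsion_free.
- by move=> g; apply: semiinvariants0.
move=> g a Ha ia; have ha : homogeneous omega (sr_val a) by apply/homogeneousP; exists g.
exact: homogeneous_prime_semiinv ha (homogeneous_irreducible ha ia).
Qed.

Lemma trivial_characters_inv : (forall chi : coordRing G, character chi -> chi = 1) ->
  forall s, (s \in in_inv_ring omega) = (s \in in_semiinv_ring omega).
Proof.
move=> X1 s; apply/eqP/idP => [Hs|/asboolP[r Hr ->]].
  by apply: homogeneous_in; exists 1; first exact: character1.
have -> : omega (\sum_(x <- r) x) = \sum_(x <- r) omega x by exact: rmorph_sum.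
by rewrite tens_suml; apply: eq_big_seq => x /Hr[chi /X1 -> ->].
Qed.

End Factoriality.

Theorem theorem4p26 (k : fieldType) (G : affineGroup k)
  (G_smooth : smooth (coordRing G))
  (G_connected : Spec_connected (coordRing G))
  (S : idomAlgType k) (omega : coaction G S)
  (S_finite_type : finite_type S)
  (X_surjective : forall u : base_change (base_closure S) (coordRing G),
     character_base_change u ->
     exists2 chi : coordRing G, character chi
       & to_base_change (base_closure S) chi = u)
  (special_principal : forall P : set S, special_prime omega P ->
     exists f : S, P = principal f) :
  [/\ forall P : set S, special_prime omega P ->
        exists f : semiinv_ring omega,
          [/\ homogeneous omega (sr_val f), prime_element f
            & P = principal (sr_val f)],
      is_UFD (semiinv_ring omega),
      forall f : semiinv_ring omega,
        homogeneous omega (sr_val f) -> prime_element f ->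
        prime_element (sr_val f)
    & (forall chi : coordRing G, character chi -> chi = 1) ->
      (forall s : S, (s \in in_inv_ring omega) = (s \in in_semiinv_ring omega))
      /\ is_UFD (inv_ring omega)].
Proof.
have gen := special_prime_generator G_smooth G_connected X_surjective special_principal.
have irr := homogeneous_irreducible G_smooth G_connected S_finite_type X_surjective special_principal.
have ufd := semiinv_UFD G_smooth G_connected S_finite_type X_surjective special_principal.
split=> //.
- move=> P /gen[f [hf pf ->]]; exists f; split=> //; exact: homogeneous_prime_semiinv.
- by move=> f hf pf; apply: irr => //; apply: prime_irreducible pf; apply: semiinv_domain.
move=> X1; have inv := trivial_characters_inv omega X1; split=> //.
suff -> : inv_ring omega = semiinv_ring omega by [].
by congr (subring _ : comNzRingType); apply: subring_closed_eq.
Qed.
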